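(* Let $k$ be a field and let $\Delta\subseteq\mathbb{R}^2$ be a $2$-dimensional lattice polygon of lattice width two. Let $N=\#(\Delta\cap\mathbb{Z}^2)$, let $N^{(1)}$ be the number of lattice points in the topological interior of $\Delta$, and let $A=N/2+N^{(1)}/2-1$ (the area of $\Delta$). Then the graded Betti numbers $\kappa_{p,q}$ of the toric surface $X_\Delta$ over $k$ are as follows: for all $p\ge0$ $$\kappa_{p,2}=\max(p-N+N^{(1)}+3,\,0)\binom{N-3}{p},$$ $$\kappa_{p,1}=\kappa_{p-1,2}+p\binom{N-1}{p+1}-2A\binom{N-3}{p-1},$$ (with $\kappa_{-1,2}=0$), $\kappa_{0,0}=1$, and all other $\kappa_{p,q}$ are zero.
   Context: The lattice width of a lattice polygon $\Delta$ is the minimum, over all non-zero linear forms $u:\mathbb{Z}^2\to\mathbb{Z}$ (extended linearly to $\mathbb{R}^2$), of $\max_{\Delta}u-\min_\Delta u$. For a lattice polygon $\Delta$ with lattice points $P_1,\dots,P_N$, the toric surface $X_\Delta\subseteq\mathbb{P}^{N-1}$ is the Zariski closure of the image of $(\mathbb{A}^1\setminus\{0\})^2\to\mathbb{P}^{N-1}$, $\lambda\mapsto(\lambda^{P_1}:\dots:\lambda^{P_N})$. Its homogeneous coordinate ring is $R=\bigoplus_{q\ge0}V_{q\Delta}$, where $V_{q\Delta}$ is the $k$-vector space with basis the Laurent monomials $x^m$, $m\in q\Delta\cap\mathbb{Z}^2$. The graded Betti number $\kappa_{p,q}$ ($p,q\ge0$) is the $k$-dimension of the degree $p+q$ part of $\mathrm{Tor}_p^{S^*V_\Delta}(R,k)$,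 where $S^*V_\Delta$ is the symmetric algebra of $V_\Delta$; equivalently the dimension of the homology at the middle term of the Koszul complex $\bigwedge^{p+1}V_\Delta\otimes V_{(q-1)\Delta}\to\bigwedge^{p}V_\Delta\otimes V_{q\Delta}\to\bigwedge^{p-1}V_\Delta\otimes V_{(q+1)\Delta}$ (with $V_{m\Delta}=0$ for $m<0$). Binomial coefficients $\binom{a}{b}$ with $b<0$ or $b>a\ge0$ are $0$. *)

(* Defs.v *)
From HB Require Import structures.
From mathcomp Require Import all_boot all_order all_algebra finmap.
From mathcomp Require Import boolp classical_sets cardinality reals topology normedtype.

Set Implicit Arguments.
Unset Strict Implicit.
Unset Printing Implicit Defensive.

Import Order.TTheory GRing.Theory Num.Theory.
Import numFieldNormedType.Exports.

Local Open Scope classical_set_scope.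
Local Open Scope ring_scope.

Section LatticePolygons.
Variable R : realType.

Definition lattice_embed (v : 'rV[int]_2) : 'rV[R]_2 := map_mx intr v.

Definition lattice_hull (n : nat) (v : 'I_n -> 'rV[int]_2) : set 'rV[R]_2 :=
  [set x | exists w : 'I_n -> R,
    [/\ forall i, 0 <= w i, \sum_i w i = 1
      & x = \sum_i w i *: lattice_embed (v i)]].

Definition lattice_polygon (D : set 'rV[R]_2) : Prop :=
  exists n (v : 'I_n -> 'rV[int]_2), D = lattice_hull v.

(* The affine hull of D is the whole plane. *)
Definition two_dimensional (D : set 'rV[R]_2) : Prop :=
  exists x y z, [/\ D x, D y, D z & free [:: y - x; z - x]].

(* The form Z^2 -> Z with coefficients u, extended linearly to R^2. *)
Definition linear_form (u : 'rV[int]_2) (x : 'rV[R]_2) : R :=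
  \sum_j (u 0 j)%:~R * x 0 j.

(* On a lattice polygon the supremum and the infimum are attained. *)
Definition directional_width (D : set 'rV[R]_2) (u : 'rV[int]_2) : R :=
  sup (linear_form u @` D) - inf (linear_form u @` D).

(* w is the minimum of the directional widths over the nonzero forms. *)
Definition has_lattice_width (D : set 'rV[R]_2) (w : R) : Prop :=
  (exists2 u, u != 0 & directional_width D u = w) /\
  (forall u, u != 0 -> w <= directional_width D u).

(* [fset_set] returns the empty set on infinite sets; the sets occurring below
   are bounded, hence contain finitely many lattice points. *)
Definition lattice_points (D : set 'rV[R]_2) : {fset 'rV[int]_2} :=
  fset_set (lattice_embed @^-1` D).

(* Empty for q < 0, in accordance with V_(q D) = 0 in negative degrees. *)
Definition dilate (q : int) (D : set 'rV[R]_2) : set 'rV[R]_2 :=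
  [set x | 0 <= q /\ exists2 y, D y & x = q%:~R *: y].

End LatticePolygons.

Section KoszulComplex.
Variables (R : realType) (k : fieldType) (D : set 'rV[R]_2).

(* The exterior power /\^p V_D has the basis e_A = x^a_1 /\ ... /\ x^a_p, where
   A = {a_1 < ... < a_p} runs over the p-element sets of lattice points of D,
   these being ordered by [enum_rank]. It vanishes for p < 0. *)
Definition wedge_basis (p : int) :=
  {A : {set lattice_points D} | #|A|%:Z == p}.

(* An element of /\^p V_D (x) V_(q D) is given by its coordinates in the basis
   e_A (x) x^m, with m a lattice point of q D. *)
Definition koszul (p q : int) :=
  {ffun wedge_basis p * lattice_points (dilate q D) -> k^o}.

(* The coefficient of e_B (x) x^n in the image of e_A (x) x^m, which is
   \sum_s (-1)^s e_(A \ a_s) (x) x^(m + a_s), with s counted from 0. *)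
Definition koszul_coef (p q p' q' : int)
    (Am : wedge_basis p * lattice_points (dilate q D))
    (Bn : wedge_basis p' * lattice_points (dilate q' D)) : k :=
  let A := val Am.1 in
  \sum_(a in A | (val Bn.1 == A :\ a) && (val Bn.2 == val Am.2 + val a))
     (-1) ^+ #|[set b in A | (enum_rank b < enum_rank a)%N]|.

Definition koszul_fun (p q p' q' : int) (f : koszul p q) : koszul p' q' :=
  [ffun Bn => \sum_Am koszul_coef Am Bn * f Am].

Fact koszul_fun_is_linear p q p' q' : linear (@koszul_fun p q p' q').
Proof.
move=> c f g; apply/ffunP => Bn; rewrite !ffunE scaler_sumr -big_split /=.
by apply: eq_bigr => Am _; rewrite !ffunE mulrDr /GRing.scale /= mulrCA.
Qed.

HB.instance Definition _ (p q p' q' : int) :=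
  GRing.isLinear.Build k (koszul p q) (koszul p' q') _ _
    (@koszul_fun_is_linear p q p' q').

(* This is the Koszul differential when p' = p - 1 and q' = q + 1; the target
   degrees are separate arguments only so that the image of one differential
   and the kernel of the next one are subspaces of the same space. *)
Definition koszul_diff (p q p' q' : int) : 'Hom(koszul p q, koszul p' q') :=
  linfun (@koszul_fun p q p' q').

End KoszulComplex.

(* The dimension of the homology at /\^p V_D (x) V_(q D); the subtraction in nat
   is exact since the image is contained in the kernel. *)
Definition kappa (R : realType) (k : fieldType) (D : set 'rV[R]_2)
    (p q : nat) : nat :=
  let: (p, q) := (p%:Z, q%:Z) in
  (\dim (lker (koszul_diff k D p q (p - 1) (q + 1)))
   - \dim (limg (koszul_diff k D (p + 1) (q - 1) p q)))%N.

(* 'C(a, b) for integers a and b, where it is 0 if b < 0 or 0 <= a < b; it is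
   only used with a >= 0. *)
Definition binomz (a b : int) : nat :=
  if (a, b) is (Posz m, Posz n) then 'C(m, n) else 0%N.

(* Main.v *)
(* In suitable coordinates a polygon of width two has its lattice points on three
   rows, so that its toric surface X lies in the threefold scroll Y swept out by the
   planes of a family of conics, and X is cut out in Y by y_0 y_2 - y_1^2. This gives
   an exact sequence 0 -> M(b)(-2) -> S_Y -> S_X -> 0, where M(b) is the module of
   sections of the twist by b fibres and b = N - N^(1) - 4. The Koszul homology of
   M(b) is concentrated in the degrees q = 0 and q = 1: cycles are made into
   boundaries by dividing by the variables at the end of each row, after enlarging
   the twist, and one returns to the original twist one fibre at a time. The
   dimensions follow by induction on b, starting from the vanishing of the cycles of
   degree q = 0 for b < p. In the long exact sequence all maps from the homology of
   M(b)(-2), which lives in q = 2 and q = 3, to that of S_Y, which lives in q = 0 and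
   q = 1, are zero, so that the Betti numbers of X are sums of those of Y and M(b). *)
Require Import Defs.
From HB Require Import structures.
From mathcomp Require Import all_boot all_order all_algebra finmap.
From mathcomp Require Import boolp classical_sets cardinality reals topology normedtype.
From mathcomp Require Import functions zify ring lra.
Set Implicit Arguments.
Unset Strict Implicit.
Unset Printing Implicit Defensive.
Import Order.TTheory GRing.Theory Num.Theory.
Import numFieldNormedType.Exports.
Local Open Scope classical_set_scope.
Local Open Scope ring_scope.

(** * Dimensions of subquotients *)

Section SubquotientDimension.
Variable k : fieldType.

(** Convexity enters through one inequality on each side ([lo_middle], [hi_middle]): the end of the
    middle row lies at most half a unit inside the midpoint of the ends of the outer rows. It has
    three uses. Lattice points of every dilate lift to monomials of the scroll. The twist satisfies
    b >= -1, the range in which it can be reached one fibre at a time. And the corrections by one in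
    the ends of the twist cancel against those in the ends of the row of interior points, which is
    where N^(1) enters b. The number N - 3 in the binomials counts the cells that are not first in
    their row; each of them gives one relation e_v - t e_v' with its left neighbour. Changing the
    twist and dividing by variables leave any fixed finite set of monomials. Hence chains are
    arbitrary functions on a group of exponents, graded modules are conditions on their supports,
    and dimensions are those of subquotients of infinite-dimensional spaces. The signs are treated
    so that characteristic 2 is included. *)

Definition is_subspace (V : lmodType k) (P : V -> Prop) : Prop :=
  P 0 /\ forall (c : k) x y, P x -> P y -> P (c *: x + y).

(** The dimension of Z/B in an ambient space that may be infinite-dimensional, witnessed by a family
    that is a basis of Z modulo B. *)
Definition subquotient_dim (V : lmodType k) (Z B : V -> Prop) (n : nat) : Prop :=
  exists (J : finType) (f : J -> V),
    [/\ #|J| = n, forall j, Z (f j),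
        forall c : J -> k, B (\sum_j c j *: f j) -> forall j, c j = 0
      & forall z, Z z -> exists c : J -> k, B (z - \sum_j c j *: f j)].

Section Subspace.
Variables (V : lmodType k) (P : V -> Prop).
Hypothesis subP : is_subspace P.

Lemma subspace0 : P 0. Proof. exact: subP.1. Qed.

Lemma subspaceZ c x : P x -> P (c *: x).
Proof. by move=> Px; rewrite -[c *: x]addr0; apply: subP.2 => //; exact: subP.1. Qed.

Lemma subspaceD x y : P x -> P y -> P (x + y).
Proof. by move=> Px Py; rewrite -[x]scale1r; apply: subP.2. Qed.

Lemma subspaceB x y : P x -> P y -> P (x - y).
Proof.
by move=> Px Py; apply: subspaceD => //; rewrite -scaleN1r; apply: subspaceZ.
Qed.

Lemma subspace_sum (J : finType) (f : J -> V) :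
  (forall j, P (f j)) -> P (\sum_j f j).
Proof.
by move=> Pf; elim/big_ind: _ => //; [exact: subspace0 | exact: subspaceD].
Qed.

End Subspace.

Lemma subquotient_dim_eq0 (V : lmodType k) (Z B : V -> Prop) :
  (forall z, Z z -> B z) -> subquotient_dim Z B 0.
Proof.
move=> ZB; exists void, (fun _ => 0); split=> //; first exact: card_void.
by move=> z /ZB Bz; exists (fun _ => 0); rewrite big1 ?subr0 // => -[].
Qed.

Lemma subspace_eq0 (V : lmodType k) : is_subspace (fun z : V => z = 0).
Proof. by split=> // c x y -> ->; rewrite scaler0 addr0. Qed.

Lemma eq_subquotient_dim (V : lmodType k) (Z B Z' B' : V -> Prop) n :
  (forall z, Z z <-> Z' z) -> (forall z, B z <-> B' z) ->
  subquotient_dim Z B n -> subquotient_dim Z' B' n.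
Proof.
move=> ZZ BB [J [f [Jn Zf free_f span_f]]]; exists J, f; split=> //.
- by move=> j; apply/ZZ.
- by move=> c /BB; exact: free_f.
- by move=> z /ZZ/span_f[c Bc]; exists c; apply/BB.
Qed.

(** Brings homology computed with unrestricted chains back to the finite-dimensional Koszul
    spaces. *)
Lemma subquotient_dim_preim (U V : lmodType k) (phi : {linear U -> V})
    (Z B : V -> Prop) n :
  (forall z, Z z -> exists u, phi u = z) -> subquotient_dim Z B n ->
  subquotient_dim (fun u => Z (phi u)) (fun u => B (phi u)) n.
Proof.
move=> surj [J [f [Jn Zf free_f span_f]]].
have /boolp.choice[u uE] j : exists u, phi u = f j by exact: surj.
have sumE (c : J -> k) : phi (\sum_j c j *: u j) = \sum_j c j *: f j.
  by rewrite linear_sum; apply: eq_bigr => j _; rewrite linearZ /= uE.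
exists J, u; split=> // [j|c|z /span_f[c Bc]]; first by rewrite uE.
  by rewrite sumE; exact: free_f.
by exists c; rewrite linearB /= sumE.
Qed.

(* The relation [r] plays the part of the connecting map of the snake lemma,
   which is well defined only on homology classes. *)
Lemma subquotient_dim_snake (V1 V V2 : lmodType k)
    (Z1 B1 : V1 -> Prop) (Z B : V -> Prop) (Z2 B2 : V2 -> Prop)
    (i : {linear V1 -> V}) (r : V -> V2 -> Prop) n1 n2 :
  is_subspace Z1 -> is_subspace Z ->
  is_subspace B -> is_subspace B2 ->
  (forall c z z' y y', r z y -> r z' y' -> r (c *: z + z') (c *: y + y')) ->
  (forall z, Z1 z -> Z (i z) /\ r (i z) 0) ->
  (forall z, B1 z -> B (i z)) ->
  (forall z, Z1 z -> B (i z) -> B1 z) ->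
  (forall z y, Z z -> r z y -> B2 y -> exists2 z1, Z1 z1 & B (z - i z1)) ->
  (forall z, Z z -> exists2 y, Z2 y & r z y) ->
  (forall y, Z2 y -> exists z y', [/\ Z z, r z y' & B2 (y - y')]) ->
  (forall z y, B z -> r z y -> B2 y) ->
  subquotient_dim Z1 B1 n1 -> subquotient_dim Z2 B2 n2 ->
  subquotient_dim Z B (n1 + n2).
Proof.
move=> sZ1 sZ sB sB2 rlin iZ iB iBV rker rtot rsur rB.
case=> J1 [f1 [<- Zf1 free1 span1]] [J2 [f2 [<- Zf2 free2 span2]]].
have /boolp.choice[F HF] (j : J2) : exists F : V * V2,
    [/\ Z F.1, r F.1 F.2 & B2 (f2 j - F.2)].
  by have [z [y' ?]] := rsur _ (Zf2 j); exists (z, y').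
have r0 : r 0 0.
  by have := (iZ _ (subspace0 sZ1)).2; rewrite linear0.
have rsum (c : J2 -> k) :
    r (\sum_j c j *: (F j).1) (\sum_j c j *: (F j).2).
  elim/big_ind2: _ => [//|x1 x2 y1 y2 rx ry|j _].
    by rewrite -[x1]scale1r -[x2]scale1r; apply: rlin.
  by rewrite -[X in r X]addr0 -[X in r _ X]addr0; apply: rlin => //; have [] := HF j.
have B2sum (c : J2 -> k) : B2 (\sum_j c j *: f2 j - \sum_j c j *: (F j).2).
  rewrite -sumrB; apply: subspace_sum => // j.
  by rewrite -scalerBr; apply: subspaceZ => //; have [] := HF j.
exists (J1 + J2)%type, (fun j => match j with inl j => i (f1 j) | inr j => (F j).1 end).
split.
- by rewrite card_sum.
- by case=> j; [exact: (iZ _ (Zf1 j)).1 | have [] := HF j].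
- move=> c; rewrite big_sumType /= => Bc.
  have c2 : forall j, c (inr j) = 0.
    apply: free2; rewrite -[X in B2 X](subrK (\sum_j c (inr j) *: (F j).2)).
    apply: subspaceD => //; apply: (rB _ _ Bc).
    rewrite -[X in r _ X]add0r.
    under eq_bigr do rewrite -linearZ.
    rewrite -linear_sum -[i _]scale1r -[X in r _ (X + _)](scaler0 _ 1).
    apply: rlin => //; apply: (iZ _ _).2; apply: subspace_sum => // j.
    exact: subspaceZ.
  move: Bc; rewrite [X in _ + X]big1 ?addr0 => [|j _]; last by rewrite c2 scale0r.
  under eq_bigr do rewrite -linearZ.
  rewrite -linear_sum => Bc.
  have c1 := free1 (fun j => c (inl j)) (iBV _ _ Bc).
  case=> j //; apply: c1; apply: subspace_sum => // ?; exact: subspaceZ.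
- move=> z Zz; have [y Zy rzy] := rtot z Zz; have [c2 B2c] := span2 _ Zy.
  (* After the lifted combination is subtracted, the image is zero modulo [B2], so that the rest
     comes from [Z1]. *)
  pose z' := z - \sum_j c2 j *: (F j).1.
  pose y' := y - \sum_j c2 j *: (F j).2.
  have Zz' : Z z'.
    apply: subspaceB => //; apply: subspace_sum => // j; apply: subspaceZ => //.
    by have [] := HF j.
  have rz'y' : r z' y'.
    rewrite /z' /y' addrC [y - _]addrC -scaleN1r -[X in r _ (X + _)]scaleN1r.
    exact: rlin.
  have B2y' : B2 y'.
    rewrite /y' -[y](subrK (\sum_j c2 j *: f2 j)) -addrA.
    exact: subspaceD.
  have [z1 Zz1 Bz1] := rker _ _ Zz' rz'y' B2y'; have [c1 B1c] := span1 _ Zz1.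
  exists (fun j => match j with inl j => c1 j | inr j => c2 j end).
  rewrite big_sumType /=.
  have -> : z - (\sum_j c1 j *: i (f1 j) + \sum_j c2 j *: (F j).1) =
     (z' - i z1) + i (z1 - \sum_j c1 j *: f1 j).
    rewrite linearB linear_sum addrA subrK.
    under [in RHS]eq_bigr do rewrite linearZ.
    by rewrite /z' opprD addrA addrAC.
  by apply: subspaceD => //; exact: iB.
Qed.

Lemma subquotient_dim_vspace (V : vectType k) (U W : {vspace V}) n :
  (W <= U)%VS ->
  subquotient_dim (fun z => z \in U) (fun z => z \in W) n ->
  (\dim U - \dim W)%N = n.
Proof.
move=> WU [J [f [<- Uf free_f span_f]]].
pose e := [tuple f (enum_val i) | i < #|J|].
have sumE (c : 'I_#|J| -> k) :
    \sum_i c i *: e`_i = \sum_j c (enum_rank j) *: f j.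
  rewrite [RHS](reindex (@enum_val J predT)) /=; last first.
    by apply: onW_bij; exact: enum_val_bij.
  apply: eq_bigr => i _.
  by rewrite enum_valK (nth_map i) ?size_enum_ord // nth_ord_enum.
have free_e : free e.
  apply/freeP => c; rewrite sumE => c0 i.
  have := free_f (fun j => c (enum_rank j)).
  by rewrite c0 mem0v => /(_ isT (enum_val i)); rewrite enum_valK.
(* Independence modulo W and spanning modulo W make U the direct sum of W and the span of the
   family. *)
have We0 : (W :&: <<e>>)%VS = 0%VS.
  apply/eqP; rewrite -subv0; apply/subvP => x; rewrite memv_cap => /andP[Wx].
  move=> /coord_span xE; rewrite memv0 xE.
  rewrite xE sumE in Wx; have c0 := free_f _ Wx.
  by rewrite sumE big1 // => j _; rewrite c0 scale0r.
have UE : (W + <<e>>)%VS = U.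
  apply/eqP; rewrite eqEsubv; apply/andP; split.
    rewrite subv_add WU; apply/span_subvP => _ /mapP[i _ ->]; exact: Uf.
  apply/subvP => z /span_f[c Wc].
  rewrite -[z](subrK (\sum_j c j *: f j)); apply: memv_add => //.
  apply: memv_suml => j _; apply: memvZ; apply: memv_span.
  by apply/mapP; exists (enum_rank j); rewrite ?mem_enum // enum_rankK.
have := dimv_add_leqif W <<e>>%VS; rewrite We0 => /leqif_eq.
move: free_e; rewrite /free size_tuple => /eqP de.
have := dimv_sum_cap W <<e>>%VS; rewrite UE We0 dimv0 addn0 de => ->.
by rewrite addKn.
Qed.

End SubquotientDimension.

(** * Koszul complexes of translations *)

Section TranslationKoszul.
Variables (k : fieldType) (I : finType) (G : zmodType) (g : I -> G).

(* [z A x] is the coefficient of e_A (x) t^x. No finiteness is imposed: a graded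
   module is the space of functions supported in a given subset of [G]. *)
Definition kchain := {set I} -> G -> k^o.
Implicit Types (z : kchain) (A B : {set I}) (x h : G) (v w : I).

(** The sign of sorting e_v into its place in front of e_B. *)
Definition wedge_sign v B : k :=
  (-1) ^+ #|[set b in B | (enum_rank b < enum_rank v)%N]|.

Definition translate h z : kchain := fun A x => z A (x - h).

(** Interior product with the vector dual to e_v, read off on coefficients; [wedge] is the exterior
    product by e_v. *)
Definition contract v z : kchain :=
  fun B x => if v \in B then 0 else wedge_sign v B * z (v |: B) x.

Definition wedge v z : kchain :=
  fun A x => if v \in A then wedge_sign v A * z (A :\ v) x else 0.

Definition kdiff z : kchain :=
  fun B x => \sum_v contract v z B (x - g v).

Lemma chainP z (w : kchain) : (forall A x, z A x = w A x) -> z = w.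
Proof. by move=> zw; apply/funext => A; apply/funext => x. Qed.

Lemma wedge_signM v B : wedge_sign v B * wedge_sign v B = 1.
Proof. by rewrite -expr2 sqrr_sign. Qed.

Lemma wedge_signU v w B : w \notin B ->
  wedge_sign v (w |: B) =
  (-1) ^+ (enum_rank w < enum_rank v)%N * wedge_sign v B.
Proof.
move=> wB; rewrite /wedge_sign; case: (boolP (enum_rank w < enum_rank v)%N) => /= wv.
  rewrite -exprS; congr (_ ^+ _).
  suff -> : [set b in w |: B | (enum_rank b < enum_rank v)%N] =
     w |: [set b in B | (enum_rank b < enum_rank v)%N].
    by rewrite cardsU1 inE (negPf wB).
  apply/finset.setP => b; rewrite !inE; case: eqP => [->|] //=; rewrite wv.
rewrite mul1r; congr (_ ^+ #|pred_of_set _|).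
by apply/finset.setP => b; rewrite !inE; case: eqP => [->|] //=; rewrite (negPf wB) (negPf wv).
Qed.

Lemma wedge_signD v B : wedge_sign v (B :\ v) = wedge_sign v B.
Proof.
congr (_ ^+ #|pred_of_set _|); apply/finset.setP => b; rewrite !inE.
by case: eqP => [->|] //=; rewrite ltnn andbF.
Qed.

Lemma wedge_signU1 v B : wedge_sign v (v |: B) = wedge_sign v B.
Proof.
congr (_ ^+ #|pred_of_set _|); apply/finset.setP => b; rewrite !inE.
by case: eqP => [->|] //=; rewrite ltnn !andbF.
Qed.

Lemma rank_antisym v w : v != w ->
  (-1) ^+ (enum_rank v < enum_rank w)%N =
  - (-1) ^+ (enum_rank w < enum_rank v)%N :> k.
Proof.
move=> vw; have : enum_rank v != enum_rank w by rewrite (inj_eq enum_rank_inj).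
rewrite -val_eqE /= neq_ltn.
by case: ltngtP => //= _ _; rewrite ?expr0 ?expr1 ?opprK.
Qed.

Lemma contractC v w z : contract v (contract w z) = - contract w (contract v z).
Proof.
apply: chainP => B x; rewrite /contract !fctE /=.
have [<-|vw] := eqVneq v w.
  by rewrite finset.setU11; case: ifP; rewrite ?mulr0 ?oppr0.
rewrite !in_setU1 [w == v]eq_sym (negPf vw) /=.
case: (boolP (v \in B)) => vB; case: (boolP (w \in B)) => wB; rewrite ?mulr0 ?oppr0 //.
rewrite !wedge_signU // finset.setUCA (rank_antisym vw).
set a := (-1) ^+ _; ring.
Qed.

(** The Clifford relation between exterior and interior multiplication. *)
Lemma wedge_contract v w z :
  contract v (wedge w z) + wedge w (contract v z) = if v == w then z else 0.
Proof.
apply: chainP => B x; rewrite !fctE /contract /wedge.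
have [<-|vw] := eqVneq v w.
  rewrite finset.setU11 in_setD1 eqxx /= wedge_signU1.
  case: (boolP (v \in B)) => vB.
    by rewrite add0r wedge_signD mulrA wedge_signM mul1r finset.setD1K.
  by rewrite addr0 mulrA wedge_signM mul1r finset.setU1K.
rewrite in_setU1 in_setD1 [w == v]eq_sym (negPf vw) /=.
case: (boolP (v \in B)) => vB; case: (boolP (w \in B)) => wB; rewrite ?(mulr0, addr0) //.
have -> : (v |: B) :\ w = v |: (B :\ w).
  by apply/finset.setP => b; rewrite !inE; case: (b =P v) => [->|]; rewrite ?vw.
have E1 : wedge_sign w (v |: B) = (-1) ^+ (enum_rank v < enum_rank w)%N * wedge_sign w B.
  exact: wedge_signU.
have E2 : wedge_sign v B = (-1) ^+ (enum_rank w < enum_rank v)%N * wedge_sign v (B :\ w).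
  by rewrite -wedge_signU ?finset.setD11 // finset.setD1K.
rewrite E1 E2 (rank_antisym vw).
set a := (-1) ^+ _; have : a * a = 1 by rewrite -expr2 sqrr_sign.
move=> aa; rewrite -[RHS]/(0 : k); ring: aa.
Qed.

Lemma translate0 z : translate 0 z = z.
Proof. by apply: chainP => A x; rewrite /translate subr0. Qed.

Lemma translateD h h' z : translate h (translate h' z) = translate (h + h') z.
Proof. by apply: chainP => A x; rewrite /translate opprD addrA. Qed.

Lemma contract_translate v h z :
  contract v (translate h z) = translate h (contract v z).
Proof. by []. Qed.

Lemma wedge_translate v h z :
  wedge v (translate h z) = translate h (wedge v z).
Proof. by []. Qed.

Lemma diffE z : kdiff z = \sum_v translate (g v) (contract v z).
Proof.
apply: chainP => B x.
have E (F : I -> kchain) : (\sum_v F v) B x = \sum_v F v B x.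
  by elim/big_rec2: _ => // v y1 y2 _ <-; rewrite !fctE.
by rewrite E.
Qed.

Lemma chain_sumE (J : Type) (r : seq J) (P : pred J) (F : J -> kchain) B x :
  (\sum_(j <- r | P j) F j) B x = \sum_(j <- r | P j) F j B x.
Proof. by elim/big_rec2: _ => // v y1 y2 _ <-; rewrite !fctE. Qed.

Lemma contract_linear v : linear (contract v).
Proof.
move=> c z w; apply: chainP => A x; rewrite !fctE /contract /=.
by case: ifP => _; rewrite ?scaler0 ?addr0 // mulrDr /GRing.scale /= mulrCA.
Qed.

Lemma wedge_linear v : linear (wedge v).
Proof.
move=> c z w; apply: chainP => A x; rewrite !fctE /wedge /=.
by case: ifP => _; rewrite ?scaler0 ?addr0 // mulrDr /GRing.scale /= mulrCA.
Qed.

Lemma translate_linear h : linear (translate h).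
Proof. by []. Qed.

HB.instance Definition _ v :=
  GRing.isLinear.Build k kchain kchain _ (contract v) (@contract_linear v).
HB.instance Definition _ v :=
  GRing.isLinear.Build k kchain kchain _ (wedge v) (@wedge_linear v).
HB.instance Definition _ h :=
  GRing.isLinear.Build k kchain kchain _ (translate h) (@translate_linear h).

Lemma translateB h z z' : translate h (z - z') = translate h z - translate h z'.
Proof. by []. Qed.

Lemma contract0 v : contract v 0 = 0. Proof. exact: linear0. Qed.
Lemma wedge0 v : wedge v 0 = 0. Proof. exact: linear0. Qed.

Lemma diff_linear : linear kdiff.
Proof.
move=> c z w; rewrite !diffE scaler_sumr -big_split /=.
by apply: eq_bigr => v _; rewrite !linearP.
Qed.
HB.instance Definition _ :=
  GRing.isLinear.Build k kchain kchain _ kdiff diff_linear.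

Lemma diff0 : kdiff 0 = 0. Proof. exact: linear0. Qed.

Lemma diffD z z' : kdiff (z + z') = kdiff z + kdiff z'.
Proof. exact: linearD. Qed.

Lemma diffB z z' : kdiff (z - z') = kdiff z - kdiff z'.
Proof. exact: linearB. Qed.

Lemma diffZ a z : kdiff (a *: z) = a *: kdiff z. Proof. exact: linearZ. Qed.

Lemma diffN z : kdiff (- z) = - kdiff z. Proof. exact: linearN. Qed.

Lemma diffP a z z' : kdiff (a *: z + z') = a *: kdiff z + kdiff z'.
Proof. exact: linearP. Qed.

Lemma diff_translate h z : kdiff (translate h z) = translate h (kdiff z).
Proof.
rewrite !diffE linear_sum /=; apply: eq_bigr => v _.
by rewrite contract_translate !translateD addrC.
Qed.

Lemma diff_contract v z : kdiff (contract v z) = - contract v (kdiff z).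
Proof.
rewrite !diffE linear_sum -sumrN /=; apply: eq_bigr => w _ /=.
by rewrite contractC linearN contract_translate.
Qed.

(** Multiplication by a generator is null-homotopic on the Koszul complex. Dividing by the generator
    turns this homotopy into a way of writing cycles as boundaries. *)
Lemma diff_wedge v z : kdiff (wedge v z) = translate (g v) z - wedge v (kdiff z).
Proof.
rewrite !diffE linear_sum /=; apply/eqP; rewrite eq_sym subr_eq -big_split /=.
rewrite (bigD1 v) //= wedge_translate -linearD wedge_contract eqxx /=.
rewrite big1 ?addr0 // => w wv.
by rewrite wedge_translate -linearD wedge_contract (negPf wv) linear0.
Qed.

Lemma contractK v z : contract v (contract v z) = 0.
Proof.
apply: chainP => B x; rewrite /contract finset.setU11 mulr0.
by case: ifP.
Qed.

Lemma diffK z : kdiff (kdiff z) = 0.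
Proof.
rewrite diffE (_ : \sum_v _ = \sum_v \sum_w
    translate (g v + g w) (contract v (contract w z))); last first.
  apply: eq_bigr => v _; rewrite diffE !linear_sum /=.
  by apply: eq_bigr => w _; rewrite contract_translate translateD.
apply: chainP => B x; rewrite chain_sumE.
pose F v w := (translate (g v + g w) (contract v (contract w z))) B x.
rewrite (eq_bigr (fun v => \sum_w F v w)); last by move=> v _; rewrite chain_sumE.
(* Antisymmetry alone would only show that twice the sum is zero. For characteristic 2 the diagonal
   is removed separately and the other terms are paired by rank. *)
have Fvv v : F v v = 0 by rewrite /F contractK linear0.
have FC v w : F v w = - F w v by rewrite /F contractC linearN addrC.
pose lt v w := (enum_rank v < enum_rank w)%N.
have split v : \sum_w F v w = \sum_(w | lt v w) F v w + \sum_(w | lt w v) F v w.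
  rewrite (bigID (lt v)) /=; congr (_ + _).
  rewrite (bigID (fun w => lt w v)) /= [X in _ + X]big1 ?addr0.
    by apply: eq_bigl => w; rewrite /lt -leqNgt andb_idl // => /ltnW.
  move=> w; rewrite /lt -!leqNgt => /andP[wv vw].
  suff -> : w = v by [].
  by apply/enum_rank_inj/val_inj/eqP => /=; rewrite eqn_leq wv vw.
rewrite (eq_bigr _ (fun v _ => split v)) big_split /=.
rewrite [X in _ + X](exchange_big_dep xpredT) //= -big_split /= big1 // => v _.
by rewrite -big_split /= big1 // => w _; rewrite FC addNr.
Qed.

(** All graded pieces of all modules become subspaces of one space of chains, so that passing to a
    larger module requires no map. *)
Definition supported (p : int) (S : G -> Prop) z :=
  forall A x, z A x != 0 -> #|A|%:Z = p /\ S x.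

Lemma supported0 p S : supported p S 0.
Proof. by move=> A x; rewrite eqxx. Qed.

Lemma supported_linear p S c z (w : kchain) :
  supported p S z -> supported p S w -> supported p S (c *: z + w).
Proof.
move=> Sz Sw A x; rewrite !fctE /=.
have [->|/Sz //] := eqVneq (z A x) 0.
by rewrite scaler0 add0r => /Sw.
Qed.

Lemma supportedD p S z (w : kchain) :
  supported p S z -> supported p S w -> supported p S (z + w).
Proof. by move=> Sz Sw; rewrite -[z]scale1r; apply: supported_linear. Qed.

Lemma supportedN p S z : supported p S z -> supported p S (- z).
Proof. by move=> Sz A x; rewrite !fctE oppr_eq0 => /Sz. Qed.

Lemma supportedB p S z (w : kchain) :
  supported p S z -> supported p S w -> supported p S (z - w).
Proof. by move=> Sz /supportedN; apply: supportedD. Qed.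

Lemma supportedW p S S' z :
  supported p S z -> (forall x, S x -> S' x) -> supported p S' z.
Proof. by move=> Sz SS A x /Sz[-> /SS]. Qed.

Lemma supported_out p S z A x : supported p S z -> ~ S x -> z A x = 0.
Proof. by move=> Sz nS; apply/eqP/negPn/negP => /Sz[]. Qed.

Lemma supported_translate p S S' h z :
  supported p S z -> (forall x, S x -> S' (x + h)) -> supported p S' (translate h z).
Proof. by move=> Sz SS A x /Sz[-> /SS]; rewrite subrK. Qed.

Lemma supported_contract p S v z :
  supported p S z -> supported (p - 1) S (contract v z).
Proof.
move=> Sz A x; rewrite /contract; case: ifPn => [|vA]; rewrite ?eqxx //.
have [->|/Sz[]] := eqVneq (z (v |: A) x) 0; first by rewrite mulr0 eqxx.
by rewrite cardsU1 vA => <- Sx _; split=> //; lia.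
Qed.

Lemma supported_wedge p S v z :
  supported p S z -> supported (p + 1) S (wedge v z).
Proof.
move=> Sz A x; rewrite /wedge; case: ifPn => [vA|]; rewrite ?eqxx //.
have [->|/Sz[]] := eqVneq (z (A :\ v) x) 0; first by rewrite mulr0 eqxx.
by rewrite (cardsD1 v A) vA => <- Sx _; split=> //; lia.
Qed.

Lemma supported_diff p S S' z : supported p S z ->
  (forall v x, S x -> S' (x + g v)) -> supported (p - 1) S' (kdiff z).
Proof.
move=> Sz SS; rewrite diffE.
elim/big_ind: _ => [|z1 z2|v _]; first exact: supported0.
  exact: supportedD.
by apply: supported_translate (supported_contract Sz) _ => x; exact: SS.
Qed.

Lemma contract_eq0 p S z : supported p S z -> 0 < p ->
  (forall v, contract v z = 0) -> z = 0.
Proof.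
move=> Sz p0 z0; apply: chainP => A x; apply/eqP/negPn/negP => zA.
have [Ap _] := Sz _ _ zA; have /card_gt0P[v vA] : (0 < #|A|)%N by lia.
have := congr1 (fun z => z (A :\ v) x) (z0 v); rewrite /contract finset.setD11 finset.setD1K //.
move=> /eqP; rewrite mulf_eq0 (negPf zA) orbF /wedge_sign expf_eq0 oppr_eq0.
by rewrite oner_eq0 andbF.
Qed.

Lemma supported_neg p S z : supported p S z -> p < 0 -> z = 0.
Proof.
move=> Sz p0; apply: chainP => A x; apply/eqP/negPn/negP => /Sz[Ap _]; lia.
Qed.

Lemma supported_empty p S z : supported p S z -> (forall x, ~ S x) -> z = 0.
Proof.
by move=> Sz nS; apply: chainP => A x; apply/eqP/negPn/negP => /Sz[_ /nS].
Qed.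

Definition cycle (S : int -> G -> Prop) (p q : int) z : Prop :=
  supported p (S q) z /\ kdiff z = 0.

Definition boundary (S : int -> G -> Prop) (p q : int) z : Prop :=
  exists2 w : kchain, supported (p + 1) (S (q - 1)) w & z = kdiff w.

Lemma boundary0 S p q : boundary S p q 0.
Proof. by exists 0; [exact: supported0 | rewrite linear0]. Qed.

Lemma cycle_subspace S p q : is_subspace (cycle S p q).
Proof.
split; first by split; [exact: supported0 | rewrite linear0].
move=> c x y [Sx dx] [Sy dy]; split; first exact: supported_linear.
by rewrite linearP /= dx dy scaler0 addr0.
Qed.

Lemma boundary_subspace S p q : is_subspace (boundary S p q).
Proof.
split; first exact: boundary0.
move=> c _ _ [x Sx ->] [y Sy ->].
by exists (c *: x + y); [exact: supported_linear | rewrite linearP].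
Qed.

End TranslationKoszul.

(** * Rational normal scrolls *)

Section Scroll.
Variables (k : fieldType) (I Rw : finType) (row : I -> Rw) (col : I -> int).
Variables (lo hi : Rw -> int).

(* The pair (m, i) stands for the monomial t^i y^m, and the generator indexed by
   [v] acts as multiplication by t^(col v) y_(row v). *)
Definition bidegree : zmodType := ({ffun Rw -> int} * int)%type.
Implicit Types (x : bidegree) (v w : I) (r : Rw) (A B : {set I}).

Definition cell v : bidegree := ([ffun r => (r == row v)%:Z], col v).

Definition degree x : int := \sum_r x.1 r.
(** Distance of the power of t from the least one that y^m admits in the untwisted ring; [below] is
    the distance from the greatest one. Both are additive in the monomial. *)
Definition above x : int := x.2 - \sum_r x.1 r * lo r.
Definition below x : int := \sum_r x.1 r * hi r - x.2.

(* The monomials of the degree q part of the module of sections of O(b) over the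
   rational normal scroll, where b = H - L. *)
Definition scroll (L H q : int) x : Prop :=
  [/\ forall r, 0 <= x.1 r, degree x = q, L <= above x & - H <= below x].

Hypothesis col_bounds : forall v, lo (row v) <= col v <= hi (row v).
Hypothesis cell_inj : forall v w, row v = row w -> col v = col w -> v = w.
Hypothesis cell_surj : forall r j, lo r <= j <= hi r ->
  exists2 v, row v = r & col v = j.
Hypothesis lo_le_hi : forall r, lo r <= hi r.

Lemma row_coordD x y r : (x + y).1 r = x.1 r + y.1 r.
Proof. by rewrite ffunE. Qed.

Lemma row_coordB x y r : (x - y).1 r = x.1 r - y.1 r.
Proof. by rewrite !ffunE. Qed.

Lemma row_coord_cell v r : (cell v).1 r = (r == row v)%:Z.
Proof. by rewrite ffunE. Qed.

Lemma degreeD x y : degree (x + y) = degree x + degree y.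
Proof. by rewrite -big_split; apply: eq_bigr => r _; exact: row_coordD. Qed.

Lemma degreeB x y : degree (x - y) = degree x - degree y.
Proof. by rewrite -sumrB; apply: eq_bigr => r _; exact: row_coordB. Qed.

Lemma aboveD x y : above (x + y) = above x + above y.
Proof.
rewrite /above addrACA -opprD -big_split; congr (_ - _).
by apply: eq_bigr => r _; rewrite row_coordD mulrDl.
Qed.

Lemma aboveB x y : above (x - y) = above x - above y.
Proof. by apply/eqP; rewrite eq_sym subr_eq -aboveD subrK. Qed.

Lemma belowD x y : below (x + y) = below x + below y.
Proof.
rewrite /below addrACA -opprD -big_split; congr (_ - _).
by apply: eq_bigr => r _; rewrite row_coordD mulrDl.
Qed.

Lemma sum_row_coord_cell v (f : Rw -> int) :
  \sum_r (cell v).1 r * f r = f (row v).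
Proof.
rewrite (bigD1 (row v)) //= row_coord_cell eqxx mul1r big1 ?addr0 // => r rv.
by rewrite row_coord_cell (negPf rv) mul0r.
Qed.

Lemma degree_cell v : degree (cell v) = 1.
Proof.
have := sum_row_coord_cell v (fun=> 1); rewrite /degree => <-.
by apply: eq_bigr => r _; rewrite mulr1.
Qed.

Lemma above_cell v : above (cell v) = col v - lo (row v).
Proof. by rewrite /above sum_row_coord_cell. Qed.

Lemma below_cell v : below (cell v) = hi (row v) - col v.
Proof. by rewrite /below sum_row_coord_cell. Qed.

Lemma above_cell_ge0 v : 0 <= above (cell v).
Proof. by rewrite above_cell; have := col_bounds v; lia. Qed.

Lemma below_cell_ge0 v : 0 <= below (cell v).
Proof. by rewrite below_cell; have := col_bounds v; lia. Qed.

Lemma scroll_cell L H q v x : scroll L H q x -> scroll L H (q + 1) (x + cell v).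
Proof.
case=> x0 tx Lx Hx; split=> [r|||].
- by rewrite row_coordD row_coord_cell addr_ge0.
- by rewrite degreeD tx degree_cell.
- by rewrite aboveD; have := above_cell_ge0 v; lia.
- by rewrite belowD; have := below_cell_ge0 v; lia.
Qed.

Lemma scrollW L L' H q x : L' <= L -> scroll L H q x -> scroll L' H q x.
Proof. by move=> LL [? ? ? ?]; split=> //; lia. Qed.

Lemma scroll_degree_ge0 L H q x : scroll L H q x -> 0 <= q.
Proof. by case=> x0 <- _ _; apply: sumr_ge0. Qed.

Lemma scroll_degree0 L H x : scroll L H 0 x -> [/\ x.1 = 0, L <= x.2 & x.2 <= H].
Proof.
case=> x0 tx; have x10 : x.1 = 0.
  apply/ffunP => r; rewrite ffunE; apply/eqP.
  move: tx => /eqP; rewrite /degree psumr_eq0 //.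
  by move/allP/(_ r); rewrite mem_index_enum => /(_ isT).
rewrite /above /below x10 !big1 ?subr0 ?sub0r ?lerN2 //.
all: by move=> r _; rewrite ffunE mul0r.
Qed.

Lemma scroll_degree0I L H j : L <= j <= H -> scroll L H 0 (0, j).
Proof.
move=> /andP[Lj jH]; split=> //=; first by move=> r; rewrite ffunE.
- by rewrite /degree big1 // => r _; rewrite ffunE.
- by rewrite /above big1 ?subr0 // => r _; rewrite ffunE mul0r.
- by rewrite /below big1 ?sub0r ?lerN2 // => r _; rewrite ffunE mul0r.
Qed.

Local Notation chain := (kchain k I bidegree).
Local Notation diff := (@kdiff k I bidegree cell).

Section Reduction.
(** [y r] is the cell by which row r is divided, [U] the region where the chain is required to be a
    cycle, and [S n] the support allowed after n enlargements. The two applications take for [U] the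
    bottom layer and the whole group. *)
Variables (y : Rw -> I) (U : pred bidegree) (S : nat -> int -> bidegree -> Prop).
Hypothesis row_y : forall r, row (y r) = r.
Hypothesis U_sub : forall x v, U x -> U (x - cell v).
Hypothesis U_add : forall x r, U x -> U (x + cell (y r)).
Hypothesis S_ge0 : forall n q x, S n q x -> forall r, 0 <= x.1 r.
Hypothesis S_total : forall n q x, S n q x -> degree x = q.
Hypothesis S_succ : forall n q x, S n q x -> S n.+1 q x.
Hypothesis S_cell : forall n q v x, S n q x -> S n (q + 1) (x + cell v).
Hypothesis S_sub : forall n q r x,
  S n q (x + cell (y r)) -> 0 <= x.1 r -> S n.+1 (q - 1) x.

(* [wedge (y r)] followed by division by the monomial [cell (y r)] is a
   contracting homotopy wherever the division is possible. *)
Lemma clear_rows p q (z : chain) (rs : seq Rw) :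
  supported p (S 0 q) z -> (forall A x, U x -> diff z A x = 0) ->
  exists n (w : chain),
    supported (p + 1) (fun x => S n (q - 1) x /\ U x) w /\
    forall A x, U x -> (z - diff w) A x != 0 -> forall r, r \in rs -> x.1 r = 0.
Proof.
move=> Sz dz; elim: rs => [|r rs [n [w [Sw wP]]]].
  by exists 0%N, 0; split; [exact: supported0|].
have S0n q' x : S 0 q' x -> S n q' x by elim: (n) => // m IH /IH; exact: S_succ.
pose z' : chain := z - diff w.
have Sz' : supported p (S n q) z'.
  apply: supportedB; first by apply: supportedW Sz _ => x; exact: S0n.
  rewrite -[p](addrK 1); apply: supported_diff Sw _ => v x [Sx _].
  by rewrite -[q](subrK 1); exact: S_cell.
have dz' A x : U x -> diff z' A x = 0.
  by move=> Ux; rewrite diffB diffK subr0 dz.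
pose h : chain := translate (- cell (y r)) (wedge (y r) z').
have hE B x : h B x = wedge (y r) z' B (x + cell (y r)).
  by rewrite /h /translate opprK.
have dh A x : U x -> diff h A x = z' A x.
  move=> Ux; rewrite /h diff_translate diff_wedge translateB translateD addNr.
  rewrite translate0 !fctE /translate opprK /wedge; case: ifP => _.
    by rewrite dz' ?mulr0 ?subr0 //; exact: U_add.
  by rewrite subr0.
(* Where the division would produce a negative exponent in row r, the homotopy is cut off. *)
pose w' : chain := fun A x => if U x && (0 <= x.1 r) then h A x else 0.
have Sw' : supported (p + 1) (fun x => S n.+1 (q - 1) x /\ U x) w'.
  move=> A x; rewrite /w'; case: ifPn => [/andP[Ux xr]|]; rewrite ?eqxx //.
  by rewrite hE => /(supported_wedge Sz')[-> Sx]; do 2!split=> //; exact: S_sub Sx xr.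
exists n.+1, (w + w'); split.
  apply: supportedD => //; apply: supportedW Sw _ => x [Sx Ux]; split=> //.
  exact: S_succ.
have -> : z - diff (w + w') = z' - diff w' by rewrite diffD opprD addrA.
move=> A x Ux ne.
have x0 : forall r', 0 <= x.1 r'.
  apply: (@S_ge0 n.+1 q).
  suff Sd : supported p (S n.+1 q) (z' - diff w') by have [] := Sd _ _ ne.
  apply: supportedB; first by apply: supportedW Sz' _ => ?; exact: S_succ.
  rewrite -[p](addrK 1); apply: supported_diff Sw' _ => v x' [Sx' _].
  by rewrite -[q](subrK 1); exact: S_cell.
suff main : (exists2 r', r' \in r :: rs & x.1 r' != 0) -> False.
  by move=> r' r'rs; apply/eqP/negPn/negP => xr'; apply: main; exists r'.
case=> r' r'rs xr'; case/negP: ne; rewrite !fctE subr_eq0 -dh // eq_sym.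
apply/eqP; apply: eq_bigr => v _.
rewrite /contract; case: ifP => // _; congr (_ * _); rewrite /w' U_sub // andTb.
case: ifPn => // /negP nr; rewrite hE /wedge; case: ifP => // _.
(* A term that was cut off belongs to a monomial without y_r, so its nonzero exponent r' is in a row
   cleared earlier. There [z'] vanishes, and cutting off has changed nothing. *)
have [rv xr0] : row v = r /\ x.1 r = 0.
  move: nr; rewrite row_coordB row_coord_cell; have := x0 r.
  by case: (r =P row v) => [<-|] /= ? ?; first split=> //; lia.
have r'r : r' != r by apply: contraNneq xr' => ->; rewrite xr0.
rewrite in_cons (negPf r'r) /= in r'rs.
set x' := _ + cell _; have Ux' : U x' by apply/U_add/U_sub.
have [->|nz] := eqVneq (z' ((v |: A) :\ y r) x') 0; first by rewrite mulr0.
move: (wP _ _ Ux' nz _ r'rs); rewrite row_coordD row_coordB !row_coord_cell.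
rewrite rv row_y subrK; move: xr'; by case: eqP.
Qed.

(** A monomial of degree q >= 1 has a nonzero exponent in some row, so nothing survives once all
    rows are cleared. *)
Lemma reduction p q (z : chain) : 1 <= q ->
  supported p (S 0 q) z -> (forall A x, U x -> diff z A x = 0) ->
  exists n (w : chain),
    supported (p + 1) (fun x => S n (q - 1) x /\ U x) w /\
    forall A x, U x -> (z - diff w) A x = 0.
Proof.
move=> q1 Sz dz; have [n [w [Sw wP]]] := clear_rows (enum Rw) Sz dz.
exists n, w; split=> // A x Ux; apply/eqP/negPn/negP => nz.
have Sd : supported p (S n q) (z - diff w).
  apply: supportedB.
    by apply: supportedW Sz _ => x'; elim: (n) => // m IH /IH; exact: S_succ.
  rewrite -[p](addrK 1); apply: supported_diff Sw _ => v x' [Sx' _].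
  by rewrite -[q](subrK 1); exact: S_cell.
have [_ /S_total] := Sd _ _ nz; rewrite /degree big1 => [|r _]; first by lia.
by apply: wP Ux nz _ _; rewrite mem_enum.
Qed.

End Reduction.

Lemma lo_cell : exists y : Rw -> I, forall r, row (y r) = r /\ col (y r) = lo r.
Proof.
have /boolp.choice[y yP] r : exists v, row v = r /\ col v = lo r.
  by have [|v] := @cell_surj r (lo r); [rewrite lexx lo_le_hi|exists v].
by exists y.
Qed.

Lemma hi_cell : exists y : Rw -> I, forall r, row (y r) = r /\ col (y r) = hi r.
Proof.
have /boolp.choice[y yP] r : exists v, row v = r /\ col v = hi r.
  by have [|v] := @cell_surj r (hi r); [rewrite lexx lo_le_hi|exists v].
by exists y.
Qed.

Lemma above_below_ge0 x : (forall r, 0 <= x.1 r) -> 0 <= above x + below x.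
Proof.
move=> x0; have -> : above x + below x = \sum_r x.1 r * (hi r - lo r).
  under eq_bigr do rewrite mulrBr.
  by rewrite sumrB /above /below addrC addrA subrK.
by apply: sumr_ge0 => r _; rewrite mulr_ge0 // subr_ge0 lo_le_hi.
Qed.

(* The quotient of the module [scroll L H] by [scroll (L + 1) H] is a polynomial
   ring in the first cells of the rows, on which the other cells act by 0. *)
Lemma bottom_reduction L H p q (z : chain) : L <= H -> 1 <= q ->
  supported p (scroll L H q) z ->
  (forall A x, above x <= L -> diff z A x = 0) ->
  exists2 w : chain, supported (p + 1) (scroll L H (q - 1)) w &
    supported p (scroll (L + 1) H q) (z - diff w).
Proof.
move=> LH q1 Sz dz; have [y yP] := lo_cell.
have ay r : above (cell (y r)) = 0.
  by have [ry cy] := yP r; rewrite above_cell cy ry subrr.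
pose S (n : nat) q x := [/\ forall r, 0 <= x.1 r, degree x = q & L <= above x].
have [] := @reduction y (fun x => above x <= L) S _ _ _ _ _ _ _ _ p q z q1.
- by move=> r; have [] := yP r.
- by move=> x v /=; rewrite aboveB; have := above_cell_ge0 v; lia.
- by move=> x r /=; rewrite aboveD ay addr0.
- by move=> n q' x [].
- by move=> n q' x [].
- by [].
- move=> n q' v x [x0 tx Lx]; split=> [r||].
  + by rewrite row_coordD row_coord_cell addr_ge0.
  + by rewrite degreeD tx degree_cell.
  + by rewrite aboveD; have := above_cell_ge0 v; lia.
- move=> n q' r x [x0 tx Lx] xr; split=> [r'||].
  + have [->//|r'r] := eqVneq r' r.
    have := x0 r'; rewrite row_coordD row_coord_cell (proj1 (yP r)).
    by rewrite (negPf r'r) addr0.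
  + by move: tx; rewrite degreeD degree_cell; lia.
  + by move: Lx; rewrite aboveD ay; lia.
- by apply: supportedW Sz _ => x [].
- exact: dz.
move=> n [w [Sw wP]].
have Sw' : supported (p + 1) (scroll L H (q - 1)) w.
  apply: supportedW Sw _ => x [[x0 tx Lx] Ux]; split=> //.
  by have := above_below_ge0 x0; lia.
exists w => // A x nz.
have Sd : supported p (scroll L H q) (z - diff w).
  apply: supportedB => //.
  rewrite -[p](addrK 1); apply: supported_diff Sw' _ => v x' Sx'.
  by rewrite -[q](subrK 1); exact: scroll_cell.
have [-> [x0 tx Lx Hx]] := Sd _ _ nz; split=> //; split=> //.
have [xL|] := leP (above x) L; last by lia.
by move/eqP: nz; rewrite wP.
Qed.

(* Clearing the rows with their last cells keeps the upper bound, at the expense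
   of the lower one. *)
Lemma boundary_below L H p q (z : chain) : 1 <= q ->
  supported p (scroll L H q) z -> diff z = 0 ->
  exists2 L', L' <= L & exists2 w : chain,
    supported (p + 1) (scroll L' H (q - 1)) w & z = diff w.
Proof.
move=> q1 Sz dz; have [y yP] := hi_cell.
(* Division by a last cell decreases [above] by at most D, which is the price in the lower bound for
   each row cleared. *)
pose D := \sum_r (hi r - lo r).
have ay r : above (cell (y r)) <= D.
  have [ry cy] := yP r; rewrite above_cell cy ry /D (bigD1 r) //= lerDl.
  by apply: sumr_ge0 => r' _; rewrite subr_ge0.
have by0 r : below (cell (y r)) = 0.
  by have [ry cy] := yP r; rewrite below_cell cy ry subrr.
have D0 : 0 <= D by apply: sumr_ge0 => r' _; rewrite subr_ge0.
pose S (n : nat) q x := scroll (L - D *+ n) H q x.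
have [] := @reduction y xpredT S _ _ _ _ _ _ _ _ p q z q1.
- by move=> r; have [] := yP r.
- by [].
- by [].
- by move=> n q' x [].
- by move=> n q' x [].
- by move=> n q' x; apply: scrollW; rewrite mulrSr; lia.
- by move=> n q' v x; exact: scroll_cell.
- move=> n q' r x [x0 tx Lx Hx] xr; split=> [r'|||].
  + have [->//|r'r] := eqVneq r' r.
    have := x0 r'; rewrite row_coordD row_coord_cell (proj1 (yP r)).
    by rewrite (negPf r'r) addr0.
  + by move: tx; rewrite degreeD degree_cell; lia.
  + by move: Lx (ay r); rewrite aboveD mulrSr; lia.
  + by move: Hx; rewrite belowD by0; lia.
- by rewrite /S mulr0n subr0.
- by move=> A x _; rewrite dz.
move=> n [w [Sw wP]]; exists (L - D *+ n).
  by rewrite lerBlDr lerDl mulrn_wge0.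
exists w; first by apply: supportedW Sw _ => x [].
apply: chainP => A x; have := wP A x isT; rewrite !fctE => /eqP.
by rewrite subr_eq0 => /eqP.
Qed.

End Scroll.

Definition posn (x : int) : nat := if x is Posz n then n else 0%N.

(** * Koszul cycles of degree zero and their leading coefficients *)

Section LowDegreeCycles.
Variables (k : fieldType) (I Rw : finType) (row : I -> Rw) (col : I -> int).
Variables (lo hi : Rw -> int).
Hypothesis col_bounds : forall v, lo (row v) <= col v <= hi (row v).
Hypothesis cell_inj : forall v w, row v = row w -> col v = col w -> v = w.
Hypothesis cell_surj : forall r j, lo r <= j <= hi r ->
  exists2 v, row v = r & col v = j.
Hypothesis lo_le_hi : forall r, lo r <= hi r.
Local Notation bidegree := (bidegree Rw).
Local Notation cell := (cell row col).
Local Notation scroll := (scroll lo hi).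
Local Notation chain := (kchain k I bidegree).
Local Notation diff := (@kdiff k I bidegree cell).
Local Notation cycle := (@cycle k I bidegree cell).
Local Notation boundary := (@boundary k I bidegree cell).
Implicit Types (x : bidegree) (v w : I) (r : Rw) (A B : {set I}) (z : chain).

(** In degree 0 no y occurs, so two terms of a differential can meet only if their generators lie in
    one row. *)
Lemma row_eq_of_degree0 L H v w x : x.1 = 0 ->
  scroll L H 0 (x + cell v - cell w) -> row v = row w /\ L <= x.2 + col v - col w.
Proof.
move=> x0 /scroll_degree0[/ffunP/(_ (row w)) p Lx _]; split=> //.
move: p; rewrite !ffunE x0 ffunE add0r eqxx [row w == _]eq_sym.
by case: eqP.
Qed.

(* The relation in the row of [v] expresses [contract v z] through the later cells
   of the row, hence [contract v z] is divisible by t. *)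
Lemma low_degree_cycle (n : nat) L H z : H - L < n%:Z ->
  cycle (scroll L H) n 0 z -> z = 0.
Proof.
elim: n L z => [|n IHn] L z HL [Sz dz].
  by apply: supported_empty Sz _ => x /scroll_degree0[_ Lx Hx]; lia.
apply: (contract_eq0 Sz) => // v.
(* Inner induction along the row, starting from its first cell. At the lowest power of t, only cells
   w to the left of v could cancel the term of v, and their contractions are already known to
   vanish. *)
have [m] : exists m : nat, col v - lo (row v) < m%:Z.
  by exists `|col v - lo (row v)|.+1; lia.
elim: m v => [|m IHm] v vm; first by have := col_bounds v; lia.
apply: (IHn (L + 1)); first by lia.
split; last by rewrite diff_contract dz contract0 oppr0.
have Sv : supported n (scroll L H 0) (contract v z).
  rewrite (_ : n%:Z = n.+1%:Z - 1); [exact: supported_contract | lia].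
move=> A x nz; have [An Sx] := Sv _ _ nz; split=> //.
have [x10 Lx Hx] := scroll_degree0 Sx.
rewrite [x]surjective_pairing x10; apply: scroll_degree0I; rewrite Hx andbT.
have [//|xL1] := leP (L + 1) x.2; have xL : x.2 = L by lia.
have /eqP := congr1 (fun z => z A (x + cell v)) dz; rewrite /diff.
rewrite (bigD1 v) //= addrK big1 ?addr0 ?(negPf nz) // => w wv.
have [->//|nzw] := eqVneq (contract w z A (x + cell v - cell w)) 0.
have [|rvw Lw] := @row_eq_of_degree0 L H v w x x10.
  by have [] := supported_contract Sz nzw.
rewrite IHm ?fctE //; have cvw : col v <> col w.
  by move=> cvw; case/eqP: wv; apply: cell_inj.
by move: vm; rewrite -rvw; lia.
Qed.

Definition free_cells : {set I} := [set v | col v != lo (row v)]%SET.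

(** A first cell v has no cell to its left, hence at t^L times v no other term can cancel the one
    coming from e_A. *)
Lemma bottom_coef_eq0 L H p z A v : supported p (scroll L H 0) z ->
  (forall A x, above lo x <= L -> diff z A x = 0) ->
  v \in A -> v \notin free_cells -> z A (0, L) = 0.
Proof.
move=> Sz dz vA; rewrite inE negbK => /eqP cv.
have := dz (A :\ v) ((0, L) + cell v).
rewrite aboveD above_cell cv subrr addr0 /above big1 ?subr0 => [|r _]; last first.
  by rewrite ffunE mul0r.
move=> /(_ (lexx _)); rewrite /diff (bigD1 v) //= addrK big1 ?addr0.
  rewrite /contract finset.setD11 finset.setD1K // => /eqP.
  by rewrite mulf_eq0 /wedge_sign signr_eq0 => /eqP.
move=> w wv; apply/eqP/negPn/negP => nzw.
have [|rvw Lw] := @row_eq_of_degree0 L H v w (0, L) erefl.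
  by have [] := supported_contract Sz nzw.
case/eqP: wv; apply: cell_inj => //; have := col_bounds w.
by rewrite -rvw -cv /= in Lw *; lia.
Qed.

(* The cycle is the wedge product of the e_v - t e_v', with v' the predecessor of v
   in its row. *)
Lemma bottom_cycle L (n : nat) A0 : #|A0| = n -> A0 \subset free_cells ->
  exists2 z, cycle (scroll L (L + n%:Z)) n 0 z &
    forall A, z A (0, L) = (A == A0)%:R.
Proof.
elim: n A0 => [|n IHn] A0 An Asub.
  exists (fun A x => ((A == A0) && (x == (0, L)))%:R); last first.
    by move=> A; rewrite eqxx andbT.
  rewrite (cards0_eq An); split.
    move=> A x; have [->|] := eqVneq A finset.set0; rewrite ?eqxx //=.
    have [->|] := eqVneq x (0, L); rewrite ?eqxx //= => _; rewrite cards0; split=> //.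
    by apply: scroll_degree0I; rewrite addr0 lexx.
  apply: chainP => A x; rewrite /diff big1 // => v _; rewrite /contract.
  case: ifP => // _; case: eqP => [/finset.setP/(_ v)|]; rewrite ?mulr0 //.
  by rewrite !inE eqxx.
have /card_gt0P[v vA] : (0 < #|A0|)%N by rewrite An.
have An1 : #|A0 :\ v| = n by have := cardsD1 v A0; rewrite vA; lia.
have [|z [Sz dz] zE] := IHn _ An1.
  by apply: fintype.subset_trans Asub; exact: subsetDl.
have [v' rv cv] : exists2 v', row v' = row v & col v' = col v - 1.
  apply: cell_surj; have := col_bounds v.
  by have := fintype.subsetP Asub _ vA; rewrite inE => /eqP; lia.
have cellE : cell v = (0, 1) + cell v'.
  by rewrite /cell rv cv; congr (_, _); [rewrite add0r | rewrite /=; lia].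
pose t : bidegree := (0, 1).
exists (wedge_sign k v A0 *: (wedge v z - translate t (wedge v' z))).
  split; last first.
    rewrite diffZ diffB diff_translate !diff_wedge dz !wedge0 !subr0.
    by rewrite translateD -cellE subrr scaler0.
  rewrite -[_ *: _]addr0; apply: supported_linear; last exact: supported0.
  have Sw u : supported n.+1 (scroll L (L + n%:Z) 0) (wedge u z).
    rewrite (_ : n.+1%:Z = n%:Z + 1); [exact: supported_wedge | lia].
  apply: supportedB.
    apply: supportedW (Sw v) _ => x [x0 tx Lx Hx]; split=> //; lia.
  apply: supported_translate (Sw v') _ => x /scroll_degree0[x10 Lx Hx].
  rewrite (_ : x + t = (0, x.2 + 1)); first by apply: scroll_degree0I; lia.
  by rewrite [x]surjective_pairing x10; congr (_, _); rewrite addr0.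
move=> A; rewrite !fctE /= /translate.
(* The factor t lifts the second summand above t^L, so that only [wedge v z] contributes to the
   leading coefficients. *)
have -> : wedge v' z A ((0, L) - t) = 0.
  apply: (@supported_out _ _ _ _ _ _ _ _ (@supported_wedge _ _ _ _ _ v' _ Sz)).
  by move=> /scroll_degree0[_ /=]; lia.
rewrite subr0 /wedge zE /GRing.scale /=.
have [->|AA0] := eqVneq A A0; first by rewrite vA eqxx mulr1 wedge_signM.
case: ifP => [vA'|_]; last by rewrite mulr0.
case: eqP => [AE|_]; last by rewrite !mulr0.
by case/eqP: AA0; rewrite -(finset.setD1K vA') AE finset.setD1K.
Qed.

(** The p-th exterior power of the span of the free cells, which is where the coefficients at the
    lowest power t^L of a cycle lie. *)
Definition bottom_coefs (p : int) (c : {set I} -> k^o) : Prop :=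
  forall A, c A != 0 -> #|A|%:Z = p /\ A \subset free_cells.

Lemma bottom_coefs_subspace p : is_subspace (bottom_coefs p).
Proof.
split=> [A|a c c' Tc Tc' A]; first by rewrite eqxx.
rewrite !fctE; have [->|/Tc //] := eqVneq (c A) 0.
by rewrite scaler0 add0r => /Tc'.
Qed.

Lemma coefs_sumE (J : finType) (F : J -> {set I} -> k^o) A :
  (\sum_j F j) A = \sum_j F j A.
Proof. by elim/big_rec2: _ => // j y1 y2 _ <-; rewrite !fctE. Qed.

Lemma bottom_coefs_dim (n : nat) :
  subquotient_dim (bottom_coefs n) (fun c => c = 0) 'C(#|free_cells|, n).
Proof.
exists {A : {set I} | (A \subset free_cells) && (#|A| == n)}.
exists (fun j A => (A == val j)%:R); split.
- by rewrite card_sig -cards_draws; apply: eq_card => A; rewrite !inE.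
- move=> [A /= /andP[As /eqP An]] B; have [->|] := eqVneq B A; last by rewrite eqxx.
  by rewrite An.
- move=> c c0 j; have := congr1 (fun c => c (val j)) c0.
  rewrite coefs_sumE (bigD1 j) //= !fctE eqxx big1 ?addr0 => [|i ij].
    by rewrite /GRing.scale /= mulr1.
  by rewrite !fctE -val_eqE eq_sym in ij *; rewrite (negPf ij) scaler0.
- move=> c Tc; exists (fun j => c (val j)); apply/funext => A.
  rewrite !fctE coefs_sumE; have [cA|/Tc[An As]] := eqVneq (c A) 0.
    rewrite cA sub0r big1 ?oppr0 // => j _; rewrite !fctE.
    by have [<-|] := eqVneq A (val j); rewrite ?cA ?scale0r ?scaler0.
  have AP : (A \subset free_cells) && (#|A| == n) by rewrite As /=; lia.
  rewrite (bigD1 (Sub A AP)) //= big1 ?addr0 => [|j jA].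
    by rewrite !fctE eqxx /GRing.scale /= mulr1 subrr.
  rewrite !fctE; have [Aj|] := eqVneq A (val j); last by rewrite scaler0.
  by case/eqP: jA; apply: val_inj; rewrite /= -Aj.
Qed.

(** A product of p factors e_v - t e_v' reaches from t^L to t^(L + p), which explains the condition
    on H. *)
Lemma bottom_cycle_span L H p c : L + p <= H -> 0 <= p -> bottom_coefs p c ->
  exists2 z, cycle (scroll L H) p 0 z & forall A, z A (0, L) = c A.
Proof.
move=> LH p0 Tc.
have /boolp.choice[F FP] (A0 : {set I}) : exists z, cycle (scroll L H) p 0 z /\
    forall A, z A (0, L) = if c A0 == 0 then 0 else (A == A0)%:R.
  have [_|/Tc[An As]] := eqVneq (c A0) 0.
    by exists 0; split=> //; split; [exact: supported0 | exact: linear0].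
  have [z [Sz dz] zE] := bottom_cycle L erefl As; rewrite -An.
  exists z; split=> //; split=> //.
  by apply: supportedW Sz _ => x [x0 tx Lx Hx]; split=> //; lia.
exists (\sum_A0 c A0 *: F A0).
  apply: subspace_sum => [|A0]; first exact: cycle_subspace.
  by apply: subspaceZ; [exact: cycle_subspace|have [] := FP A0].
move=> A; rewrite chain_sumE (bigD1 A) //= big1 => [|A0 A0A].
  rewrite addr0 !fctE (FP A).2 eqxx.
  by case: eqP => [->|_]; rewrite ?scale0r // /GRing.scale /= mulr1.
rewrite !fctE (FP A0).2 [A == A0]eq_sym (negPf A0A).
by case: ifP => _; rewrite scaler0.
Qed.

End LowDegreeCycles.

(** * Koszul homology of the twists of a scroll *)

Section ScrollHomology.
Variables (k : fieldType) (I Rw : finType) (row : I -> Rw) (col : I -> int).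
Variables (lo hi : Rw -> int).
Hypothesis col_bounds : forall v, lo (row v) <= col v <= hi (row v).
Hypothesis cell_inj : forall v w, row v = row w -> col v = col w -> v = w.
Hypothesis cell_surj : forall r j, lo r <= j <= hi r ->
  exists2 v, row v = r & col v = j.
Hypothesis lo_le_hi : forall r, lo r <= hi r.
Local Notation bidegree := (bidegree Rw).
Local Notation cell := (cell row col).
Local Notation scroll := (scroll lo hi).
Local Notation chain := (kchain k I bidegree).
Local Notation diff := (@kdiff k I bidegree cell).
Local Notation cycle := (@cycle k I bidegree cell).
Local Notation boundary := (@boundary k I bidegree cell).
Local Notation free_cells := (free_cells row col lo).
Local Notation bottom_coefs := (@bottom_coefs k I Rw row col lo).
Implicit Types (x : bidegree) (v w : I) (r : Rw) (A B : {set I}) (z : chain).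

Lemma bottom_coefs_of_chain L H p z : supported p (scroll L H 0) z ->
  (forall A x, above lo x <= L -> diff z A x = 0) ->
  bottom_coefs p (fun A => z A (0, L)).
Proof.
move=> Sz dz A nz; have [Ap _] := Sz _ _ nz; split=> //.
apply/fintype.subsetP => v vA; apply/negPn/negP => nv; case/eqP: nz.
exact: (bottom_coef_eq0 col_bounds cell_inj Sz dz vA nv).
Qed.

Lemma supported_above L H p z : supported p (scroll L H 0) z ->
  (forall A, z A (0, L) = 0) -> supported p (scroll (L + 1) H 0) z.
Proof.
move=> Sz z0 A x nz; have [Ap [x0 tx Lx Hx]] := Sz _ _ nz; split=> //; split=> //.
have [x10 Lx2 _] := scroll_degree0 (And4 x0 tx Lx Hx).
have : x.2 != L.
  by apply: contraNneq nz => xL; rewrite [x]surjective_pairing x10 xL z0.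
by rewrite /above x10 big1 ?subr0 => [|r _]; [lia|rewrite ffunE mul0r].
Qed.

(** Every admissible leading coefficient at t^L is realised by a cycle as long as H - L >= n, so
    each of the m steps contributes a full exterior power. At H - L = n - 1 no cycles are left. *)
Lemma cycle0_dim (m n : nat) L H : H - L = m%:Z + n%:Z - 1 ->
  subquotient_dim (cycle (scroll L H) n 0) (fun z => z = 0)
    (m * 'C(#|free_cells|, n)).
Proof.
elim: m L => [|m IHm] L HL.
  rewrite mul0n; apply: subquotient_dim_eq0 => z.
  by apply: low_degree_cycle; rewrite ?HL //; lia.
rewrite mulSn addnC.
have Hm : subquotient_dim (cycle (scroll (L + 1) H) n 0) (fun z => z = 0)
    (m * 'C(#|free_cells|, n)) by apply: IHm; lia.
have dE z : diff z = 0 -> forall A x, above lo x <= L -> diff z A x = 0.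
  by move=> ->.
apply: (@subquotient_dim_snake _ _ _ _ _ _ _ _ (bottom_coefs n) (fun c => c = 0)
  (idfun : {linear chain -> chain}) (fun z c => forall A, z A (0, L) = c A)
  _ _ _ _ _ _ _ _ _ _ _ _ _ _ Hm (bottom_coefs_dim _ _ _ _ _)).
- exact: cycle_subspace.
- exact: cycle_subspace.
- exact: subspace_eq0.
- exact: subspace_eq0.
- by move=> c z z' y y' zy zy' A; rewrite !fctE zy zy'.
- move=> z [Sz dz]; split.
    by split=> //; apply: supportedW Sz _ => x; apply: scrollW; lia.
  by move=> A /=; rewrite (supported_out _ Sz) // => /scroll_degree0[_ /=]; lia.
- by [].
- by [].
- move=> z c [Sz dz] zc c0; exists z; last by rewrite subrr.
  by split=> //; apply: supported_above => // A; rewrite zc c0.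
- move=> z [Sz dz]; exists (fun A => z A (0, L)) => //.
  exact: bottom_coefs_of_chain Sz (dE _ dz).
- move=> c Tc.
  have [||z Zz zE] := bottom_cycle_span (H := H) (L := L) col_bounds cell_surj _ _ Tc.
  + by lia.
  + by [].
  by exists z, c; split=> //; rewrite subrr.
- by move=> z c -> zc; apply/funext => A; rewrite -zc.
Qed.

(** If the differential of a chain starts at L, the layers of the chain below L are relative cycles.
    They are removed one at a time, by corrections that do not change the differential. *)
Lemma raise_lower_bound L' L H p q z : L' <= L ->
  (forall L1 z1, L' <= L1 < L -> supported p (scroll L1 H q) z1 ->
    (forall A x, above lo x <= L1 -> diff z1 A x = 0) ->
    exists2 z2, supported p (scroll (L1 + 1) H q) z2 & diff z2 = diff z1) ->
  supported p (scroll L' H q) z -> supported (p - 1) (scroll L H (q + 1)) (diff z) ->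
  exists2 z', supported p (scroll L H q) z' & diff z' = diff z.
Proof.
move=> L'L step; have [n] : exists n : nat, L = L' + n%:Z.
  by exists `|L - L'|%N; lia.
elim: n L' L'L step z => [|n IHn] L' L'L step z LE Sz Sd.
  by exists z => //; rewrite LE addr0.
have LL : L' <= L' < L by lia.
have dz A x : above lo x <= L' -> diff z A x = 0.
  by move=> xL'; rewrite (supported_out _ Sd) // => -[_ _]; lia.
have [z1 Sz1 dz1] := step L' z LL Sz dz.
have step1 L1 z2 : L' + 1 <= L1 < L -> supported p (scroll L1 H q) z2 ->
    (forall A x, above lo x <= L1 -> diff z2 A x = 0) ->
    exists2 z3, supported p (scroll (L1 + 1) H q) z3 & diff z3 = diff z2.
  by move=> L1L; apply: step; lia.
have [|||z2 Sz2 dz2] := IHn (L' + 1) _ step1 z1 _ Sz1; try lia.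
  by rewrite dz1.
by exists z2; rewrite // dz2.
Qed.

Lemma cycle_ge2_boundary L H p q z : L <= H + 1 -> 2 <= q ->
  cycle (scroll L H) p q z -> boundary (scroll L H) p q z.
Proof.
move=> LH q2 [Sz dz].
have [|L' L'L [w Sw zw]] := boundary_below col_bounds cell_surj lo_le_hi _ Sz dz.
  by lia.
(* Since [w] has degree q - 1 >= 1, its bottom layers are removed as boundaries; L1 < L <= H + 1
   gives the L1 <= H needed for this. *)
have [||w' Sw' dw'] := raise_lower_bound L'L _ Sw.
- move=> L1 w1 L1L Sw1 dw1.
  have [||u Su Su'] := bottom_reduction col_bounds cell_surj lo_le_hi _ _ Sw1 dw1.
  + by lia.
  + by lia.
  exists (w1 - diff u) => //.
  by rewrite diffB diffK subr0.
- by rewrite addrK subrK -zw.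
by exists w'; rewrite // dw'.
Qed.

Lemma cycle1_boundary L H p z : L <= H + 1 -> p <= H - L ->
  cycle (scroll L H) p 1 z -> boundary (scroll L H) p 1 z.
Proof.
move=> LH pb [Sz dz].
have [|L' L'L [w Sw zw]] := boundary_below col_bounds cell_surj lo_le_hi _ Sz dz.
  by [].
have [p0|p0] := ltP (p + 1) 0.
  exists 0; first exact: supported0.
  by rewrite zw (supported_neg Sw) ?diff0.
(* Now [w] has degree 0, and its bottom layer is removed by a cycle with the same leading
   coefficients. There is room for it, as L1 + (p + 1) <= L + p <= H. *)
have [||w' Sw' dw'] := raise_lower_bound L'L _ Sw.
- move=> L1 w1 L1L Sw1 dw1.
  have [|u [Su du] uE] := bottom_cycle_span (H := H) (L := L1) col_bounds cell_surj
    _ p0 (bottom_coefs_of_chain Sw1 dw1); first by lia.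
  exists (w1 - u); last by rewrite diffB du subr0.
  apply: supported_above; first exact: supportedB.
  by move=> A; rewrite !fctE uE subrr.
- by rewrite addrK subrK -zw.
by exists w'; rewrite // dw'.
Qed.

(** At the exponent (0, L) this lifts leading coefficients to a chain; its differential then gives
    the connecting map. *)
Definition chain_at (x0 : bidegree) (c : {set I} -> k^o) : chain :=
  fun A x => if x == x0 then c A else 0.

Lemma chain_at_linear x0 : linear (chain_at x0).
Proof.
move=> a c c'; apply: chainP => A x; rewrite !fctE /chain_at /=.
by case: eqP; rewrite ?scaler0 ?addr0.
Qed.
HB.instance Definition _ x0 :=
  GRing.isLinear.Build k ({set I} -> k^o) chain _ (chain_at x0) (@chain_at_linear x0).

Lemma chain_at0 x0 : chain_at x0 0 = 0. Proof. exact: linear0. Qed.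

Lemma supported_chain_at L H p c : L <= H -> bottom_coefs p c ->
  supported p (scroll L H 0) (chain_at (0, L) c).
Proof.
move=> LH Tc A x; rewrite /chain_at.
have [->|_] := eqVneq x (0, L); last by rewrite eqxx.
by move=> /Tc[Ap _]; split=> //; apply: scroll_degree0I; rewrite lexx.
Qed.

(** Only free cells occur in the chain, and multiplication by a free cell leaves the bottom
    layer. *)
Lemma supported_diff_chain_at L H p c : L <= H -> bottom_coefs p c ->
  supported (p - 1) (scroll (L + 1) H 1) (diff (chain_at (0, L) c)).
Proof.
move=> LH Tc A x nz.
have Sd : supported (p - 1) (scroll L H 1) (diff (chain_at (0, L) c)).
  apply: supported_diff (supported_chain_at LH Tc) _ => v x' Sx'.
  by rewrite -[1]add0r; exact: scroll_cell.
have [Ap [x0 tx Lx Hx]] := Sd _ _ nz; split=> //; split=> //.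
have [v nzv] : exists v, contract v (chain_at (0, L) c) A (x - cell v) != 0.
  apply: contrapT => nv; case/eqP: nz; apply: big1 => v _.
  by apply/eqP/negPn/negP => nzv; apply: nv; exists v.
move: nzv; rewrite /contract /chain_at; case: ifP => _; rewrite ?eqxx //.
have [xE|_] := eqVneq (x - cell v) (0, L); rewrite ?mulr0 ?eqxx // mulf_eq0 negb_or => /andP[_ /Tc[_]].
move=> /fintype.subsetP/(_ v); rewrite setU11 => /(_ isT); rewrite inE => cv.
have /(congr1 (above lo)) := xE; rewrite aboveB above_cell.
rewrite [above lo (0, L)]/above big1 ?subr0 => [|r _]; last by rewrite ffunE mul0r.
by have := col_bounds v; rewrite /=; lia.
Qed.

(** Raising the lower bound from K to K + 1 adds one copy of the leading coefficients in exterior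
    degree n + 1: the chain with these coefficients at t^K is lost, and its differential is no
    longer a boundary. *)
Lemma homology1_dim (m n : nat) L H : H - L = n%:Z - m%:Z -> (m <= n.+1)%N ->
  subquotient_dim (cycle (scroll L H) n 1) (boundary (scroll L H) n 1)
    (m * 'C(#|free_cells|, n.+1)).
Proof.
elim: m L => [|m IHm] L HL mn.
  rewrite mul0n; apply: subquotient_dim_eq0 => z.
  by apply: cycle1_boundary; lia.
rewrite mulSn; have [K LK] : exists K, L = K + 1 by exists (L - 1); rewrite subrK.
rewrite {L}LK in HL *.
have Hm : subquotient_dim (cycle (scroll K H) n 1) (boundary (scroll K H) n 1)
    (m * 'C(#|free_cells|, n.+1)) by apply: IHm; lia.
have KH : K <= H by lia.
have BW z : boundary (scroll (K + 1) H) n 1 z -> boundary (scroll K H) n 1 z.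
  move=> [w Sw ->]; exists w => //; apply: supportedW Sw _ => x.
  by apply: scrollW; lia.
have nE : n.+1%:Z = n%:Z + 1 by lia.
have sB2 : is_subspace (boundary (scroll K H) n 1) by exact: boundary_subspace.
apply: (@subquotient_dim_snake _ _ _ _ (bottom_coefs n.+1) (fun c => c = 0)
  _ _ _ _
  (diff \o chain_at (0, K) : {linear ({set I} -> k^o) -> chain})
  (* The map to the homology of the larger module is induced by an inclusion, so being related means
     being homologous there. *)
  (fun z y => boundary (scroll K H) n 1 (z - y))
  _ _ _ _ _ _ _ _ _ _ _ _ _ _ (bottom_coefs_dim _ _ _ _ _) Hm).
- exact: bottom_coefs_subspace.
- exact: cycle_subspace.
- exact: boundary_subspace.
- exact: boundary_subspace.
- move=> c z z' y y' zy zy'.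
  rewrite (_ : _ - _ = c *: (z - y) + (z' - y')); last by rewrite scalerBr addrACA opprD.
  exact: sB2.2.
- move=> c Tc /=; split; [split|].
  + by rewrite -[n%:Z](addrK 1) -nE; exact: supported_diff_chain_at.
  + exact: diffK.
  + rewrite subr0; exists (chain_at (0, K) c) => //.
    by rewrite -nE subrr; exact: supported_chain_at.
- by move=> c -> /=; rewrite chain_at0 diff0; exact: boundary0.
- move=> c Tc /= [w]; rewrite subrr -nE => Sw dw.
  (* Two chains with the same differential differ by a cycle of exterior degree n + 1, which is zero
     because H - K <= n. *)
  have : chain_at (0, K) c - w = 0.
    apply: (@low_degree_cycle _ _ _ row col lo hi col_bounds cell_inj n.+1 K H).
      by lia.
    split; last by rewrite diffB dw subrr.
    apply: supportedB; first exact: supported_chain_at.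
    by apply: supportedW Sw _ => x; apply: scrollW; lia.
  move=> cw; apply/funext => A.
  have := congr1 (fun z => z A (0, K)) cw; rewrite !fctE /chain_at eqxx.
  rewrite (supported_out _ Sw); first by rewrite subr0.
  by move=> /scroll_degree0[_ /=]; lia.
- move=> z y [Sz dz] zy By.
  have [w] : boundary (scroll K H) n 1 z.
    by rewrite -[z](subrK y); exact: subspaceD.
  rewrite subrr -nE => Sw zw.
  have dw A x : above lo x <= K -> diff w A x = 0.
    by move=> xK; rewrite -zw; apply: (supported_out _ Sz) => -[_ _]; lia.
  have Tc := bottom_coefs_of_chain Sw dw.
  exists (fun A => w A (0, K)) => //=.
  exists (w - chain_at (0, K) (fun A => w A (0, K))); last by rewrite diffB zw.
  rewrite subrr -nE; apply: supported_above.
    by apply: supportedB => //; exact: supported_chain_at.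
  by move=> A; rewrite !fctE /chain_at eqxx subrr.
- move=> z [Sz dz]; exists z; last by rewrite subrr; exact: boundary0.
  by split=> //; apply: supportedW Sz _ => x; apply: scrollW; lia.
- move=> y [Sy dy].
  have [||w Sw Sw'] := bottom_reduction col_bounds cell_surj lo_le_hi KH _ Sy.
  + by [].
  + by move=> A x _; rewrite dy.
  exists (y - diff w), y; split.
  + by split=> //; rewrite diffB dy diffK subrr.
  + by exists (- w); [exact: supportedN | rewrite addrAC subrr add0r diffN].
  + by rewrite subrr; exact: boundary0.
- move=> z y Bz zy; rewrite -[y](subKr z); apply: subspaceB => //; exact: BW.
Qed.

(* With E a trivial bundle of rank F on the projective line, the values are
   h^0(/\^p E (b - p)) for q = 0 and h^1(/\^(p + 1) E (b - p - 1)) for q = 1. *)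
Definition scroll_betti (F : nat) (b p q : int) : nat :=
  if q == 0 then (posn (b + 1 - p) * binomz F p)%N
  else if q == 1 then (posn (p - b) * binomz F (p + 1))%N else 0%N.

Lemma scroll_homology_dim L H p q : L <= H + 1 ->
  subquotient_dim (cycle (scroll L H) p q) (boundary (scroll L H) p q)
    (scroll_betti #|free_cells| (H - L) p q).
Proof.
move=> LH; have B0 z : cycle (scroll L H) p q z -> z = 0 -> boundary (scroll L H) p q z.
  by move=> _ ->; exact: boundary0.
rewrite /scroll_betti; case: (q =P 0) => [q0|q0].
  rewrite q0 in B0 *; case: p B0 => n B0; last first.
    rewrite muln0; apply: subquotient_dim_eq0 => z Zz; apply: B0 => //.
    by apply: supported_neg Zz.1 _.
  apply: (@eq_subquotient_dim _ _ (cycle (scroll L H) n 0) (fun z => z = 0)) => [//|z|].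
    split=> [->|[w Sw ->]]; first exact: boundary0.
    rewrite (supported_empty Sw) ?diff0 // => x /scroll_degree_ge0; lia.
  have [HL|HL] := ltP (H - L) n%:Z.
    rewrite (_ : posn _ = 0%N); last by case E: (H - L + 1 - n%:Z) => [[|j]|j] //=; lia.
    by apply: subquotient_dim_eq0 => z; exact: low_degree_cycle.
  apply: cycle0_dim; case E: (H - L + 1 - n%:Z) => [j|j] /=; lia.
case: (q =P 1) => [q1|q1].
  rewrite q1 in B0 *; case: p B0 => n B0; last first.
    rewrite (_ : (_ * _)%N = 0%N).
      apply: subquotient_dim_eq0 => z Zz; apply: B0 => //.
      by apply: supported_neg Zz.1 _.
    case: n {B0} => [|n]; last by rewrite muln0.
    by rewrite (_ : posn _ = 0%N) //; case E: (_ - (H - L)) => [[|j]|j] //=; lia.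
  have -> : binomz #|free_cells| (n%:Z + 1) = 'C(#|free_cells|, n.+1).
    by rewrite -PoszD addn1.
  have [HL|HL] := leP n%:Z (H - L).
    rewrite (_ : posn _ = 0%N); last by case E: (_ - (H - L)) => [[|j]|j] //=; lia.
    by rewrite mul0n; apply: subquotient_dim_eq0 => z; exact: cycle1_boundary.
  by apply: homology1_dim; case E: (_ - (H - L)) => [j|j] /=; lia.
apply: subquotient_dim_eq0 => z Zz.
have [q2|q2] := leP 2 q; first exact: cycle_ge2_boundary.
apply: B0 => //; apply: supported_empty Zz.1 _ => x /scroll_degree_ge0; lia.
Qed.

End ScrollHomology.

(** * Surfaces fibred in conics *)

Definition row0 : 'I_3 := @Ordinal 3 0 isT.
Definition row1 : 'I_3 := @Ordinal 3 1 isT.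
Definition row2 : 'I_3 := @Ordinal 3 2 isT.

Lemma sum_rows (V : nmodType) (f : 'I_3 -> V) :
  \sum_r f r = f row0 + f row1 + f row2.
Proof.
rewrite !big_ord_recl big_ord0 /= addr0 addrA.
by congr (f _ + f _ + f _); apply: val_inj.
Qed.

Lemma rows_ind (P : 'I_3 -> Prop) : P row0 -> P row1 -> P row2 -> forall r, P r.
Proof.
move=> P0 P1 P2 [[|[|[|//]]] lt3].
- by rewrite (_ : Ordinal lt3 = row0) //; exact: val_inj.
- by rewrite (_ : Ordinal lt3 = row1) //; exact: val_inj.
- by rewrite (_ : Ordinal lt3 = row2) //; exact: val_inj.
Qed.

Section ConicFibration.
Variables (k : fieldType) (I : finType) (row : I -> 'I_3) (col : I -> int).
Variables (lo hi : 'I_3 -> int).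
Hypothesis col_bounds : forall v, lo (row v) <= col v <= hi (row v).
Hypothesis cell_inj : forall v w, row v = row w -> col v = col w -> v = w.
Hypothesis cell_surj : forall r j, lo r <= j <= hi r ->
  exists2 v, row v = r & col v = j.
Hypothesis lo_le_hi : forall r, lo r <= hi r.
Local Notation bidegree := (bidegree 'I_3).
Local Notation cell := (cell row col).
Local Notation scroll := (scroll lo hi).
Local Notation chain := (kchain k I bidegree).
Local Notation diff := (@kdiff k I bidegree cell).
Implicit Types (x : bidegree) (v w : I) (r : 'I_3) (A B : {set I}) (z : chain).

Definition plane : zmodType := (int * int)%type.
Definition plane_cell v : plane := (Posz (row v), col v).

Local Notation pchain := (kchain k I plane).
Local Notation pdiff := (@kdiff k I plane plane_cell).

(** The exponents of the image under y_0, y_1, y_2 -> 1, s, s^2; the degree is remembered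
    separately. *)
Definition proj x : plane := (x.1 row1 + x.1 row2 * 2, x.2).

(* The point of degree q of the fiber of [proj] over [y] whose exponent in the
   first row is a. *)
Definition fiber_point (q a : int) (y : plane) : bidegree :=
  ([ffun r : 'I_3 => nth 0 [:: a; q * 2 - a * 2 - y.1; y.1 - q + a] r], y.2).

(** The monomials in the image of the coordinate ring of the scroll. That they are all the lattice
    points of the dilates is the content of [dilate_surface]. *)
Definition surface (q : int) (y : plane) : Prop :=
  exists2 x, scroll 0 0 q x & proj x = y.

Lemma projD x x' : proj (x + x') = proj x + proj x'.
Proof. by rewrite /proj !row_coordD mulrDl addrACA. Qed.

Lemma proj_cell v : proj (cell v) = plane_cell v.
Proof.
rewrite /proj !row_coord_cell /plane_cell; congr (_, _).
by move: (row v); apply: rows_ind.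
Qed.

Lemma degree_rows x : degree x = x.1 row0 + x.1 row1 + x.1 row2.
Proof. exact: sum_rows. Qed.

Lemma fiber_point_coords q a y :
  [/\ (fiber_point q a y).1 row0 = a,
      (fiber_point q a y).1 row1 = q * 2 - a * 2 - y.1
    & (fiber_point q a y).1 row2 = y.1 - q + a].
Proof. by rewrite !ffunE. Qed.

Lemma degree_fiber_point q a y : degree (fiber_point q a y) = q.
Proof. by rewrite degree_rows; have [-> -> ->] := fiber_point_coords q a y; lia. Qed.

Lemma proj_fiber_point q a y : proj (fiber_point q a y) = y.
Proof.
rewrite /proj; have [_ -> ->] := fiber_point_coords q a y.
by case: y => h i; congr (_, _) => /=; lia.
Qed.

Lemma bidegreeP x x' : x.1 row0 = x'.1 row0 -> x.1 row1 = x'.1 row1 ->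
  x.1 row2 = x'.1 row2 -> x.2 = x'.2 -> x = x'.
Proof.
move=> e0 e1 e2 e; rewrite [x]surjective_pairing [x']surjective_pairing e.
by congr (_, _); apply/ffunP; exact: rows_ind.
Qed.

Lemma fiber_pointE q x : degree x = q -> x = fiber_point q (x.1 row0) (proj x).
Proof.
rewrite degree_rows => tx.
have [e0 e1 e2] := fiber_point_coords q (x.1 row0) (proj x).
apply: bidegreeP; rewrite ?e0 ?e1 ?e2 // -tx /proj /=; lia.
Qed.

Lemma fiber_point_eq q a y x : degree x = q -> x.1 row0 = a -> proj x = y ->
  fiber_point q a y = x.
Proof. by move=> tx <- <-; rewrite -fiber_pointE. Qed.

Lemma scroll_row0 L H q x : scroll L H q x -> 0 <= x.1 row0 <= q.
Proof.
case=> x0 + _ _; rewrite degree_rows.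
have := x0 row0; have := x0 row1; have := x0 row2.
by move: (x.1 row0) (x.1 row1) (x.1 row2) => a b c; lia.
Qed.

(* The sum over the fibers of [proj] in degree q. In [scroll 0 0 q] one has
   0 <= a <= q, so that any n > q gives the same map. *)
Definition push (n : nat) (q : int) z : pchain :=
  fun A y => \sum_(a < n) z A (fiber_point q a%:Z y).

Lemma push_linear n q : linear (push n q).
Proof.
move=> c z z'; apply: chainP => A y; rewrite !fctE /push scaler_sumr -big_split.
by apply: eq_bigr => a _; rewrite !fctE.
Qed.
HB.instance Definition _ n q :=
  GRing.isLinear.Build k chain pchain _ (push n q) (@push_linear n q).

Lemma push_cell n p q v z (A : {set I}) y : supported p (scroll 0 0 q) z ->
  q + 1 < n%:Z ->
  \sum_(a < n) z A (fiber_point (q + 1) a%:Z y - cell v) =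
  \sum_(a < n) z A (fiber_point q a%:Z (y - plane_cell v)).
Proof.
move=> Sz qn; pose F a := z A (fiber_point q a (y - plane_cell v)).
have E a : fiber_point (q + 1) a y - cell v =
    fiber_point q (a - (row0 == row v)%:Z) (y - plane_cell v).
  apply/esym/fiber_point_eq.
  - by rewrite degreeB degree_fiber_point degree_cell addrK.
  - by rewrite row_coordB row_coord_cell; have [-> _ _] := fiber_point_coords (q + 1) a y.
  - by apply/eqP; rewrite eq_sym subr_eq -proj_cell -projD subrK proj_fiber_point.
under eq_bigr do rewrite E; have [r0|_] := eqVneq row0 (row v); last first.
  by apply: eq_bigr => a _; rewrite subr0.
have F0 a : ~~ (0 <= a <= q) -> F a = 0.
  move=> aq; apply: (supported_out _ Sz) => /scroll_row0.
  by have [-> _ _] := fiber_point_coords q a (y - plane_cell v); apply/negP.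
case: n qn => [|n] qn; first by rewrite !big_ord0.
rewrite big_ord_recl big_ord_recr /= -!/(F _) !F0 ?addr0 ?add0r //; try by lia.
apply: eq_bigr => a _; rewrite -/(F _); congr F; rewrite /= /bump /=; lia.
Qed.

Lemma push_diff n p q z : supported p (scroll 0 0 q) z -> q + 1 < n%:Z ->
  pdiff (push n q z) = push n (q + 1) (diff z).
Proof.
move=> Sz qn; apply: chainP => A y; rewrite /kdiff /push exchange_big /=.
apply: eq_bigr => v _; rewrite /contract; case: ifP => vA.
  by rewrite big1.
by rewrite -!mulr_sumr (push_cell _ _ _ Sz qn).
Qed.

Lemma supported_push n p q z : supported p (scroll 0 0 q) z ->
  supported p (surface q) (push n q z).
Proof.
move=> Sz A y; rewrite /push => nz.
have [a nza] : exists a : 'I_n, z A (fiber_point q a%:Z y) != 0.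
  apply: contrapT => na; case/eqP: nz; apply: big1 => a _.
  by apply/eqP/negPn/negP => nza; apply: na; exists a.
have [Ap Sx] := Sz _ _ nza; split=> //.
by exists (fiber_point q a%:Z y); rewrite ?proj_fiber_point.
Qed.

(** One point is chosen in each fibre and carries the whole coefficient. *)
Lemma push_surj n p q (w : pchain) : q < n%:Z -> supported p (surface q) w ->
  exists2 z, supported p (scroll 0 0 q) z & push n q z = w.
Proof.
move=> qn Sw.
have /boolp.choice[lift liftP] (y : plane) : exists x,
    surface q y -> scroll 0 0 q x /\ proj x = y.
  have [[x Sx xy]|nS] := pselect (surface q y); first by exists x.
  by exists 0 => /nS.
exists (fun A x => if `[< scroll 0 0 q x >] && (lift (proj x) == x)
                   then w A (proj x) else 0).
  move=> A x; case: ifPn; rewrite ?eqxx // => /andP[/asboolP Sx _].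
  by move=> /Sw[].
apply: chainP => A y; rewrite /push.
have [Sy|nSy] := pselect (surface q y); last first.
  rewrite (supported_out _ Sw nSy); apply: big1 => a _.
  case: ifP => // /andP[/asboolP Sx _]; case: nSy.
  by exists (fiber_point q a%:Z y); rewrite ?proj_fiber_point.
have [Sx xy] := liftP y Sy; have aq := scroll_row0 Sx.
have a0n : (`|(lift y).1 row0| < n)%N by lia.
have lE : lift y = fiber_point q (Ordinal a0n)%:Z y.
  rewrite /= gez0_abs; last by case/andP: aq.
  by have [_ tx _ _] := Sx; rewrite {1}(fiber_pointE tx) xy.
rewrite (bigD1 (Ordinal a0n)) //= big1 ?addr0.
  rewrite -lE xy eqxx andbT; case: ifP => // /asboolP; by case.
move=> a aa0; rewrite proj_fiber_point; case: ifP => // /andP[_ /eqP lE'].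
case/eqP: aa0; apply: val_inj => /=.
by rewrite lE'; have [-> _ _] := fiber_point_coords q a%:Z y.
Qed.

Definition outer_shift : bidegree := ([ffun r : 'I_3 => nth 0 [:: 1; 0; 1] r], 0).
Definition inner_shift : bidegree := ([ffun r : 'I_3 => nth 0 [:: 0; 2; 0] r], 0).

(* Multiplication by y_0 y_2 - y_1^2, the equation of the surface in the scroll. *)
Definition conic z : chain := translate outer_shift z - translate inner_shift z.

Lemma outer_shift_coords : [/\ outer_shift.1 row0 = 1, outer_shift.1 row1 = 0,
  outer_shift.1 row2 = 1 & outer_shift.2 = 0].
Proof. by rewrite !ffunE. Qed.

Lemma inner_shift_coords : [/\ inner_shift.1 row0 = 0, inner_shift.1 row1 = 2,
  inner_shift.1 row2 = 0 & inner_shift.2 = 0].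
Proof. by rewrite !ffunE. Qed.

Lemma above_rows x : above lo x =
  x.2 - (x.1 row0 * lo row0 + x.1 row1 * lo row1 + x.1 row2 * lo row2).
Proof. by rewrite /above sum_rows. Qed.

Lemma below_rows x : below hi x =
  (x.1 row0 * hi row0 + x.1 row1 * hi row1 + x.1 row2 * hi row2) - x.2.
Proof. by rewrite /below sum_rows. Qed.

(** A multiple of the conic belongs to the scroll when its multiples by y_0 y_2 and by y_1^2 both
    do, whence the maximum of the two lower bounds and the minimum of the two upper ones. The twist
    is b = [conic_hi - conic_lo]. *)
Definition conic_lo : int := Num.max (lo row0 + lo row2) (lo row1 * 2).
Definition conic_hi : int := Num.min (hi row0 + hi row2) (hi row1 * 2).
Local Notation twisted := (scroll conic_lo conic_hi).

Lemma twistedP q x : twisted (q - 2) x <->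
  scroll 0 0 q (x + outer_shift) /\ scroll 0 0 q (x + inner_shift).
Proof.
have [u0 u1 u2 u3] := outer_shift_coords; have [i0 i1 i2 i3] := inner_shift_coords.
have D2 (s : bidegree) : (x + s).2 = x.2 + s.2 by [].
rewrite /scroll !degree_rows !above_rows !below_rows !row_coordD !D2.
rewrite u0 u1 u2 u3 i0 i1 i2 i3 /conic_lo /conic_hi.
rewrite ge_max (lerNl (Num.min _ _)) le_min.
split.
  case=> x0 tx /andP[L1 L2] /andP[H1 H2].
  have := x0 row0; have := x0 row1; have := x0 row2 => x2 x1 x0'.
  split; split; try lia; apply: rows_ind; rewrite row_coordD ?u0 ?u1 ?u2 ?i0 ?i1 ?i2; lia.
case=> -[x0 tx L1 H1] [x0' tx' L2 H2].
have := x0 row1; have := x0' row0; have := x0' row2.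
rewrite !row_coordD u1 i0 i2 !addr0 => x2 x1 x00.
by split; [exact: rows_ind|lia|apply/andP; lia|apply/andP; lia].
Qed.

Lemma diff_conic z : diff (conic z) = conic (diff z).
Proof. by rewrite /conic diffB !diff_translate. Qed.

Lemma conic_linear : linear conic.
Proof.
move=> c z z'; apply: chainP => A x; rewrite /conic !fctE /translate !fctE /=.
by rewrite scalerBr opprD addrACA.
Qed.
HB.instance Definition _ :=
  GRing.isLinear.Build k chain chain _ conic conic_linear.

Lemma conic0 : conic 0 = 0. Proof. exact: linear0. Qed.

Lemma conicB z z' : conic (z - z') = conic z - conic z'.
Proof. exact: linearB. Qed.

Lemma conicP a z z' : conic (a *: z + z') = a *: conic z + conic z'.
Proof. exact: linearP. Qed.

Lemma pushB n q z z' : push n q (z - z') = push n q z - push n q z'.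
Proof. exact: linearB. Qed.

Lemma pushP n q a z z' : push n q (a *: z + z') = a *: push n q z + push n q z'.
Proof. exact: linearP. Qed.

Lemma push0 n q : push n q 0 = 0. Proof. exact: linear0. Qed.

Lemma supported_conic p q z :
  supported p (twisted (q - 2)) z -> supported p (scroll 0 0 q) (conic z).
Proof.
by move=> Sz; apply: supportedB; apply: supported_translate Sz _ => x /twistedP[].
Qed.

(** A chain killed by the conic is invariant under the translation that replaces y_0 y_2 by y_1^2.
    As this lowers the exponent of y_0, the support would leave the nonnegative exponents. *)
Lemma conic_inj p q z : supported p (twisted q) z -> conic z = 0 -> z = 0.
Proof.
move=> Sz cz; apply: chainP => A x; apply/eqP/negPn/negP.
have [n] : exists n : nat, x.1 row0 < n%:Z by exists `|x.1 row0|.+1; lia.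
elim: n x => [|n IHn] x xn nz.
  by have [_ /scroll_row0] := Sz _ _ nz; lia.
apply: (IHn (x + inner_shift - outer_shift)).
  have [u0 _ _ _] := outer_shift_coords; have [i0 _ _ _] := inner_shift_coords.
  by rewrite row_coordB row_coordD u0 i0; lia.
have := congr1 (fun z => z A (x + inner_shift)) cz.
rewrite /conic !fctE /translate addrK => /eqP; rewrite subr_eq0 => /eqP ->.
exact: nz.
Qed.

Lemma proj_shift : proj outer_shift = proj inner_shift.
Proof.
have [u0 u1 u2 u3] := outer_shift_coords; have [i0 i1 i2 i3] := inner_shift_coords.
by rewrite /proj u1 u2 u3 i1 i2 i3.
Qed.

(** Along a fibre the two multiples of z are the same sequence, displaced by one, so their
    difference telescopes. *)
Lemma push_conic n p q z : supported p (twisted (q - 2)) z -> q < n%:Z ->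
  push n q (conic z) = 0.
Proof.
move=> Sz qn; apply: chainP => A y; rewrite /push -[RHS]/(0 : k).
have [u0 u1 u2 u3] := outer_shift_coords; have [i0 i1 i2 i3] := inner_shift_coords.
pose F (a : int) := z A (fiber_point q (a - 1) y - inner_shift).
have FE (a : int) : fiber_point q a y - outer_shift = fiber_point q (a - 1) y - inner_shift.
  have [e0 e1 e2] := fiber_point_coords q a y.
  have [e0' e1' e2'] := fiber_point_coords q (a - 1) y.
  by apply: bidegreeP; rewrite ?row_coordB ?u0 ?u1 ?u2 ?i0 ?i1 ?i2 ?e0 ?e1 ?e2 ?e0' ?e1' ?e2' /=;
    try lia; rewrite -[LHS]/(y.2 - outer_shift.2) -[RHS]/(y.2 - inner_shift.2) u3 i3.
have F0 a : ~~ (0 < a <= q) -> F a = 0.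
  move=> aq; apply: (supported_out _ Sz) => /scroll_row0; rewrite row_coordB i0 subr0.
  have [-> _ _] := fiber_point_coords q (a - 1) y; move: aq; lia.
have -> : \sum_(a < n) conic z A (fiber_point q a%:Z y) =
   \sum_(a < n) (F a%:Z - F a.+1%:Z).
  apply: eq_bigr => a _; rewrite /conic !fctE /translate FE; congr (_ - z A (_ - _)).
  by congr fiber_point; lia.
rewrite -(big_mkord xpredT (fun a => F a%:Z - F a.+1%:Z)).
under eq_bigr do rewrite -opprB.
rewrite sumrN telescope_sumr //= !F0 ?subrr ?oppr0 //; lia.
Qed.

End ConicFibration.

Lemma affine_ge0 (a b c u w : int) : 0 <= u + a * w -> 0 <= u + b * w ->
  a <= c <= b -> 0 <= u + c * w.
Proof. by have [w0|w0] := leP 0 w; nia. Qed.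

(** * The long exact sequence of the conic equation *)

Section SurfaceHomology.
Variables (k : fieldType) (I : finType) (row : I -> 'I_3) (col : I -> int).
Variables (lo hi : 'I_3 -> int).
Hypothesis col_bounds : forall v, lo (row v) <= col v <= hi (row v).
Hypothesis cell_inj : forall v w, row v = row w -> col v = col w -> v = w.
Hypothesis cell_surj : forall r j, lo r <= j <= hi r ->
  exists2 v, row v = r & col v = j.
Hypothesis lo_le_hi : forall r, lo r <= hi r.
Local Notation bidegree := (bidegree 'I_3).
Local Notation cell := (cell row col).
Local Notation scroll := (scroll lo hi).
Local Notation chain := (kchain k I bidegree).
Local Notation diff := (@kdiff k I bidegree cell).
Local Notation plane_cell := (plane_cell row col).
Local Notation pchain := (kchain k I plane).
Local Notation pdiff := (@kdiff k I plane plane_cell).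
Local Notation surface := (surface lo hi).
Local Notation conic := (@conic k I).
Local Notation push := (@push k I).
Local Notation conic_lo := (conic_lo lo).
Local Notation conic_hi := (conic_hi hi).
Local Notation twisted := (scroll conic_lo conic_hi).
Implicit Types (x : bidegree) (v w : I) (r : 'I_3) (A B : {set I}) (z : chain).

(** All conditions are affine in the exponent of y_0, so the fibre meets the scroll in an
    interval. *)
Lemma scroll_fiber_convex q a b c y : a <= c <= b ->
  scroll 0 0 q (fiber_point q a y) -> scroll 0 0 q (fiber_point q b y) ->
  scroll 0 0 q (fiber_point q c y).
Proof.
move=> acb [a0 _ La Ha] [b0 _ Lb Hb].
have [ea0 ea1 ea2] := fiber_point_coords q a y.
have [eb0 eb1 eb2] := fiber_point_coords q b y.
have [ec0 ec1 ec2] := fiber_point_coords q c y.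
split; last 2 first.
- move: La Lb; rewrite !above_rows ec0 ec1 ec2 ea0 ea1 ea2 eb0 eb1 eb2 /= => La Lb.
  have := @affine_ge0 a b c
    (y.2 - (q * 2 - y.1) * lo row1 - (y.1 - q) * lo row2)
    (lo row1 * 2 - lo row0 - lo row2).
  by move: (lo row0) (lo row1) (lo row2) y.1 y.2 La Lb => l0 l1 l2 h i La Lb; lia.
- move: Ha Hb; rewrite !below_rows ec0 ec1 ec2 ea0 ea1 ea2 eb0 eb1 eb2 /= => Ha Hb.
  have := @affine_ge0 a b c
    ((q * 2 - y.1) * hi row1 + (y.1 - q) * hi row2 - y.2)
    (hi row0 + hi row2 - hi row1 * 2).
  by move: (hi row0) (hi row1) (hi row2) y.1 y.2 Ha Hb => l0 l1 l2 h i Ha Hb; lia.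
- move: (a0 row0) (a0 row1) (a0 row2) (b0 row0) (b0 row1) (b0 row2).
  rewrite ea0 ea1 ea2 eb0 eb1 eb2 => ? ? ? ? ? ?.
  by apply: (@rows_ind (fun r => 0 <= (fiber_point q c y).1 r)); rewrite ?ec0 ?ec1 ?ec2; lia.
- exact: degree_fiber_point.
Qed.

Lemma big_neq0 (J : finType) (P : pred J) (F : J -> k) :
  \sum_(j | P j) F j != 0 -> exists2 j, P j & F j != 0.
Proof.
move=> nz; apply: contrapT => nj; case/eqP: nz; apply: big1 => j Pj.
by apply/eqP/negPn/negP => nzj; apply: nj; exists j.
Qed.

Lemma degree_outer_shift : degree outer_shift = 2.
Proof. by rewrite degree_rows; have [-> -> -> _] := outer_shift_coords. Qed.

Lemma degree_inner_shift : degree inner_shift = 2.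
Proof. by rewrite degree_rows; have [-> -> -> _] := inner_shift_coords. Qed.

(** Exactness in the middle: along a fibre, the quotient by the conic is given by the tail sums of
    the coefficients. *)
Lemma push_kernel n p q z : q < n%:Z -> supported p (scroll 0 0 q) z ->
  push n q z = 0 ->
  exists2 z', supported p (twisted (q - 2)) z' & z = conic z'.
Proof.
move=> qn Sz pz.
have [u0 _ _ _] := outer_shift_coords; have [i0 _ _ _] := inner_shift_coords.
pose f A x b := z A (fiber_point q b (proj (x + outer_shift))).
pose z' : chain := fun A x => if degree x == q - 2 then
   \sum_(b < n | x.1 row0 < b%:Z) f A x b%:Z else 0.
exists z'.
  move=> A x; rewrite /z'; have [tx nz|_] := eqVneq (degree x) (q - 2); last by rewrite eqxx.
  have [b1 xb1 nz1] := big_neq0 nz.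
  (* As the total sum is zero, a nonzero tail has a nonzero complement. So z is nonzero on both
     sides, and by convexity the two neighbouring points [x + inner_shift] and [x + outer_shift] are
     in the scroll. *)
  have : \sum_(b < n | ~~ (x.1 row0 < b%:Z)) f A x b%:Z != 0.
    apply: contraNneq nz => nz0.
    have := congr1 (fun z : pchain => z A (proj (x + outer_shift))) pz.
    by rewrite /push (bigID (fun b : 'I_n => x.1 row0 < b%:Z)) /= nz0 addr0 => ->.
  move=> /big_neq0[b0 xb0 nz0].
  have [Ap T1] := Sz _ _ nz1; have [_ T0] := Sz _ _ nz0.
  split=> //; apply/twistedP.
  have xo : fiber_point q (x.1 row0 + 1) (proj (x + outer_shift)) = x + outer_shift.
    apply: fiber_point_eq => //; last by rewrite row_coordD u0.
    by rewrite degreeD degree_outer_shift tx subrK.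
  have xi : fiber_point q (x.1 row0) (proj (x + outer_shift)) = x + inner_shift.
    apply: fiber_point_eq.
    - by rewrite degreeD degree_inner_shift tx subrK.
    - by rewrite row_coordD i0 addr0.
    - by rewrite !projD proj_shift.
  rewrite -{1}xo -xi; move: (x.1 row0) xb0 xb1 => a ab0 ab1.
  by split; apply: scroll_fiber_convex T0 T1; lia.
apply: chainP => A x; rewrite /conic !fctE /translate /z'.
rewrite !degreeB degree_outer_shift degree_inner_shift.
have [tx|tx] := eqVneq (degree x - 2) (q - 2); last first.
  rewrite subr0; apply: (supported_out _ Sz) => -[_ tx' _ _].
  by case/eqP: tx; rewrite tx'.
have {}tx : degree x = q by lia.
rewrite !row_coordB u0 i0 subr0 /f subrK (_ : proj (x - _ + _) = proj x); last first.
  by rewrite projD proj_shift -projD subrK.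
rewrite (bigID (fun b : 'I_n => b%:Z == x.1 row0)) /=.
rewrite [X in _ + X - _](eq_bigl (fun b : 'I_n => x.1 row0 < b%:Z)); last first.
  by move=> b; move: (x.1 row0) => a; lia.
rewrite addrK.
have xE b : b = x.1 row0 -> fiber_point q b (proj x) = x.
  by move=> ->; rewrite -fiber_pointE.
have [zx|nz] := eqVneq (z A x) 0.
  rewrite zx big1 // => b /andP[_ /eqP bx].
  by rewrite xE // zx.
have [_ /scroll_row0 xq] := Sz _ _ nz.
have xn : (`|x.1 row0| < n)%N by move: (x.1 row0) xq => a; lia.
have bE : `|x.1 row0|%N = x.1 row0 :> int by rewrite gez0_abs //; case/andP: xq.
rewrite (big_pred1 (Ordinal xn)) /= ?bE ?xE // => b.
rewrite /= -(inj_eq val_inj) /=; move: (x.1 row0) (val b) xq => a m; lia.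
Qed.

Lemma surface_homology_dim p q : conic_lo <= conic_hi + 1 ->
  subquotient_dim (@cycle k I plane plane_cell surface p q)
    (@boundary k I plane plane_cell surface p q)
    (scroll_betti #|free_cells row col lo| 0 p q
     + scroll_betti #|free_cells row col lo| (conic_hi - conic_lo) (p - 1) (q - 1)).
Proof.
(* Large enough for the sums over the fibres to be complete in the degrees q - 1, q and q + 1. *)
move=> bge; pose n := `|q|.+4.
have [qn q1n qn1] : [/\ q < n%:Z, q - 1 < n%:Z & q + 1 < n%:Z] by split; rewrite /n; lia.
have bT z p' q' : 2 <= q' -> cycle cell (scroll 0 0) p' q' z ->
    boundary cell (scroll 0 0) p' q' z.
  by apply: cycle_ge2_boundary.
have qE : (q - 1) + 1 = q by rewrite subrK.
have q2E : (q + 1) - 2 = q - 1 by lia.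
have pE : (p - 1) + 1 = p by rewrite subrK.
(* For this map and the next one, either the target has degree at least 2 and no homology, or the
   source has negative degree. *)
have kill1 z : cycle cell twisted p (q - 2) z ->
    boundary cell (scroll 0 0) p q (conic z).
  move=> [Sz dz]; have [q2|q2] := leP 2 q.
    apply: bT => //; split; first exact: supported_conic.
    by rewrite diff_conic dz conic0.
  rewrite (supported_empty Sz) ?conic0; first exact: boundary0.
  by move=> x /scroll_degree_ge0; lia.
have kill2 z : cycle cell twisted (p - 1) (q - 1) z ->
    boundary cell (scroll 0 0) (p - 1) (q + 1) (conic z).
  move=> [Sz dz]; have [q2|q2] := leP 1 q.
    apply: bT; first by lia.
    split; first by apply: supported_conic; rewrite q2E.
    by rewrite diff_conic dz conic0.
  rewrite (supported_empty Sz) ?conic0; first exact: boundary0.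
  by move=> x /scroll_degree_ge0; lia.
have dscroll p' q' z : supported p' (scroll 0 0 q') z ->
    supported (p' - 1) (scroll 0 0 (q' + 1)) (diff z).
  by move=> Sz; apply: supported_diff Sz _ => v x; exact: scroll_cell.
have dtwist p' q' z : supported p' (twisted q') z ->
    supported (p' - 1) (twisted (q' + 1)) (diff z).
  by move=> Sz; apply: supported_diff Sz _ => v x; exact: scroll_cell.
have T1 := scroll_homology_dim k col_bounds cell_inj cell_surj lo_le_hi p q
  (isT : (0 : int) <= 0 + 1).
have T2 := scroll_homology_dim k col_bounds cell_inj cell_surj lo_le_hi (p - 1) (q - 1) bge.
rewrite subrr in T1.
have pushD p' q' z : supported p' (scroll 0 0 q') z -> q' + 1 < n%:Z ->
    pdiff (push n q' z) = push n (q' + 1) (diff z).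
  exact: push_diff.
have ker q' p' z : q' < n%:Z -> supported p' (scroll 0 0 q') z -> push n q' z = 0 ->
    exists2 z', supported p' (twisted (q' - 2)) z' & z = conic z'.
  exact: push_kernel.
apply: (@subquotient_dim_snake _ _ _ _ _ _ _ _ _ _
  (push n q : {linear chain -> pchain})
  (* The connecting map: lift z to a chain t over the scroll and divide the differential of t by the
     conic. *)
  (fun (z : pchain) (y : chain) => exists t : chain,
    [/\ supported p (scroll 0 0 q) t, push n q t = z, diff t = conic y & supported (p - 1) (twisted (q - 1)) y])
  _ _ _ _ _ _ _ _ _ _ _ _ _ _ T1 T2).
- exact: cycle_subspace.
- exact: cycle_subspace.
- exact: boundary_subspace.
- exact: boundary_subspace.
- move=> c z z' y y' [t [St <- dt Sy]] [t' [St' <- dt' Sy']]; exists (c *: t + t').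
  split; [exact: supported_linear|exact: pushP| |exact: supported_linear].
  by rewrite diffP conicP dt dt'.
- move=> z [Sz dz]; split.
    split; first exact: supported_push.
    by rewrite (pushD _ _ _ Sz) // dz push0.
  by exists z; split; [| |rewrite dz conic0|exact: supported0].
- move=> z [w Sw ->].
  exists (push n (q - 1) w); first exact: supported_push.
  by rewrite (pushD _ _ _ Sw) qE.
- move=> z [Sz dz] [w Sw pz].
  have [w' Sw' w'E] := push_surj q1n Sw.
  have [g Sg gE] : exists2 g, supported p (twisted (q - 2)) g & z - diff w' = conic g.
    apply: (ker _ _ _ qn).
      apply: supportedB => //.
      by rewrite -[p](addrK 1) -qE; exact: dscroll.
    by rewrite pushB pz -w'E (pushD _ _ _ Sw') qE // subrr.
  have dg : diff g = 0.
    apply: (@conic_inj _ _ lo hi (p - 1) (q - 1)).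
      by rewrite -q2E addrAC; exact: dtwist.
    by rewrite -diff_conic -gE diffB diffK dz subrr.
  have [u Su uE] := kill1 g (conj Sg dg).
  exists (w' + u); first exact: supportedD.
  by rewrite diffD -uE -gE addrC subrK.
- move=> z y [Sz dz] [t [St tz dt _]] [w Sw yE].
  rewrite pE in Sw; have Sw' : supported p (twisted (q - 2)) w.
    by rewrite (_ : q - 2 = q - 1 - 1) //; lia.
  exists (t - conic w); last first.
    rewrite /= pushB (push_conic Sw') // subr0 tz subrr; exact: boundary0.
  split; first by apply: supportedB => //; exact: supported_conic.
  by rewrite diffB diff_conic dt yE subrr.
- move=> z [Sz dz]; have [t St tz] := push_surj qn Sz.
  have [y Sy yE] : exists2 y, supported (p - 1) (twisted (q + 1 - 2)) y & diff t = conic y.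
    apply: (ker _ _ _ qn1); first exact: dscroll.
    by rewrite -(pushD _ _ _ St) // tz dz.
  rewrite q2E in Sy; exists y; last by exists t.
  split=> //; apply: (@conic_inj _ _ lo hi (p - 1 - 1) (q - 1 + 1)); first exact: dtwist.
  by rewrite -diff_conic -yE diffK.
- move=> y Zy; have [t St yE] := kill2 y Zy; rewrite pE addrK in St.
  exists (push n q t), y; split; last by rewrite subrr; exact: boundary0.
    split; first exact: supported_push.
    rewrite (pushD _ _ _ St) // -yE; apply: push_conic qn1.
    by rewrite q2E; exact: Zy.1.
  by exists t; split=> //; exact: Zy.1.
- move=> _ y [w Sw ->] [t [St tz dt Sy]].
  have [w' Sw' w'E] := push_surj q1n Sw.
  have [g Sg gE] : exists2 g, supported p (twisted (q - 2)) g & t - diff w' = conic g.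
    apply: (ker _ _ _ qn).
      apply: supportedB => //.
      by rewrite -[p](addrK 1) -qE; exact: dscroll.
    by rewrite pushB tz -w'E (pushD _ _ _ Sw') qE // subrr.
  exists g; first by rewrite pE (_ : q - 1 - 1 = q - 2) //; lia.
  apply/eqP; rewrite -subr_eq0; apply/eqP.
  apply: (@conic_inj _ _ lo hi (p - 1) (q - 1)).
    apply: supportedB => //.
    by rewrite -q2E addrAC; exact: dtwist.
  by rewrite conicB -diff_conic -gE diffB diffK subr0 dt subrr.
Qed.

End SurfaceHomology.

(** * The Koszul complex of a polygon *)

Section KoszulOfPolygon.
Variables (R : realType) (k : fieldType) (D : set 'rV[R]_2).
Variables (hgt wid : 'rV[int]_2 -> int) (c : int).
Variables (row : lattice_points D -> 'I_3) (lo hi : 'I_3 -> int).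
Local Notation I := (lattice_points D).
Let col (v : I) : int := wid (val v).

Hypothesis hgtD : forall P Q, hgt (P + Q) = hgt P + hgt Q.
Hypothesis widD : forall P Q, wid (P + Q) = wid P + wid Q.
Hypothesis coord_inj : forall P Q, hgt P = hgt Q -> wid P = wid Q -> P = Q.
Hypothesis coord_surj : forall h i, exists2 P, hgt P = h & wid P = i.
Hypothesis hgt_row : forall v : I, hgt (val v) = c + (row v)%:Z.
Hypothesis mem_dilate : forall (q : int) P,
  P \in lattice_points (dilate q D) <-> surface lo hi q (hgt P - c * q, wid P).
Hypothesis col_bounds : forall v, lo (row v) <= col v <= hi (row v).
Hypothesis cell_inj : forall v w, row v = row w -> col v = col w -> v = w.
Hypothesis cell_surj : forall r j, lo r <= j <= hi r ->
  exists2 v, row v = r & col v = j.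
Hypothesis lo_le_hi : forall r, lo r <= hi r.

Local Notation plane_cell := (plane_cell row col).
Local Notation pchain := (kchain k I plane).
Local Notation pdiff := (@kdiff k I plane plane_cell).
Local Notation surface := (surface lo hi).

(** The lowest row of the q-th dilate has height c q. Subtracting it makes the generators lie at the
    heights 0, 1, 2 and the coordinates additive under multiplication. *)
Definition plane_coord (q : int) (P : 'rV[int]_2) : plane := (hgt P - c * q, wid P).

Lemma plane_coord_inj q : injective (plane_coord q).
Proof. by move=> P Q [/addIr hPQ wPQ]; exact: coord_inj. Qed.

Lemma plane_coord_surj q y : exists P, plane_coord q P = y.
Proof.
have [P hP wP] := coord_surj (y.1 + c * q) y.2; exists P.
by rewrite /plane_coord hP wP addrK -surjective_pairing.
Qed.

Lemma plane_coordD q P (v : I) :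
  plane_coord (q + 1) (P + val v) = plane_coord q P + plane_cell v.
Proof.
rewrite /plane_coord hgtD widD hgt_row.
by have -> : hgt P + (c + (row v)%:Z) - c * (q + 1) = hgt P - c * q + (row v)%:Z by ring.
Qed.

Lemma surface_cell q v y : surface q y -> surface (q + 1) (y + plane_cell v).
Proof.
move=> [x Sx <-]; exists (x + cell row col v); first exact: scroll_cell.
by rewrite projD proj_cell.
Qed.

(** Extension by zero from the finite index set to all sets of generators and all exponents. *)
Definition chain_of (p q : int) (f : koszul k D p q) : pchain :=
  fun A y => \sum_Am ((val Am.1 == A) && (plane_coord q (val Am.2) == y))%:R * f Am.

Lemma chain_of_linear p q : linear (@chain_of p q).
Proof.
move=> a f g; apply: chainP => A y; rewrite /chain_of !fctE scaler_sumr -big_split /=.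
by apply: eq_bigr => Am _; rewrite !ffunE mulrDr /GRing.scale /= mulrCA.
Qed.
HB.instance Definition _ p q :=
  GRing.isLinear.Build k (koszul k D p q) pchain _ (@chain_of p q) (@chain_of_linear p q).

Lemma chain_ofE p q f (Am : wedge_basis D p * lattice_points (dilate q D)) :
  chain_of f (val Am.1) (plane_coord q (val Am.2)) = f Am.
Proof.
rewrite /chain_of (bigD1 Am) //= !eqxx mul1r big1 ?addr0 // => Am' ne.
case: eqP => [/val_inj E1|]; rewrite ?mul0r //=.
case: eqP => [/plane_coord_inj/val_inj E2|]; rewrite ?mul0r //.
by case/eqP: ne; rewrite [Am']surjective_pairing E1 E2 -surjective_pairing.
Qed.

Lemma chain_of_eq0 p q (f : koszul k D p q) : chain_of f = 0 -> f = 0.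
Proof. by move=> f0; apply/ffunP => Am; rewrite -chain_ofE f0 ffunE. Qed.

Lemma supported_chain_of p q f : supported p (surface q) (@chain_of p q f).
Proof.
move=> A y /(@big_neq0 _ _ _ _)[Am _].
case: andP => [[/eqP <- /eqP <-] _|_]; last by rewrite mul0r eqxx.
by split; [exact/eqP/(valP Am.1)|apply/mem_dilate/valP].
Qed.

Lemma wedge_basisP p (A : {set I}) : #|A|%:Z = p ->
  exists B : wedge_basis D p, val B = A.
Proof. by move=> /eqP Ap; exists (Sub A Ap). Qed.

Lemma dilate_point q y : surface q y ->
  exists P : lattice_points (dilate q D), plane_coord q (val P) = y.
Proof.
have [P <-] := plane_coord_surj q y => /mem_dilate PD.
by exists [` PD]%fset.
Qed.

Lemma chain_of_surj p q (z : pchain) : supported p (surface q) z ->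
  exists f : koszul k D p q, chain_of f = z.
Proof.
move=> Sz; exists [ffun Am => z (val Am.1) (plane_coord q (val Am.2))].
apply: chainP => A y.
have [[Ap Sy]|nS] := pselect (#|A|%:Z = p /\ surface q y).
  have [B <-] := wedge_basisP Ap; have [P <-] := dilate_point Sy.
  by rewrite (@chain_ofE _ _ _ (B, P)) ffunE.
have [->|/Sz//] := eqVneq (z A y) 0.
by apply/eqP/negPn/negP => /supported_chain_of.
Qed.

Lemma koszul_coefE p q p' q' (Am : wedge_basis D p * lattice_points (dilate q D))
    (Bn : wedge_basis D p' * lattice_points (dilate q' D)) : q' = q + 1 ->
  koszul_coef k Am Bn = \sum_v (if v \in val Bn.1 then 0 else
    wedge_sign k v (val Bn.1) * ((val Am.1 == v |: val Bn.1) &&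
     (plane_coord q (val Am.2) == plane_coord q' (val Bn.2) - plane_cell v))%:R).
Proof.
move=> qE; rewrite /koszul_coef big_mkcond /=; apply: eq_bigr => v _.
have -> : (val Bn.2 == val Am.2 + val v) =
    (plane_coord q (val Am.2) == plane_coord q' (val Bn.2) - plane_cell v).
  rewrite eq_sym [RHS]eq_sym subr_eq -plane_coordD -qE.
  by rewrite (inj_eq (@plane_coord_inj _)) eq_sym.
case: (boolP (v \in val Bn.1)) => vB.
  rewrite ifF //; apply/negP => /and3P[_ /eqP E _].
  by move: vB; rewrite (E : val Bn.1 = _) finset.setD11.
have -> : (v \in val Am.1) && ((val Bn.1 == val Am.1 :\ v) &&
   (plane_coord q (val Am.2) == plane_coord q' (val Bn.2) - plane_cell v)) =
   (val Am.1 == v |: val Bn.1) &&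
   (plane_coord q (val Am.2) == plane_coord q' (val Bn.2) - plane_cell v).
  rewrite andbA; congr (_ && _); apply/andP/eqP => [[vA /eqP ->]|->].
    by rewrite finset.setD1K.
  by rewrite finset.setU11 finset.setU1K.
case: eqP => [->|] /=; rewrite ?mulr0 //.
by case: ifP; rewrite ?mulr0 ?mulr1 // -wedge_signU1.
Qed.

Lemma chain_of_diff p q p' q' (f : koszul k D p q) : p' = p - 1 -> q' = q + 1 ->
  chain_of (koszul_fun p' q' f) = pdiff (chain_of f).
Proof.
move=> pE qE; apply: chainP => B y.
have Sd : supported p' (surface q') (pdiff (chain_of f)).
  rewrite pE qE; apply: supported_diff (supported_chain_of (f := f)) _ => v x.
  exact: surface_cell.
have [[Bp Sy]|nS] := pselect (#|B|%:Z = p' /\ surface q' y); last first.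
  have [->|/Sd//] := eqVneq (pdiff (chain_of f) B y) 0.
  by apply/eqP/negPn/negP => /supported_chain_of.
have [B' BE] := wedge_basisP Bp; have [P PE] := dilate_point Sy.
rewrite -BE -PE (@chain_ofE _ _ _ (B', P)) ffunE.
under eq_bigr do rewrite koszul_coefE //= mulr_suml.
rewrite exchange_big /=; apply: eq_bigr => v _; rewrite /contract.
case: ifP => _; first by rewrite big1 // => Am _; rewrite mul0r.
rewrite /chain_of mulr_sumr; apply: eq_bigr => Am _.
by rewrite mulrA.
Qed.

Lemma kappa_surface (p q : nat) n :
  subquotient_dim (@cycle k I plane plane_cell surface p q)
    (@boundary k I plane plane_cell surface p q) n ->
  kappa k D p q = n.
Proof.
move=> dim_n; have kerE (f : koszul k D p q) :
    f \in lker (koszul_diff k D p q (p%:Z - 1) (q%:Z + 1)) <->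
    pdiff (chain_of f) = 0.
  rewrite memv_ker lfunE /= -(@chain_of_diff _ _ (p%:Z - 1) (q%:Z + 1)) //; split=> [/eqP->|/chain_of_eq0 ->//].
  by rewrite linear0.
have imgE (f : koszul k D p q) :
    f \in limg (koszul_diff k D (p%:Z + 1) (q%:Z - 1) p q) <->
    boundary plane_cell surface p q (chain_of f).
  split=> [/memv_imgP[w _ ->]|[w Sw fw]].
    exists (chain_of w); first exact: supported_chain_of.
    by rewrite lfunE /= chain_of_diff //; lia.
  have [g gw] := chain_of_surj Sw.
  apply/memv_imgP; exists g; rewrite ?memvf // lfunE /=.
  apply/eqP; rewrite -subr_eq0; apply/eqP/chain_of_eq0.
  by rewrite linearB /= fw -gw (@chain_of_diff (p%:Z + 1) (q%:Z - 1)) ?subrr //; lia.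
apply: subquotient_dim_vspace.
  apply/subvP => f /imgE[w Sw fw]; apply/kerE.
  by rewrite fw diffK.
have surj z : cycle plane_cell surface p q z -> exists f : koszul k D p q, chain_of f = z.
  by move=> [Sz _]; exact: chain_of_surj.
apply: eq_subquotient_dim (subquotient_dim_preim surj dim_n) => f.
  split=> [[_ df]|/kerE df]; first exact/kerE.
  by split=> //; exact: supported_chain_of.
by split=> /imgE.
Qed.

Theorem kappa_scroll_betti (p q : nat) : conic_lo lo <= conic_hi hi + 1 ->
  kappa k D p q = (scroll_betti #|free_cells row col lo| 0 p q +
    scroll_betti #|free_cells row col lo| (conic_hi hi - conic_lo lo)
      (p%:Z - 1) (q%:Z - 1))%N.
Proof. by move=> bge; apply/kappa_surface/surface_homology_dim. Qed.

End KoszulOfPolygon.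

(** * Lattice polygons of width two *)

Lemma int_set_min (P : int -> Prop) (m j0 : int) :
  P j0 -> (forall j, P j -> m <= j) ->
  exists2 j, P j & forall j', P j' -> j <= j'.
Proof.
move=> Pj0 Pm.
have exP : exists n : nat, `[< P (m + n%:Z) >].
  exists `|j0 - m|%N; apply/asboolP; have := Pm _ Pj0.
  by move=> mj; rewrite gez0_abs ?subr_ge0 // subrKC.
case: (ex_minnP exP) => n /asboolP Pn n_min; exists (m + n%:Z) => // j Pj.
have mj := Pm _ Pj; have := n_min `|j - m|%N.
rewrite gez0_abs ?subr_ge0 // subrKC => /(_ (asboolT Pj)); lia.
Qed.

Section ConvexHull.
Variable R : realType.
Implicit Types (u : 'rV[int]_2) (x y : 'rV[R]_2).

Definition dot u (P : 'rV[int]_2) : int := \sum_j u 0 j * P 0 j.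

Lemma dotE u P : dot u P = u 0 0 * P 0 0 + u 0 1 * P 0 1.
Proof.
rewrite /dot !big_ord_recl big_ord0 addr0.
by congr (u _ _ * P _ _ + u _ _ * P _ _); apply: val_inj.
Qed.

Lemma linear_formE u x : linear_form u x = (u 0 0)%:~R * x 0 0 + (u 0 1)%:~R * x 0 1.
Proof.
rewrite /linear_form !big_ord_recl big_ord0 addr0.
by congr ((u _ _)%:~R * x _ _ + (u _ _)%:~R * x _ _); apply: val_inj.
Qed.

Lemma linear_form_embed u P : linear_form u (lattice_embed R P) = (dot u P)%:~R.
Proof. by rewrite linear_formE dotE !mxE intrD !intrM. Qed.

Lemma linear_formD u x y : linear_form u (x + y) = linear_form u x + linear_form u y.
Proof. by rewrite !linear_formE !mxE; ring. Qed.

Lemma linear_formZ u a x : linear_form u (a *: x) = a * linear_form u x.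
Proof. by rewrite !linear_formE !mxE; ring. Qed.

Lemma linear_form_sum u (J : finType) (a : J -> R) (y : J -> 'rV[R]_2) :
  linear_form u (\sum_j a j *: y j) = \sum_j a j * linear_form u (y j).
Proof.
elim/big_ind2: _ => [|x1 s1 x2 s2 <- <-|j _].
- by rewrite linear_formE !mxE !mulr0 addr0.
- exact: linear_formD.
- exact: linear_formZ.
Qed.

Lemma dotD u P Q : dot u (P + Q) = dot u P + dot u Q.
Proof. by rewrite !dotE !mxE; ring. Qed.

Variables (n : nat) (v : 'I_n -> 'rV[int]_2).
Local Notation D := (lattice_hull (R := R) v).

Lemma hull_vertex i : D (lattice_embed R (v i)).
Proof.
exists (fun j => (j == i)%:R); split=> [j||].
- exact: ler0n.
- by rewrite (bigD1 i) //= eqxx big1 ?addr0 // => j /negPf ->.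
- rewrite (bigD1 i) //= eqxx scale1r big1 ?addr0 // => j /negPf ->.
  by rewrite scale0r.
Qed.

Lemma hull_convex (J : finType) (a : J -> R) (y : J -> 'rV[R]_2) :
  (forall j, 0 <= a j) -> \sum_j a j = 1 -> (forall j, D (y j)) ->
  D (\sum_j a j *: y j).
Proof.
move=> a0 a1 /boolp.choice[t tP].
exists (fun i => \sum_j a j * t j i); split=> [i||].
- by apply: sumr_ge0 => j _; have [t0 _ _] := tP j; rewrite mulr_ge0.
- rewrite exchange_big /= -a1; apply: eq_bigr => j _.
  by have [_ t1 _] := tP j; rewrite -mulr_sumr t1 mulr1.
- under [RHS]eq_bigr do rewrite scaler_suml.
  rewrite exchange_big /=; apply: eq_bigr => j _.
  have [_ _ {1}->] := tP j; rewrite scaler_sumr.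
  by apply: eq_bigr => i _; rewrite scalerA.
Qed.

Lemma hull_convex2 (a : R) x y : 0 <= a <= 1 -> D x -> D y ->
  D (a *: x + (1 - a) *: y).
Proof.
move=> /andP[a0 a1] Dx Dy.
have := @hull_convex bool (fun b => if b then a else 1 - a) (fun b => if b then x else y).
rewrite !big_bool /=; apply; [by case; lra|by lra|by case].
Qed.

Lemma hull_form_ge u (m : R) x : (forall i, m <= (dot u (v i))%:~R) -> D x ->
  m <= linear_form u x.
Proof.
move=> mv [t [t0 t1 ->]]; rewrite linear_form_sum -[m]mulr1 -t1 mulr_sumr.
by apply: ler_sum => i _; rewrite mulrC linear_form_embed ler_wpM2l.
Qed.

Lemma hull_form_le u (m : R) x : (forall i, (dot u (v i))%:~R <= m) -> D x ->
  linear_form u x <= m.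
Proof.
move=> mv [t [t0 t1 ->]]; rewrite linear_form_sum -[m]mulr1 -t1 mulr_sumr.
by apply: ler_sum => i _; rewrite [m * _]mulrC linear_form_embed ler_wpM2l.
Qed.

Lemma directional_width_hull u i j :
  (forall l, dot u (v j) <= dot u (v l) <= dot u (v i)) ->
  directional_width D u = (dot u (v i) - dot u (v j))%:~R.
Proof.
move=> ext; rewrite intrB /directional_width.
have ub : ubound (linear_form u @` D) (dot u (v i))%:~R.
  move=> _ [x Dx <-]; apply: hull_form_le => // l.
  by rewrite ler_int; case/andP: (ext l).
have lb : lbound (linear_form u @` D) (dot u (v j))%:~R.
  move=> _ [x Dx <-]; apply: hull_form_ge => // l.
  by rewrite ler_int; case/andP: (ext l).
have im l : (linear_form u @` D) (dot u (v l))%:~R.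
  by exists (lattice_embed R (v l)); [exact: hull_vertex|exact: linear_form_embed].
congr (_ - _); apply/eqP; rewrite eq_le; apply/andP; split.
- by apply: ge_sup => //; eexists; exact: (im i).
- by apply: ub_le_sup; [exists (dot u (v i))%:~R | exact: im].
- by apply: ge_inf; [exists (dot u (v j))%:~R | exact: im].
- by apply: lb_le_inf => //; eexists; exact: (im j).
Qed.

Lemma extremal_vertices (f : 'I_n -> int) (i0 : 'I_n) :
  exists i j, forall l, f j <= f l <= f i.
Proof.
case: (@arg_maxP _ _ _ i0 xpredT f isT) => i _ maxi.
case: (@arg_minP _ _ _ i0 xpredT f isT) => j _ minj.
by exists i, j => l; rewrite minj //=; exact: maxi.
Qed.

(** A form of minimal width is primitive, since dividing it by the gcd d of its coefficients divides
    the width by d. A Bezout relation then completes it to a basis of the dual lattice. *)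
Lemma width2_coordinates : two_dimensional D -> has_lattice_width D 2 ->
  exists (u w : 'rV[int]_2) (c : int),
  [/\ u 0 0 * w 0 1 - u 0 1 * w 0 0 = 1,
      forall i, c <= dot u (v i) <= c + 2,
      exists i, dot u (v i) = c & exists i, dot u (v i) = c + 2].
Proof.
move=> [x [_ [_ [[t [_ t1 _]] _ _ _]]]] [[u u0 wu] minw].
have [i0] : exists i : 'I_n, True.
  case: n t t1 {u u0 wu minw} => [|m] t t1; last by exists ord0.
  by move: t1; rewrite big_ord0 => /eqP; rewrite eq_sym oner_eq0.
move=> _; set d := gcdz (u 0 0) (u 0 1).
have d0 : 0 < d.
  rewrite lt_neqAle; apply/andP; split=> //; apply: contraNneq u0 => /esym/eqP.
  rewrite gcdz_eq0 => /andP[/eqP u00 /eqP u01]; apply/eqP/rowP => j.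
  rewrite mxE; case: j => -[|[|//]] lt2.
    by rewrite -[RHS]u00; congr (u _ _); apply: val_inj.
  by rewrite -[RHS]u01; congr (u _ _); apply: val_inj.
pose u' : 'rV[int]_2 := \row_(j < 2) (if j == 0 then divz (u 0 0) d else divz (u 0 1) d).
have u'0 : u 0 0 = d * u' 0 0 by rewrite mxE /= mulrC divzK ?dvdz_gcdl.
have u'1 : u 0 1 = d * u' 0 1 by rewrite mxE /= mulrC divzK ?dvdz_gcdr.
have dotu P : dot u P = d * dot u' P by rewrite !dotE u'0 u'1; ring.
have u'n0 : u' != 0.
  apply: contraNneq u0 => u'z; apply/eqP/rowP => j; rewrite mxE.
  case: j => -[|[|//]] lt2.
    rewrite -(mulr0 d) -[in RHS](_ : u' 0 0 = 0); last by rewrite u'z mxE.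
    by rewrite -u'0; congr (u _ _); apply: val_inj.
  rewrite -(mulr0 d) -[in RHS](_ : u' 0 1 = 0); last by rewrite u'z mxE.
  by rewrite -u'1; congr (u _ _); apply: val_inj.
have [i [j ext]] := extremal_vertices (fun l => dot u' (v l)) i0.
have extu l : dot u (v j) <= dot u (v l) <= dot u (v i).
  by rewrite !dotu !ler_pM2l //; exact: ext.
have w2 : dot u (v i) - dot u (v j) = 2.
  by apply/eqP; rewrite -(eqr_int R) -(directional_width_hull extu) wu.
have d1 : d = 1.
  have := minw _ u'n0; rewrite (directional_width_hull ext).
  rewrite -[2]/(2%:~R) ler_int; move: w2; rewrite !dotu; nia.
have [e [f ef]] := Bezoutz (u 0 0) (u 0 1).
pose w : 'rV[int]_2 := \row_(j < 2) (if j == 0 then - f else e).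
exists u, w, (dot u (v j)); split.
- by rewrite !mxE /= -d1 /d -ef; ring.
- by move=> l; have := extu l; lia.
- by exists j.
- by exists i; lia.
Qed.

End ConvexHull.

Lemma three_rows (c m : int) : c <= m <= c + 2 -> exists r : 'I_3, m = c + r%:Z.
Proof.
move=> cm; have lt3 : (`|(m - c)%R| < 3)%N by lia.
by exists (Ordinal lt3) => /=; lia.
Qed.

Section LatticeCoordinates.
Variables (R : realType) (u w : 'rV[int]_2).
Hypothesis det_uw : u 0 0 * w 0 1 - u 0 1 * w 0 0 = 1.
Implicit Types (P Q S : 'rV[int]_2) (x y z : 'rV[R]_2).

Lemma row2P (T : nmodType) (x y : 'rV[T]_2) : x 0 0 = y 0 0 -> x 0 1 = y 0 1 -> x = y.
Proof.
move=> e0 e1; apply/rowP => -[[|[|//]] lt2].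
  by rewrite (_ : Ordinal lt2 = 0) //; exact: val_inj.
by rewrite (_ : Ordinal lt2 = 1) //; exact: val_inj.
Qed.

Lemma dot_inj P Q : dot u P = dot u Q -> dot w P = dot w Q -> P = Q.
Proof.
rewrite !dotE => hPQ wPQ.
have E0 S : S 0 0 = w 0 1 * (u 0 0 * S 0 0 + u 0 1 * S 0 1)
   - u 0 1 * (w 0 0 * S 0 0 + w 0 1 * S 0 1) by rewrite -[LHS]mul1r -det_uw; ring.
have E1 S : S 0 1 = u 0 0 * (w 0 0 * S 0 0 + w 0 1 * S 0 1)
   - w 0 0 * (u 0 0 * S 0 0 + u 0 1 * S 0 1) by rewrite -[LHS]mul1r -det_uw; ring.
by apply: row2P; [rewrite (E0 P) (E0 Q) | rewrite (E1 P) (E1 Q)]; rewrite hPQ wPQ.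
Qed.

Lemma dot_surj h i : exists2 P, dot u P = h & dot w P = i.
Proof.
exists (\row_(j < 2) if j == 0 then w 0 1 * h - u 0 1 * i else u 0 0 * i - w 0 0 * h).
  by rewrite dotE !mxE /= -[RHS]mul1r -det_uw; ring.
by rewrite dotE !mxE /= -[RHS]mul1r -det_uw; ring.
Qed.

Lemma linear_form_inj x y : linear_form u x = linear_form u y ->
  linear_form w x = linear_form w y -> x = y.
Proof.
have : (u 0 0)%:~R * (w 0 1)%:~R - (u 0 1)%:~R * (w 0 0)%:~R = 1 :> R.
  by rewrite -!intrM -intrB det_uw.
rewrite !linear_formE; move: (u 0 0)%:~R (u 0 1)%:~R (w 0 0)%:~R (w 0 1)%:~R.
move=> u0 u1 w0 w1 detR hxy wxy.
have E0 z : z 0 0 = w1 * (u0 * z 0 0 + u1 * z 0 1) - u1 * (w0 * z 0 0 + w1 * z 0 1).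
  by rewrite -[LHS]mul1r -detR; ring.
have E1 z : z 0 1 = u0 * (w0 * z 0 0 + w1 * z 0 1) - w0 * (u0 * z 0 0 + u1 * z 0 1).
  by rewrite -[LHS]mul1r -detR; ring.
by apply: row2P; [rewrite (E0 x) (E0 y) | rewrite (E1 x) (E1 y)]; rewrite hxy wxy.
Qed.

Variables (n : nat) (v : 'I_n -> 'rV[int]_2) (c : int).
Local Notation D := (lattice_hull (R := R) v).
Hypothesis vertex_rows : forall i, c <= dot u (v i) <= c + 2.
Hypothesis bottom_vertex : exists i, dot u (v i) = c.
Hypothesis top_vertex : exists i, dot u (v i) = c + 2.
Hypothesis dim2 : two_dimensional D.

Definition lattice_member P : Prop := D (lattice_embed R P).

Lemma not_collinear (p s : R) :
  ~ (forall x, D x -> linear_form w x = p + s * linear_form u x).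
Proof.
move=> coll; have [x [y [z [Dx Dy Dz]]]] := dim2.
have dir t : D t -> linear_form w (t - x) = s * linear_form u (t - x).
  move=> Dt; rewrite -scaleN1r !linear_formD !linear_formZ !coll //; ring.
rewrite free_cons seq1_free span_seq1 => /andP[yz z0].
have [h0|h0] := eqVneq (linear_form u (z - x)) 0.
  case/eqP: z0; apply: linear_form_inj.
    by rewrite h0 linear_formE !mxE !mulr0 addr0.
  by rewrite dir // h0 mulr0 linear_formE !mxE !mulr0 addr0.
case/negP: yz; apply/vlineP.
exists (linear_form u (y - x) / linear_form u (z - x)).
apply: linear_form_inj; rewrite linear_formZ ?dir // ?divfK //.
by rewrite mulrCA divfK.
Qed.

Lemma hull_mix (a : R) x y z : 0 <= a <= 1 -> D x -> D y ->
  linear_form u z = a * linear_form u x + (1 - a) * linear_form u y ->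
  linear_form w z = a * linear_form w x + (1 - a) * linear_form w y -> D z.
Proof.
move=> a01 Dx Dy hz wz.
suff -> : z = a *: x + (1 - a) *: y by exact: hull_convex2.
by apply: linear_form_inj; rewrite linear_formD !linear_formZ.
Qed.

Lemma lattice_member_between P Q S : lattice_member P -> lattice_member Q ->
  dot u P = dot u S -> dot u Q = dot u S ->
  dot w P <= dot w S <= dot w Q -> lattice_member S.
Proof.
move=> LP LQ hP hQ /andP[PS SQ].
have [PQ|PQ] := eqVneq (dot w P) (dot w Q).
  by have -> : S = P by apply: dot_inj; [rewrite hP|lia].
have wPQ : (0 : R) < (dot w Q - dot w P)%:~R by rewrite ltr0z; lia.
pose a : R := (dot w Q - dot w S)%:~R / (dot w Q - dot w P)%:~R.
have aE : a * (dot w Q - dot w P)%:~R = (dot w Q - dot w S)%:~R.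
  by rewrite divfK // gt_eqF.
apply: (@hull_mix a) LP LQ _ _; rewrite ?linear_form_embed ?hP ?hQ.
- rewrite divr_ge0 ?ler0z //=; try lia.
  by rewrite ler_pdivrMr // mul1r ler_int; lia.
- ring.
- by move: aE; rewrite !intrB; lra.
Qed.

Lemma lattice_member_row P : lattice_member P -> c <= dot u P <= c + 2.
Proof.
move=> LP; rewrite -!(ler_int R) -linear_form_embed; apply/andP; split.
  by apply: hull_form_ge LP => i; rewrite ler_int; case/andP: (vertex_rows i).
by apply: hull_form_le LP => i; rewrite ler_int; case/andP: (vertex_rows i).
Qed.

Lemma lattice_member_col : exists B : int, forall P, lattice_member P ->
  - B <= dot w P <= B.
Proof.
exists (\sum_i `|dot w (v i)|) => P LP.
have B i : `|dot w (v i)| <= \sum_i `|dot w (v i)|.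
  by rewrite (bigD1 i) //= lerDl sumr_ge0.
rewrite -!(ler_int R) -linear_form_embed; apply/andP; split.
  by apply: hull_form_ge LP => i; rewrite ler_int; have := B i; lia.
by apply: hull_form_le LP => i; rewrite ler_int; have := B i; lia.
Qed.

Lemma row_extrema h : (exists2 P, lattice_member P & dot u P = h) ->
  exists a b, a <= b /\
    forall P, dot u P = h -> lattice_member P <-> a <= dot w P <= b.
Proof.
move=> [P0 LP0 hP0]; have [B PB] := lattice_member_col.
(* The sign s treats the minimum and the maximum at once. *)
pose T s j := exists P, [/\ lattice_member P, dot u P = h & s * dot w P = j].
have ext s : s * s = 1 -> exists2 j, T s j & forall j', T s j' -> j <= j'.
  move=> ss; apply: (@int_set_min _ (- B) (s * dot w P0)); first by exists P0.
  move=> _ [P [LP _ <-]]; have := PB P LP.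
  have : s = 1 \/ s = -1 by nia.
  by case=> ->; lia.
have [a [Pa [LPa hPa wPa]] amin] := ext 1 erefl.
have [b [Pb [LPb hPb wPb]] bmin] := ext (-1) erefl.
exists a, (- b); split.
  have : a <= dot w Pb by apply: amin; exists Pb; rewrite mul1r.
  by lia.
move=> P hP; split=> [LP|/andP[aP Pb']].
  have : a <= dot w P by apply: amin; exists P; rewrite mul1r.
  have : b <= - dot w P by apply: bmin; exists P; rewrite mulN1r.
  by lia.
by apply: (lattice_member_between LPa LPb); rewrite ?hP //; lia.
Qed.

(** Otherwise all vertices lie on the outer rows. If each of these has a single lattice point, the
    polygon is a segment; if not, two columns of even sum can be chosen, and their midpoint is a
    lattice point on the middle row. *)
Lemma middle_row : exists2 P, lattice_member P & dot u P = c + 1.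
Proof.
apply: contrapT => none.
have row_v i : dot u (v i) = c \/ dot u (v i) = c + 2.
  have := vertex_rows i; have : dot u (v i) <> c + 1; last by lia.
  by move=> e; apply: none; exists (v i) => //; exact: hull_vertex.
have [i0 hi0] := bottom_vertex; have [i2 hi2] := top_vertex.
have [|a0 [b0 [ab0 row0P]]] := @row_extrema c.
  by exists (v i0) => //; exact: hull_vertex.
have [|a2 [b2 [ab2 row2P']]] := @row_extrema (c + 2).
  by exists (v i2) => //; exact: hull_vertex.
have [single|wide] := pselect (a0 = b0 /\ a2 = b2).
  have [e0 e2] := single.
  pose s : R := (a2 - a0)%:~R / 2; pose p : R := a0%:~R - s * c%:~R.
  apply: (@not_collinear p s) => x [t [t0 t1 ->]].
  rewrite !linear_form_sum -[p]mulr1 -t1 !mulr_sumr -big_split /=.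
  apply: eq_bigr => i _; rewrite !linear_form_embed.
  rewrite [s * _]mulrCA [p * _]mulrC -mulrDr; congr (_ * _).
  have [hi|hi] := row_v i; rewrite hi /p.
    have : a0 <= dot w (v i) <= b0 by apply/row0P => //; exact: hull_vertex.
    rewrite -e0 => wi; have -> : dot w (v i) = a0 by lia.
    by rewrite subrK.
  have : a2 <= dot w (v i) <= b2 by apply/row2P' => //; exact: hull_vertex.
  rewrite -e2 => wi; have -> : dot w (v i) = a2 by lia.
  by rewrite /s intrB [(c + 2)%:~R]intrD; field.
have [a [b [aab bab [j abj]]]] : exists a b, [/\ a0 <= a <= b0, a2 <= b <= b2 &
    exists j, a + b = j * 2].
  have [odd|even] := boolP (2 %| a0 + a2)%Z.
    by exists a0, a2; split; [lia|lia|case/dvdzP: odd => j ?; exists j].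
  have [j jE] : exists j, a0 + a2 + 1 = j * 2.
    by exists (divz (a0 + a2 + 1) 2); lia.
  have [lt0|ge0] := ltP a0 b0.
    by exists (a0 + 1), a2; split; [lia|lia|exists j; lia].
  by exists a0, (a2 + 1); split; [lia|lia|exists j; lia].
have [Pa hPa wPa] := dot_surj c a; have [Pb hPb wPb] := dot_surj (c + 2) b.
have [S hS wS] := dot_surj (c + 1) j.
have LPa : lattice_member Pa by apply/row0P; rewrite ?wPa.
have LPb : lattice_member Pb by apply/row2P'; rewrite ?wPb.
apply: none; exists S => //; apply: (@hull_mix (1 / 2)) LPa LPb _ _.
- by lra.
- by rewrite !linear_form_embed hPa hPb hS !intrD; field.
- rewrite !linear_form_embed wPa wPb wS.
  by have /(congr1 (fun m : int => m%:~R : R)) := abj; rewrite intrD intrM; lra.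
Qed.

Lemma lattice_rows : exists lo hi : 'I_3 -> int, (forall r, lo r <= hi r) /\
  forall (r : 'I_3) P, dot u P = c + r%:Z -> lattice_member P <-> lo r <= dot w P <= hi r.
Proof.
have rowP (r : 'I_3) : exists ab : int * int, ab.1 <= ab.2 /\
    forall P, dot u P = c + r%:Z -> lattice_member P <-> ab.1 <= dot w P <= ab.2.
  have [|a [b abP]] := @row_extrema (c + r%:Z); last by exists (a, b).
  move: r; apply: rows_ind => /=.
  - by have [i hi] := bottom_vertex; exists (v i); rewrite ?addr0 //; exact: hull_vertex.
  - exact: middle_row.
  - by have [i hi] := top_vertex; exists (v i) => //; exact: hull_vertex.
have /boolp.choice[f fP] := rowP.
exists (fun r => (f r).1), (fun r => (f r).2); split=> [r|r]; first by have [] := fP r.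
exact: (fP r).2.
Qed.

End LatticeCoordinates.

(** For s = -1 the condition is an integral lower bound on t, which rounding down respects. For s <=
    -2 the bound could be fractional, and rounding could violate it. *)
Lemma floor_affine (R : realType) (t : R) (s m : int) : -1 <= s ->
  t * s%:~R <= m%:~R -> Num.floor t * s <= m.
Proof.
move=> s1 tm; have [s0|s0] := leP 0 s.
  rewrite -(ler_int R) intrM; apply: le_trans tm.
  by rewrite ler_wpM2r ?ler0z // floor_le.
have sE : s = -1 by lia.
have : - m <= Num.floor t; last by rewrite sE; lia.
by rewrite floor_ge_int intrN; move: tm; rewrite sE intrN; lra.
Qed.

Lemma near_linear_forms (R : realType) (u w : 'rV[int]_2) (z : 'rV[R]_2) (e : R) :
  0 < e -> exists2 d : R, 0 < d & forall x, ball z d x ->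
    `|linear_form u x - linear_form u z| <= e /\
    `|linear_form w x - linear_form w z| <= e.
Proof.
move=> e0; pose M : R := 1 + `|(u 0 0)%:~R| + `|(u 0 1)%:~R| + `|(w 0 0)%:~R| + `|(w 0 1)%:~R|.
have M0 : 0 < M by rewrite /M; do 4!apply: ltr_wpDr => //.
exists (e / M) => [|x]; first exact: divr_gt0.
move=> [_ bx].
have dM : e / M * M = e by rewrite divfK // gt_eqF.
set d := e / M in bx dM.
have d0 : 0 < d by rewrite /d divr_gt0.
have /ltW b0 := bx 0 0; have /ltW b1 := bx 0 1.
have bound (a b s t : R) : `|s| <= d -> `|t| <= d -> `|a| + `|b| <= M ->
    `|a * s + b * t| <= e.
  move=> sd td abM; apply: le_trans (ler_normD _ _) _; rewrite !normrM.
  apply: (@le_trans _ _ ((`|a| + `|b|) * d)).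
    by rewrite mulrDl lerD // ler_wpM2l.
  by rewrite -dM mulrC ler_wpM2l // ltW.
rewrite !linear_formE.
have E (a b s t s' t' : R) : a * s + b * t - (a * s' + b * t') =
  a * (s - s') + b * (t - t') by ring.
by split; rewrite E; apply: bound; rewrite 1?distrC //;
  move: (normr_ge0 (u 0 0)%:~R : 0 <= _ :> R) (normr_ge0 (u 0 1)%:~R : 0 <= _ :> R)
  (normr_ge0 (w 0 0)%:~R : 0 <= _ :> R) (normr_ge0 (w 0 1)%:~R : 0 <= _ :> R);
  rewrite /M; lra.
Qed.

(** * Convexity of the three rows and the lattice points of dilates *)

Section LatticeRows.
Variables (R : realType) (u w : 'rV[int]_2).
Hypothesis det_uw : u 0 0 * w 0 1 - u 0 1 * w 0 0 = 1.
Implicit Types (P Q S : 'rV[int]_2) (x y z : 'rV[R]_2).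
Variables (n : nat) (v : 'I_n -> 'rV[int]_2) (c : int).
Local Notation D := (lattice_hull (R := R) v).
Hypothesis vertex_rows : forall i, c <= dot u (v i) <= c + 2.
Hypothesis dim2 : two_dimensional D.
Variables (lo hi : 'I_3 -> int).
Hypothesis lo_le_hi : forall r, lo r <= hi r.
Hypothesis rowsP : forall (r : 'I_3) P, dot u P = c + r%:Z ->
  lattice_member R v P <-> lo r <= dot w P <= hi r.

(** The polygon is the convex hull of three parallel segments, and a gives the mass that a convex
    combination puts on each of them. *)
Definition row_weights (a : 'I_3 -> R) x : Prop :=
  [/\ forall r, 0 <= a r, a row0 + a row1 + a row2 = 1,
      linear_form u x = c%:~R + a row1 + a row2 * 2,
      a row0 * (lo row0)%:~R + a row1 * (lo row1)%:~R + a row2 * (lo row2)%:~R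
        <= linear_form w x
    & linear_form w x <=
      a row0 * (hi row0)%:~R + a row1 * (hi row1)%:~R + a row2 * (hi row2)%:~R].

Lemma cell_point (r : 'I_3) j : lo r <= j <= hi r ->
  exists P, [/\ dot u P = c + r%:Z, dot w P = j & lattice_member R v P].
Proof.
move=> jr; have [P hP wP] := dot_surj det_uw (c + r%:Z) j.
by exists P; split=> //; apply/(rowsP hP); rewrite wP.
Qed.

Lemma hull_row_weights x : D x -> exists a, row_weights a x.
Proof.
move=> [t [t0 t1 xE]].
have /boolp.choice[rv rvP] i : exists r : 'I_3, dot u (v i) = c + r%:Z.
  exact: three_rows.
pose a r := \sum_(i | rv i == r) t i.
have aE (g : 'I_3 -> R) : a row0 * g row0 + a row1 * g row1 + a row2 * g row2 =
    \sum_i t i * g (rv i).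
  rewrite -(sum_rows (fun r => a r * g r)) [RHS](partition_big rv xpredT) //=.
  apply: eq_bigr => r _; rewrite mulr_suml.
  by apply: eq_bigr => i /eqP ->.
have vb i : lo (rv i) <= dot w (v i) <= hi (rv i).
  by apply/(rowsP (rvP i)); exact: hull_vertex.
exists a; split.
- by move=> r; apply: sumr_ge0.
- have := aE (fun=> 1); rewrite !mulr1 => ->.
  by under eq_bigr do rewrite mulr1.
- have := aE (fun r => (r : nat)%:R); rewrite mulr0 add0r mulr1 -addrA => ->.
  have -> : c%:~R = \sum_i t i * c%:~R by rewrite -mulr_suml t1 mul1r.
  rewrite xE linear_form_sum -big_split /=.
  apply: eq_bigr => i _; rewrite linear_form_embed rvP intrD mulrDr.
  by rewrite -pmulrn.
- rewrite (aE (fun r => (lo r)%:~R)) xE linear_form_sum; apply: ler_sum => i _.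
  by rewrite linear_form_embed ler_wpM2l // ler_int; case/andP: (vb i).
- rewrite (aE (fun r => (hi r)%:~R)) xE linear_form_sum; apply: ler_sum => i _.
  by rewrite linear_form_embed ler_wpM2l // ler_int; case/andP: (vb i).
Qed.

(** With the weights fixed, the combinations of the left ends and of the right ends bound a segment
    in D that passes through x. *)
Lemma row_weights_hull a x : row_weights a x -> D x.
Proof.
move=> [a0 a1 hx lox hix].
have /boolp.choice[P PP] r : exists P, [/\ dot u P = c + (r : 'I_3)%:Z,
    dot w P = lo r & lattice_member R v P].
  by apply: cell_point; rewrite lexx lo_le_hi.
have /boolp.choice[Q QP] r : exists P, [/\ dot u P = c + (r : 'I_3)%:Z,
    dot w P = hi r & lattice_member R v P].
  by apply: cell_point; rewrite lexx lo_le_hi.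
have s1 : \sum_r a r = 1 by rewrite sum_rows.
pose X := \sum_r a r *: lattice_embed R (P r).
pose Y := \sum_r a r *: lattice_embed R (Q r).
have DX : D X by apply: hull_convex => // r; have [] := PP r.
have DY : D Y by apply: hull_convex => // r; have [] := QP r.
have hE (F : 'I_3 -> 'rV[int]_2) : (forall r, dot u (F r) = c + r%:Z) ->
    linear_form u (\sum_r a r *: lattice_embed R (F r)) = linear_form u x.
  move=> FE; rewrite linear_form_sum sum_rows !linear_form_embed !FE hx !intrD.
  rewrite /= -[(0%:Z)%:~R]/(0 : R) -[(1%:Z)%:~R]/(1 : R) -[(2%:Z)%:~R]/(2 : R).
  rewrite [in RHS](_ : c%:~R = (a row0 + a row1 + a row2) * c%:~R); first by ring.
  by rewrite a1 mul1r.
have hX : linear_form u X = linear_form u x by apply: hE => r; have [] := PP r.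
have hY : linear_form u Y = linear_form u x by apply: hE => r; have [] := QP r.
have wX : linear_form w X =
  a row0 * (lo row0)%:~R + a row1 * (lo row1)%:~R + a row2 * (lo row2)%:~R.
  rewrite linear_form_sum sum_rows !linear_form_embed.
  by have [_ -> _] := PP row0; have [_ -> _] := PP row1; have [_ -> _] := PP row2.
have wY : linear_form w Y =
  a row0 * (hi row0)%:~R + a row1 * (hi row1)%:~R + a row2 * (hi row2)%:~R.
  rewrite linear_form_sum sum_rows !linear_form_embed.
  by have [_ -> _] := QP row0; have [_ -> _] := QP row1; have [_ -> _] := QP row2.
rewrite -wX in lox; rewrite -wY in hix.
have [XY|XY] := eqVneq (linear_form w X) (linear_form w Y).
  have -> : x = X; last by [].
  by apply: (linear_form_inj det_uw); [rewrite hX | lra].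
have XY0 : 0 < linear_form w Y - linear_form w X.
  by rewrite subr_gt0 lt_neqAle XY; lra.
pose b := (linear_form w Y - linear_form w x) / (linear_form w Y - linear_form w X).
have bE : b * (linear_form w Y - linear_form w X) = linear_form w Y - linear_form w x.
  by rewrite divfK // gt_eqF.
apply: (hull_mix det_uw (a := b) _ DX DY); rewrite ?hX ?hY.
- apply/andP; split; first by rewrite /b divr_ge0 //; lra.
  by rewrite ler_pdivrMr // mul1r; lra.
- ring.
- lra.
Qed.

(** Otherwise the segment from the first point of the middle row to the midpoint of the first points
    of the outer rows has length at least 1, and so contains the lattice point one column further
    left. *)
Lemma lo_middle : lo row1 * 2 <= lo row0 + lo row2 + 1.
Proof.
rewrite leNgt; apply/negP => lt_lo.
have [P hP wP] := dot_surj det_uw (c + row1%:Z) (lo row1 - 1).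
suff : lattice_member R v P by move/(rowsP hP); rewrite wP; lia.
pose g : R := (lo row1 * 2 - lo row0 - lo row2)%:~R.
have g2 : 2 <= g by rewrite /g -[2]/(2%:~R) ler_int; lia.
(* The mass to be moved from the middle row to the outer rows: it displaces the column by s g / 2 =
   1. *)
pose s := 2 / g.
have sg : s * g = 2 by rewrite /s divfK // gt_eqF //; lra.
have s0 : 0 <= s by rewrite divr_ge0 //; lra.
have s1 : s <= 1 by rewrite ler_pdivrMr; lra.
have loE : s / 2 * (lo row0)%:~R + (1 - s) * (lo row1)%:~R + s / 2 * (lo row2)%:~R
   = (lo row1 - 1)%:~R.
  by move: sg; rewrite /g !intrB intrM; lra.
have mono r : ((lo r)%:~R : R) <= (hi r)%:~R by rewrite ler_int.
apply: (@row_weights_hull (fun r => nth 0 [:: s / 2; 1 - s; s / 2] r)).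
split; rewrite /= ?linear_form_embed ?wP ?hP ?loE //.
- by apply: rows_ind => /=; lra.
- by field.
- by rewrite intrD /=; lra.
- rewrite -loE; do 2?apply: lerD; apply: ler_wpM2l => //; lra.
Qed.

Lemma hi_middle : hi row0 + hi row2 - 1 <= hi row1 * 2.
Proof.
rewrite leNgt; apply/negP => lt_hi.
have [P hP wP] := dot_surj det_uw (c + row1%:Z) (hi row1 + 1).
suff : lattice_member R v P by move/(rowsP hP); rewrite wP; lia.
pose g : R := (hi row0 + hi row2 - hi row1 * 2)%:~R.
have g2 : 2 <= g by rewrite /g -[2]/(2%:~R) ler_int; lia.
pose s := 2 / g.
have sg : s * g = 2 by rewrite /s divfK // gt_eqF //; lra.
have s0 : 0 <= s by rewrite divr_ge0 //; lra.
have s1 : s <= 1 by rewrite ler_pdivrMr; lra.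
have hiE : s / 2 * (hi row0)%:~R + (1 - s) * (hi row1)%:~R + s / 2 * (hi row2)%:~R
   = (hi row1 + 1)%:~R.
  by move: sg; rewrite /g intrB !intrD intrM; lra.
have mono r : ((lo r)%:~R : R) <= (hi r)%:~R by rewrite ler_int.
apply: (@row_weights_hull (fun r => nth 0 [:: s / 2; 1 - s; s / 2] r)).
split; rewrite /= ?linear_form_embed ?wP ?hP ?hiE //.
- by apply: rows_ind => /=; lra.
- by field.
- by rewrite intrD /=; lra.
- rewrite -hiE; do 2?apply: lerD; apply: ler_wpM2l => //; lra.
Qed.

(** That is, b >= -1. The defect of one comes from comparing an outer end on one side with a middle
    end on the other. *)
Lemma conic_lo_hi : conic_lo lo <= conic_hi hi + 1.
Proof.
have := lo_middle; have := hi_middle; rewrite /conic_lo /conic_hi.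
by have := lo_le_hi row0; have := lo_le_hi row1; have := lo_le_hi row2; lia.
Qed.

(* A weight a on the bottom row can be rounded down: the left end of the possible
   columns is an affine function of a with an integral slope >= -1, so that the
   bound on a that it imposes is either an upper bound or an integral lower bound. *)
Lemma dilate_surface (q : int) P : dilate q D (lattice_embed R P) <->
  surface lo hi q (dot u P - c * q, dot w P).
Proof.
have lo_slope : -1 <= lo row0 + lo row2 - lo row1 * 2 by have := lo_middle; lia.
have hi_slope : -1 <= - (hi row0 + hi row2 - hi row1 * 2) by have := hi_middle; lia.
have split_fiber (m h i l0 l1 l2 : int) :
    i - (m * l0 + (q * 2 - m * 2 - h) * l1 + (h - q + m) * l2) =
    i - (q * 2 - h) * l1 - (h - q) * l2 - m * (l0 + l2 - l1 * 2) by ring.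
split.
  move=> [q0 [y Dy PE]]; have [a [a0 a1 hy loy hiy]] := hull_row_weights Dy.
  have qR0 : 0 <= (q%:~R : R) by rewrite ler0z.
  have hPE : (dot u P)%:~R = q%:~R * linear_form u y by rewrite -linear_form_embed PE linear_formZ.
  have wPE : (dot w P)%:~R = q%:~R * linear_form w y by rewrite -linear_form_embed PE linear_formZ.
  pose b r := q%:~R * a r.
  have b0 r : 0 <= b r by rewrite mulr_ge0.
  have [h hdef] : exists h, h = dot u P - c * q by exists (dot u P - c * q).
  rewrite -hdef; pose i := dot w P.
  have bsum : b row0 + b row1 + b row2 = q%:~R by rewrite /b -!mulrDr a1 mulr1.
  have hb : h%:~R = b row1 + b row2 * 2.
    by rewrite hdef intrB intrM hPE hy /b; ring.
  have lob : b row0 * (lo row0)%:~R + b row1 * (lo row1)%:~R + b row2 * (lo row2)%:~R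
      <= i%:~R.
    by rewrite /i wPE /b -!mulrA -!mulrDr ler_wpM2l.
  have hib : i%:~R <=
      b row0 * (hi row0)%:~R + b row1 * (hi row1)%:~R + b row2 * (hi row2)%:~R.
    by rewrite /i wPE /b -!mulrA -!mulrDr ler_wpM2l.
  have b1E : b row1 = (q * 2 - h)%:~R - b row0 * 2 by rewrite intrB intrM; lra.
  have b2E : b row2 = (h - q)%:~R + b row0 by rewrite intrB; lra.
  have b00 := b0 row0; have b10 := b0 row1; have b20 := b0 row2.
  pose m := Num.floor (b row0).
  have mle : m%:~R <= b row0 by exact: floor_le.
  have [e0 e1 e2] := fiber_point_coords q m (h, i).
  exists (fiber_point q m (h, i)); last exact: proj_fiber_point.
  split.
  - apply: (@rows_ind (fun r => 0 <= (fiber_point q m (h, i)).1 r)).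
    + by rewrite e0 /m floor_ge_int.
    + rewrite e1 /= -(ler_int R) !intrB !intrM.
      by move: b10; rewrite b1E intrB intrM; lra.
    + rewrite e2 /= -lerBlDl sub0r opprB floor_ge_int.
      by move: b20; rewrite b2E !intrB; lra.
  - exact: degree_fiber_point.
  - rewrite above_rows e0 e1 e2 /=.
    rewrite split_fiber subr_ge0; apply: floor_affine => //.
    by move: lob; rewrite b1E b2E !(intrB, intrD, intrM); lra.
  - rewrite below_rows e0 e1 e2 /=.
    rewrite oppr0 -opprB split_fiber oppr_ge0 subr_le0 -lerN2 -mulrN.
    apply: floor_affine => //.
    by move: hib; rewrite b1E b2E !(intrB, intrD, intrM, intrN); lra.
move=> [x Sx [hP wP]]; have [x0 tx lx hx] := Sx.
have q0 := scroll_degree_ge0 Sx; split=> //.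
rewrite above_rows in lx; rewrite below_rows in hx; rewrite degree_rows in tx.
(* For q = 0 one cannot divide by q; here all exponents vanish, and the dilate is the origin because
   D is nonempty. *)
have [qz|qn0] := eqVneq q 0.
  have [y [_ [_ [Dy _ _ _]]]] := dim2; exists y => //.
  have PE : P = 0.
    have xz r : x.1 r = 0.
      have := x0 row0; have := x0 row1; have := x0 row2; move: tx; rewrite qz.
      by move: r; apply: (@rows_ind (fun r => _ -> _ -> _ -> _ -> x.1 r = 0));
        move: (x.1 row0) (x.1 row1) (x.1 row2) => m0 m1 m2; lia.
    move: hP wP lx hx; rewrite !xz qz !mul0r mulr0 !addr0 ?subr0 ?oppr0 ?sub0r.
    move=> hP -> lx hx.
    apply: (dot_inj det_uw); rewrite [RHS]dotE !mxE !mulr0 addr0 //.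
    by apply/eqP; rewrite eq_le lx andbT -oppr_ge0.
  by rewrite qz scale0r PE; apply/rowP => j; rewrite !mxE.
have qR : 0 < (q%:~R : R) by rewrite ltr0z; lia.
have qR0 : q%:~R != 0 :> R by rewrite gt_eqF.
exists (q%:~R^-1 *: lattice_embed R P); last by rewrite scalerA divff // scale1r.
have x0R r : 0 <= ((x.1 r)%:~R : R) by rewrite ler0z.
have txR : (x.1 row0)%:~R + (x.1 row1)%:~R + (x.1 row2)%:~R = q%:~R :> R.
  by rewrite -!intrD tx.
apply: (@row_weights_hull (fun r => (x.1 r)%:~R / q%:~R)).
rewrite /row_weights !linear_formZ !linear_form_embed; split.
- by move=> r; apply: divr_ge0 => //; exact: ltW.
- by rewrite -!mulrDl txR divff.
- have -> : dot u P = c * q + x.1 row1 + x.1 row2 * 2 by move: (x.1 row1) (x.1 row2) hP => m1 m2 hP; lia.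
  by rewrite !intrD !intrM; field.
- rewrite ![_ / _ * _]mulrAC -!mulrDl [q%:~R^-1 * _]mulrC ler_pM2r ?invr_gt0 //.
  rewrite -!intrM -!intrD ler_int -wP; move: lx.
  by move: (x.1 row0) (x.1 row1) (x.1 row2) x.2 => m0 m1 m2 i; lia.
- rewrite ![_ / _ * _]mulrAC -!mulrDl [q%:~R^-1 * _]mulrC ler_pM2r ?invr_gt0 //.
  rewrite -!intrM -!intrD ler_int -wP; move: hx.
  by move: (x.1 row0) (x.1 row1) (x.1 row2) x.2 => m0 m1 m2 i; lia.
Qed.

End LatticeRows.

(** * Lattice points in the interior *)

Section LatticeInterior.
Variables (R : realType) (u w : 'rV[int]_2).
Hypothesis det_uw : u 0 0 * w 0 1 - u 0 1 * w 0 0 = 1.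
Implicit Types (P Q S : 'rV[int]_2) (x y z : 'rV[R]_2).
Variables (n : nat) (v : 'I_n -> 'rV[int]_2) (c : int).
Local Notation D := (lattice_hull (R := R) v).
Hypothesis vertex_rows : forall i, c <= dot u (v i) <= c + 2.
Hypothesis dim2 : two_dimensional D.
Variables (lo hi : 'I_3 -> int).
Hypothesis lo_le_hi : forall r, lo r <= hi r.
Hypothesis rowsP : forall (r : 'I_3) P, dot u P = c + r%:Z ->
  lattice_member R v P <-> lo r <= dot w P <= hi r.

Lemma interior_direction z (d : 'rV[R]_2) : interior D z ->
  exists2 t : R, 0 < t & D (z + t *: d).
Proof.
move=> /nbhs_ballP[e /= e0 be].
pose K := 1 + \sum_j `|d 0 j|.
have K0 : 0 < K by rewrite ltr_wpDr // sumr_ge0.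
exists (e / 2 / K); first by rewrite !divr_gt0.
apply: be; split=> // i j; rewrite /ball /= !mxE opprD addrA subrr add0r normrN.
have dK : `|d i j| <= K.
  by rewrite (ord1 i) /K (bigD1 j) //= addrCA lerDl addr_ge0 // sumr_ge0.
rewrite normrM gtr0_norm ?divr_gt0 //.
apply: (@le_lt_trans _ _ (e / 2 / K * K)).
  by rewrite ler_wpM2l // ltW // !divr_gt0.
by rewrite divfK ?gt_eqF //; lra.
Qed.

Lemma hull_rows x : D x -> c%:~R <= linear_form u x <= (c + 2)%:~R.
Proof.
move=> Dx; apply/andP; split.
  by apply: hull_form_ge Dx => i; rewrite ler_int; case/andP: (vertex_rows i).
by apply: hull_form_le Dx => i; rewrite ler_int; case/andP: (vertex_rows i).
Qed.

(** The line of the middle row cuts the polygon in a chord whose left end is the smaller of lo_1 and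
    (lo_0 + lo_2) / 2, and similarly on the right; doubling keeps everything integral. Small moves
    in the four coordinate directions give the strict inequalities. *)
Lemma interior_middle P : interior D (lattice_embed R P) ->
  dot u P = c + 1 /\
  Num.min (lo row1 * 2) (lo row0 + lo row2) < dot w P * 2
    < Num.max (hi row1 * 2) (hi row0 + hi row2).
Proof.
move=> intP.
have dir h i : exists2 t : R, 0 < t & exists2 x, D x &
    linear_form u x = (dot u P)%:~R + t * h%:~R /\
    linear_form w x = (dot w P)%:~R + t * i%:~R.
  have [Q hQ wQ] := dot_surj det_uw h i.
  have [t t0 Dt] := interior_direction (lattice_embed R Q) intP.
  exists t => //; exists (lattice_embed R P + t *: lattice_embed R Q) => //.
  by rewrite !linear_formD !linear_formZ !linear_form_embed hQ wQ.
have hP : dot u P = c + 1.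
  have [t t0 [x /hull_rows/andP[h1 _] [hx _]]] := dir (-1) 0.
  have [t' t'0 [x' /hull_rows/andP[_ h2] [hx' _]]] := dir 1 0.
  rewrite hx intrN in h1; rewrite hx' in h2.
  have : dot u P < c + 2 by rewrite -(ltr_int R); lra.
  have : c < dot u P by rewrite -(ltr_int R); lra.
  lia.
split=> //; apply/andP; split.
  have [t t0 [x Dx [hx wx]]] := dir 0 (-1).
  have [a [a0 a1 ha la _]] := hull_row_weights vertex_rows rowsP Dx.
  rewrite ltNge; apply/negP; rewrite le_min => /andP[le1 le2].
  (* At the height of the middle row the outer rows have equal weights. *)
  have e02 : a row0 = a row2.
    by move: ha; rewrite hx hP intrD mulr0; lra.
  have l1 : (dot w P)%:~R <= (lo row1)%:~R :> R by rewrite ler_int; lia.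
  have l2 : (dot w P)%:~R * 2 <= (lo row0)%:~R + (lo row2)%:~R :> R.
    by rewrite -intrD -[2]/(2%:~R) -intrM ler_int.
  have p1 : a row1 * (dot w P)%:~R <= a row1 * (lo row1)%:~R by rewrite ler_wpM2l.
  have p2 : a row2 * ((dot w P)%:~R * 2) <= a row2 * ((lo row0)%:~R + (lo row2)%:~R).
    by rewrite ler_wpM2l.
  have aP : a row1 * (dot w P)%:~R + a row2 * ((dot w P)%:~R * 2) = (dot w P)%:~R.
    by transitivity ((a row0 + a row1 + a row2) * (dot w P)%:~R); [rewrite e02; ring|rewrite a1 mul1r].
  by move: la; rewrite wx e02 intrN; lra.
have [t t0 [x Dx [hx wx]]] := dir 0 1.
have [a [a0 a1 ha _ la]] := hull_row_weights vertex_rows rowsP Dx.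
rewrite ltNge; apply/negP; rewrite ge_max => /andP[le1 le2].
have e02 : a row0 = a row2.
  by move: ha; rewrite hx hP intrD mulr0; lra.
have l1 : (hi row1)%:~R <= (dot w P)%:~R :> R by rewrite ler_int; lia.
have l2 : (hi row0)%:~R + (hi row2)%:~R <= (dot w P)%:~R * 2 :> R.
  by rewrite -intrD -[2]/(2%:~R) -intrM ler_int.
have p1 : a row1 * (hi row1)%:~R <= a row1 * (dot w P)%:~R by rewrite ler_wpM2l.
have p2 : a row2 * ((hi row0)%:~R + (hi row2)%:~R) <= a row2 * ((dot w P)%:~R * 2).
  by rewrite ler_wpM2l.
have aP : a row1 * (dot w P)%:~R + a row2 * ((dot w P)%:~R * 2) = (dot w P)%:~R.
  by transitivity ((a row0 + a row1 + a row2) * (dot w P)%:~R); [rewrite e02; ring|rewrite a1 mul1r].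
by move: la; rewrite wx e02; lra.
Qed.

(** The section of the triangle with base xl, xr and apex t at the relative height eta. *)
Lemma hull_fan (eta : R) xl xr t x : 0 <= eta < 1 -> D xl -> D xr -> D t ->
  let m := (1 - eta) * linear_form u xl + eta * linear_form u t in
  linear_form u xl = linear_form u xr -> linear_form u x = m ->
  (1 - eta) * linear_form w xl + eta * linear_form w t <= linear_form w x ->
  linear_form w x <= (1 - eta) * linear_form w xr + eta * linear_form w t ->
  D x.
Proof.
move=> /andP[e0 e1] Dl Dr Dt m hlr hx lx rx.
have Dl' := hull_convex2 (a := 1 - eta) (_ : 0 <= 1 - eta <= 1) Dl Dt.
have Dr' := hull_convex2 (a := 1 - eta) (_ : 0 <= 1 - eta <= 1) Dr Dt.
have e01 : 0 <= 1 - eta <= 1 by lra.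
move: (Dl' e01) (Dr' e01) => {}Dl' {}Dr'; rewrite subKr in Dl' Dr'.
set yl := _ + _ in Dl'; set yr := _ + _ in Dr'.
have hyl : linear_form u yl = linear_form u x.
  by rewrite hx linear_formD !linear_formZ.
have hyr : linear_form u yr = linear_form u x.
  by rewrite hx linear_formD !linear_formZ -hlr.
have wl : linear_form w yl <= linear_form w x by rewrite linear_formD !linear_formZ.
have wr : linear_form w x <= linear_form w yr by rewrite linear_formD !linear_formZ.
have [lr|lr] := eqVneq (linear_form w yl) (linear_form w yr).
  have -> : x = yl; last by [].
  by apply: (linear_form_inj det_uw); [rewrite hyl | lra].
have lr0 : 0 < linear_form w yr - linear_form w yl.
  by rewrite subr_gt0 lt_neqAle lr; lra.
pose b := (linear_form w yr - linear_form w x) / (linear_form w yr - linear_form w yl).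
have bE : b * (linear_form w yr - linear_form w yl) = linear_form w yr - linear_form w x.
  by rewrite divfK // gt_eqF.
apply: (hull_mix det_uw (a := b) _ Dl' Dr'); rewrite ?hyl ?hyr.
- apply/andP; split; first by rewrite /b divr_ge0 //; lra.
  by rewrite ler_pdivrMr // mul1r; lra.
- ring.
- lra.
Qed.

(** A chord reaching beyond P on both sides, joined to a point of the top row and one of the bottom
    row, gives two triangles that together surround P. *)
Lemma middle_interior P : dot u P = c + 1 ->
  Num.min (lo row1 * 2) (lo row0 + lo row2) < dot w P * 2
    < Num.max (hi row1 * 2) (hi row0 + hi row2) ->
  interior D (lattice_embed R P).
Proof.
move=> hP /andP[lw wh].
have cell r j : lo r <= j <= hi r -> exists2 x, D x &
    linear_form u x = (c + r%:Z)%:~R /\ linear_form w x = j%:~R.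
  move=> jr; have [Q [hQ wQ LQ]] := cell_point det_uw rowsP jr.
  by exists (lattice_embed R Q) => //; rewrite !linear_form_embed hQ wQ.
have loc r : lo r <= lo r <= hi r by rewrite lexx lo_le_hi.
have hic r : lo r <= hi r <= hi r by rewrite lexx lo_le_hi.
have half : 0 <= (1 / 2 : R) <= 1 by lra.
have [xl Dl [hl wl]] : exists2 x, D x & linear_form u x = (c + 1)%:~R /\
    linear_form w x < (dot w P)%:~R.
  move: lw; rewrite gt_min => /orP[lt1|lt1].
    have [x Dx [hx wx]] := cell _ _ (loc row1); exists x => //; split=> //.
    by rewrite wx ltr_int; lia.
  have [x0 Dx0 [hx0 wx0]] := cell _ _ (loc row0).
  have [x2 Dx2 [hx2 wx2]] := cell _ _ (loc row2).
  exists (1 / 2 *: x0 + (1 - 1 / 2) *: x2); first exact: hull_convex2.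
  rewrite !linear_formD !linear_formZ hx0 wx0 hx2 wx2; split.
    by rewrite !intrD /=; lra.
  by move: lt1; rewrite -(ltr_int R) intrD intrM; lra.
have [xr Dr [hr wr]] : exists2 x, D x & linear_form u x = (c + 1)%:~R /\
    (dot w P)%:~R < linear_form w x.
  move: wh; rewrite lt_max => /orP[lt1|lt1].
    have [x Dx [hx wx]] := cell _ _ (hic row1); exists x => //; split=> //.
    by rewrite wx ltr_int; lia.
  have [x0 Dx0 [hx0 wx0]] := cell _ _ (hic row0).
  have [x2 Dx2 [hx2 wx2]] := cell _ _ (hic row2).
  exists (1 / 2 *: x0 + (1 - 1 / 2) *: x2); first exact: hull_convex2.
  rewrite !linear_formD !linear_formZ hx0 wx0 hx2 wx2; split.
    by rewrite !intrD /=; lra.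
  by move: lt1; rewrite -(ltr_int R) intrD intrM; lra.
have [xb Db [hb wb]] := cell _ _ (loc row0).
have [xt Dt [ht wt]] := cell _ _ (loc row2).
pose i : R := (dot w P)%:~R.
pose p := linear_form w xl; pose q := linear_form w xr.
pose M : R := 2 + `|linear_form w xt - p| + `|linear_form w xt - q|
  + `|linear_form w xb - p| + `|linear_form w xb - q|.
have n1 := normr_ge0 (linear_form w xt - p).
have n2 := normr_ge0 (linear_form w xt - q).
have n3 := normr_ge0 (linear_form w xb - p).
have n4 := normr_ge0 (linear_form w xb - q).
have M2 : 2 <= M by rewrite /M; lra.
(* A vertical move by at most e displaces the sides of the triangles inwards by at most e (M - 1),
   and the horizontal move is at most e. Their sum e M must not exceed the distances from P to the
   ends of the chord. *)
pose e := Num.min 1 (Num.min (i - p) (q - i)) / M.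
have e0 : 0 < e.
  rewrite divr_gt0 //; last by lra.
  by rewrite !lt_min ltr01 !subr_gt0 wl wr.
have eM : e * M = Num.min 1 (Num.min (i - p) (q - i)) by rewrite divfK // gt_eqF //; lra.
have eM1 : e * M <= 1 by rewrite eM ge_min lexx.
have eMp : e * M <= i - p by rewrite eM !ge_min lexx orbT.
have eMq : e * M <= q - i by rewrite eM !ge_min lexx !orbT.
have e12 : e <= 1 / 2.
  have : e * 2 <= e * M by rewrite ler_wpM2l // ltW.
  lra.
have [d d0 dP] := near_linear_forms u w (lattice_embed R P) e0.
apply/nbhs_ballP; exists d => //= x /dP[].
rewrite !linear_form_embed hP -/i !ler_norml => /andP[h1 h2] /andP[w1 w2].
have small (eta s : R) : 0 <= eta <= e -> `|s| + 1 <= M -> eta * s + e <= e * M.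
  move=> /andP[eta0 etae] sM.
  apply: (@le_trans _ _ (e * `|s| + e)).
    rewrite lerD2r; apply: (@le_trans _ _ (eta * `|s|)).
      by rewrite ler_wpM2l // ler_norm.
    by rewrite ler_wpM2r.
  rewrite -[X in _ + X]mulr1 -mulrDr ler_wpM2l //; exact: ltW.
have M1 : `|linear_form w xt - p| + 1 <= M by rewrite /M; lra.
have M2' : `|- (linear_form w xt - q)| + 1 <= M by rewrite normrN /M; lra.
have M3 : `|linear_form w xb - p| + 1 <= M by rewrite /M; lra.
have M4 : `|- (linear_form w xb - q)| + 1 <= M by rewrite normrN /M; lra.
have hcR : (c + 1)%:~R = c%:~R + 1 :> R by rewrite intrD.
rewrite hcR in hl hr h1 h2.
move: ht hb; rewrite !intrD /= addr0 => ht hb.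
have [up|down] := leP (c%:~R + 1) (linear_form u x).
  pose eta := linear_form u x - (c%:~R + 1).
  have etae : 0 <= eta <= e by rewrite /eta; lra.
  have s1 := small _ _ etae M1; have s2 := small _ _ etae M2'.
  apply: (@hull_fan eta xl xr xt) => //; rewrite ?hl ?hr ?ht -/p -/q /eta //.
  - by lra.
  - by lra.
  - by move: s1; rewrite /eta; lra.
  - by move: s2; rewrite /eta; lra.
pose eta := (c%:~R + 1) - linear_form u x.
have etae : 0 <= eta <= e by rewrite /eta; lra.
have s1 := small _ _ etae M3; have s2 := small _ _ etae M4.
apply: (@hull_fan eta xl xr xb) => //; rewrite ?hl ?hr ?hb -/p -/q /eta //.
- by lra.
- by lra.
- by move: s1; rewrite /eta; lra.
- by move: s2; rewrite /eta; lra.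
Qed.

End LatticeInterior.

(** * Numbers of lattice points *)

Lemma card_interval (T : finType) (f : T -> int) (A : {set T}) (a : int) (m : nat) :
  {in A &, injective f} -> (forall x, x \in A -> a <= f x < a + m%:Z) ->
  (forall j, a <= j < a + m%:Z -> exists2 x, x \in A & f x = j) -> #|A| = m.
Proof.
move=> f_inj f_bounds f_surj.
suff /perm_size : perm_eq [seq f x | x <- enum A] [seq a + i%:Z | i <- iota 0 m].
  by rewrite !size_map size_iota -cardE.
apply: uniq_perm.
- rewrite map_inj_in_uniq ?enum_uniq // => x y.
  by rewrite !mem_enum; exact: f_inj.
- by rewrite map_inj_uniq ?iota_uniq // => i j /addrI[].
move=> j; apply/mapP/mapP => [[x]|[i]].
  rewrite mem_enum => /f_bounds fx ->; exists `|f x - a|%N; last by lia.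
  by rewrite mem_iota; lia.
rewrite mem_iota => im ->; have [|x xA fx] := f_surj (a + i%:Z); first by lia.
by exists x; rewrite ?mem_enum.
Qed.

Lemma lattice_pointsP (R : realType) (S : set 'rV[R]_2) P :
  finite_set (@lattice_embed R @^-1` S) ->
  (P \in lattice_points S) <-> S (lattice_embed R P).
Proof. by move=> fS; rewrite in_fset_set //; split=> [/set_mem|SP]; last exact: mem_set. Qed.

Section LatticePointCounts.
Variables (R : realType) (u w : 'rV[int]_2).
Hypothesis det_uw : u 0 0 * w 0 1 - u 0 1 * w 0 0 = 1.
Implicit Types (P Q : 'rV[int]_2) (x y z : 'rV[R]_2).
Variables (n : nat) (v : 'I_n -> 'rV[int]_2) (c : int).
Local Notation D := (lattice_hull (R := R) v).
Hypothesis vertex_rows : forall i, c <= dot u (v i) <= c + 2.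
Hypothesis dim2 : two_dimensional D.
Variables (lo hi : 'I_3 -> int).
Hypothesis lo_le_hi : forall r, lo r <= hi r.
Hypothesis rowsP : forall (r : 'I_3) P, dot u P = c + r%:Z ->
  lattice_member R v P <-> lo r <= dot w P <= hi r.

Lemma finite_box (S : set 'rV[int]_2) (B : int) :
  (forall P, S P -> `|dot u P| <= B /\ `|dot w P| <= B) -> finite_set S.
Proof.
move=> SB.
have /boolp.choice[f fP] (hi0 : int * int) : exists P, dot u P = hi0.1 /\ dot w P = hi0.2.
  by have [P hP wP] := dot_surj det_uw hi0.1 hi0.2; exists P.
pose r := [seq i%:Z - B | i <- iota 0 `|B * 2 + 1|].
have in_r (i : int) : `|i| <= B -> i \in r.
  move=> iB; apply/mapP; exists (absz (i + B)); last by lia.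
  by rewrite mem_iota; lia.
apply: sub_finite_set (finite_seq [seq f (h, i) | h <- r, i <- r]) => P /SB[hB wB] /=.
apply/allpairsP; exists (dot u P, dot w P); rewrite !in_r //; split=> //.
have [hf wf] := fP (dot u P, dot w P).
by apply: (dot_inj det_uw).
Qed.

Lemma hull_form_bounded (s : 'rV[int]_2) x : D x ->
  `|linear_form s x| <= (\sum_i `|dot s (v i)|)%:~R.
Proof.
move=> Dx; have B i : `|dot s (v i)| <= \sum_i `|dot s (v i)|.
  by rewrite (bigD1 i) //= lerDl sumr_ge0.
rewrite ler_norml; apply/andP; split.
  by apply: hull_form_ge Dx => i; rewrite -intrN ler_int; have := B i; lia.
by apply: hull_form_le Dx => i; rewrite ler_int; have := B i; lia.
Qed.

Lemma finite_dilate (q : int) : finite_set (@lattice_embed R @^-1` dilate q D).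
Proof.
pose B := \sum_i `|dot u (v i)| + \sum_i `|dot w (v i)|.
apply: (@finite_box _ (`|q| * B)) => P [_ [y Dy PE]].
have [B1 B2] : 0 <= \sum_i `|dot u (v i)| /\ 0 <= \sum_i `|dot w (v i)|.
  by split; apply: sumr_ge0.
have E s : (`|dot s P|)%:~R = `|q%:~R| * `|linear_form s y|.
  by rewrite -normrM -linear_formZ -PE linear_form_embed intr_norm.
split; rewrite -(ler_int R) E intrM intr_norm ler_wpM2l //.
  apply: le_trans (hull_form_bounded u Dy) _.
  by rewrite ler_int lerDl.
apply: le_trans (hull_form_bounded w Dy) _.
by rewrite ler_int lerDr.
Qed.

Lemma finite_polygon : finite_set (@lattice_embed R @^-1` D).
Proof.
apply: sub_finite_set (finite_dilate 1) => P DP /=; split=> //.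
by exists (lattice_embed R P) => //; rewrite scale1r.
Qed.

Lemma finite_interior : finite_set (@lattice_embed R @^-1` interior D).
Proof.
by apply: sub_finite_set finite_polygon => P /=; exact: interior_subset.
Qed.

(** Each row would be a single point and the middle one the midpoint of the others, so that the
    polygon would be a segment. *)
Lemma not_all_degenerate : ~ [/\ lo row1 = hi row1,
  lo row1 * 2 <= lo row0 + lo row2 & hi row0 + hi row2 <= hi row1 * 2].
Proof.
move=> [e1 l2 h2].
have := lo_le_hi row0; have := lo_le_hi row2 => le2 le0.
have e0 : hi row0 = lo row0 by lia.
have e2 : hi row2 = lo row2 by lia.
have em : lo row0 + lo row2 = lo row1 * 2 by lia.
have emR : (lo row0)%:~R + (lo row2)%:~R = (lo row1)%:~R * 2 :> R.
  by rewrite -intrD em intrM.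
pose s : R := ((lo row2)%:~R - (lo row0)%:~R) / 2.
apply: (not_collinear det_uw dim2 (p := (lo row0)%:~R - s * c%:~R) (s := s)) => x Dx.
have [a [a0 a1 -> lx hx]] := hull_row_weights vertex_rows rowsP Dx.
rewrite e0 -e1 e2 in hx.
have -> : linear_form w x =
    a row0 * (lo row0)%:~R + a row1 * (lo row1)%:~R + a row2 * (lo row2)%:~R by lra.
have -> : (lo row1)%:~R = ((lo row0)%:~R + (lo row2)%:~R) / 2 :> R by lra.
have -> : a row0 = 1 - a row1 - a row2 by lra.
by rewrite /s; field.
Qed.

Lemma row_point r j : lo r <= j <= hi r ->
  exists2 P, P \in lattice_points D & dot u P = c + r%:Z /\ dot w P = j.
Proof.
move=> jr; have [P [hP wP LP]] := cell_point det_uw rowsP jr.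
by exists P => //; apply/(lattice_pointsP _ finite_polygon).
Qed.

Section Cells.
Local Notation I := (lattice_points D).
Variable row : I -> 'I_3.
Hypothesis dot_row : forall P : I, dot u (val P) = c + (row P)%:Z.
Let col (P : I) : int := dot w (val P).

Lemma cell_col_bounds (P : I) : lo (row P) <= col P <= hi (row P).
Proof.
apply/(rowsP (dot_row P)).
by apply/(lattice_pointsP _ finite_polygon); exact: valP.
Qed.

Lemma cell_coord_inj (P Q : I) : row P = row Q -> col P = col Q -> P = Q.
Proof.
by move=> rPQ cPQ; apply/val_inj/(dot_inj det_uw); rewrite ?dot_row ?rPQ.
Qed.

Lemma cell_coord_surj r j : lo r <= j <= hi r -> exists2 P : I, row P = r & col P = j.
Proof.
move=> /row_point[P PD [hP wP]]; exists [` PD]%fset => //.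
apply: val_inj; have := dot_row [` PD]%fset.
by rewrite /= hP => /addrI[].
Qed.

(** The flag s leaves out the first cell of the row, so that lattice points and free cells are
    counted together. *)
Lemma card_row_cells r (s : bool) :
  #|[set P : I | (row P == r) && (s ==> (col P != lo r))]%SET| =
  (absz (hi r - lo r + 1)%R - s)%N.
Proof.
have lh := lo_le_hi r.
apply: (@card_interval _ col _ (lo r + s%:Z)).
- move=> P Q; rewrite !inE => /andP[/eqP rP _] /andP[/eqP rQ _].
  by apply: cell_coord_inj; rewrite rP.
- move=> P; rewrite inE => /andP[/eqP rP cP].
  have := cell_col_bounds P; rewrite rP; case: s cP => /= [/eqP|_]; lia.
- move=> j jr; have [|P rP cP] := @cell_coord_surj r j; first by lia.
  exists P => //; rewrite inE rP eqxx cP /=.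
  by case: s jr => //= jr; apply/eqP; lia.
Qed.

Lemma card_cells (A : {set I}) (s : bool) :
  (forall P : I, (P \in A) = (s ==> (col P != lo (row P)))) ->
  #|A| = ((absz (hi row0 - lo row0 + 1)%R - s) + (absz (hi row1 - lo row1 + 1)%R - s) +
    (absz (hi row2 - lo row2 + 1)%R - s))%N.
Proof.
move=> AE; rewrite -sum1_card (partition_big row xpredT) //=.
rewrite (eq_bigr (fun r => absz (hi r - lo r + 1)%R - s)%N) ?sum_rows // => r _.
rewrite -card_row_cells -sum1_card; apply: eq_bigl => P; rewrite inE AE andbC.
by case: eqP => //= ->.
Qed.

Lemma card_lattice_points : #|` lattice_points D| =
  (absz (hi row0 - lo row0)%R + absz (hi row1 - lo row1)%R + absz (hi row2 - lo row2)%R + 3)%N.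
Proof.
rewrite cardfE -cardsT (card_cells (s := false)); last by move=> P; rewrite inE.
by have := lo_le_hi row0; have := lo_le_hi row1; have := lo_le_hi row2; lia.
Qed.

Lemma card_free_cells : #|free_cells row col lo| =
  (absz (hi row0 - lo row0)%R + absz (hi row1 - lo row1)%R + absz (hi row2 - lo row2)%R)%N.
Proof.
rewrite (card_cells (s := true)); last by move=> P; rewrite inE.
by have := lo_le_hi row0; have := lo_le_hi row1; have := lo_le_hi row2; lia.
Qed.

End Cells.

(** With a <= j < b the columns of the interior points, [conic_lo + a] is the sum of the left ends
    plus 1, and [conic_hi + b] is the sum of the right ends, whichever case occurs on either
    side. *)
Lemma card_interior_points :
  conic_hi hi - conic_lo lo + #|` lattice_points (interior D)|%:Z + 4 =
  (hi row0 - lo row0) + (hi row1 - lo row1) + (hi row2 - lo row2) + 3.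
Proof.
(* If the chord begins at the first middle lattice point, that point is on the boundary. Otherwise,
   by [lo_middle], the chord begins half a unit earlier and the point is interior. The bound b is
   exclusive. *)
pose a := if lo row1 * 2 <= lo row0 + lo row2 then lo row1 + 1 else lo row1.
pose b := if hi row0 + hi row2 <= hi row1 * 2 then hi row1 else hi row1 + 1.
have lm := lo_middle det_uw lo_le_hi rowsP.
have hm := hi_middle det_uw lo_le_hi rowsP.
have lh0 := lo_le_hi row0; have lh1 := lo_le_hi row1; have lh2 := lo_le_hi row2.
have ab : a <= b.
  rewrite leNgt; apply/negP => ba; apply: not_all_degenerate.
  by move: ba; rewrite /a /b; case: ifP => l1; case: ifP => h1; split; lia.
have cardE : #|` lattice_points (interior D)| = `|b - a|%N.
  rewrite cardfE -cardsT.
  have intP (P : lattice_points (interior D)) : interior D (lattice_embed R (val P)).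
    by apply/(lattice_pointsP _ finite_interior); exact: valP.
  have mid (P : lattice_points (interior D)) :=
    interior_middle det_uw vertex_rows rowsP (intP P).
  apply: (@card_interval _ (fun P : lattice_points (interior D) => dot w (val P)) _ a).
  - move=> P Q _ _ wPQ; apply/val_inj/(dot_inj det_uw) => //.
    by rewrite (mid P).1 (mid Q).1.
  - move=> P _; have := (mid P).2; rewrite gt_min lt_max.
    by move: ab; rewrite /a /b; do 2!case: ifP; lia.
  - move=> j jab; have [P hP wP] := dot_surj det_uw (c + 1) j.
    have PI : P \in lattice_points (interior D).
      apply/(lattice_pointsP _ finite_interior).
      apply: (middle_interior det_uw lo_le_hi rowsP) => //; rewrite wP gt_min lt_max.
      by move: ab jab; rewrite /a /b; do 2!case: ifP; lia.
    by exists [` PI]%fset.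
rewrite cardE gez0_abs ?subr_ge0 // /conic_lo /conic_hi /a /b.
by do 2!case: ifP; lia.
Qed.

End LatticePointCounts.

(** * From the Betti numbers of scrolls to the closed formulas *)

Lemma posnE (x : int) : (posn x)%:R = Num.max x%:~R 0 :> rat.
Proof.
case: x => [m|m] /=; first by rewrite max_l // ler0z.
by rewrite max_r // lerz0.
Qed.

Lemma posnBN (x : int) : (posn x)%:R - (posn (- x))%:R = x%:~R :> rat.
Proof. by case: x => [[|m]|m] //=; rewrite ?subr0 ?sub0r ?subrr // NegzE intrN. Qed.

Lemma mul_bin_rat (F m : nat) :
  m.+1%:R * 'C(F, m.+1)%:R = (F%:R - m%:R) * 'C(F, m)%:R :> rat.
Proof.
have [mF|Fm] := leqP m F; first by rewrite -natrB // -!natrM mul_bin_left.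
by rewrite !bin_small ?mulr0 // ltnW.
Qed.

Theorem corollary5 (R : realType) (k : fieldType) (D : set 'rV[R]_2)
    (D_polygon : lattice_polygon D) (D_dim2 : two_dimensional D)
    (D_width2 : has_lattice_width D 2) :
  let N := #|` lattice_points D| in
  let N1 := #|` lattice_points (interior D)| in
  let A : rat := N%:R / 2 + N1%:R / 2 - 1 in
  [/\ forall p : nat,
        (kappa k D p 2)%:R =
          Num.max (p%:R - N%:R + N1%:R + 3) 0
            * (binomz (N%:Z - 3) p%:Z)%:R :> rat,
      forall p : nat,
        (kappa k D p 1)%:R =
          (if p is p'.+1 then kappa k D p' 2 else 0%N)%:R
            + p%:R * (binomz (N%:Z - 1) (p%:Z + 1))%:R
            - 2 * A * (binomz (N%:Z - 3) (p%:Z - 1))%:R :> rat,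
      kappa k D 0 0 = 1%N
    & forall p q : nat, (p, q) <> (0%N, 0%N) -> q <> 1%N -> q <> 2%N ->
        kappa k D p q = 0%N].
Proof.
have [n [v DE]] := D_polygon; rewrite {}DE in D_dim2 D_width2 *.
have [u [w [c [det_uw vrows vbot vtop]]]] := width2_coordinates D_dim2 D_width2.
have [lo [hi [lo_le_hi rowsP]]] := lattice_rows det_uw vrows vbot vtop D_dim2.
have finD := finite_polygon R det_uw v.
have /boolp.choice[row dot_row] (P : lattice_points (lattice_hull (R := R) v)) :
    exists r : 'I_3, dot u (val P) = c + r%:Z.
  have /(lattice_pointsP _ finD) LP := valP P.
  exact: three_rows (lattice_member_row vrows LP).
have cardN := card_lattice_points det_uw lo_le_hi rowsP dot_row.
have cardF := card_free_cells det_uw lo_le_hi rowsP dot_row.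
have cardN1 := card_interior_points det_uw vrows D_dim2 lo_le_hi rowsP.
have mem_dilate q P : P \in lattice_points (dilate q (lattice_hull (R := R) v)) <->
    surface lo hi q (dot u P - c * q, dot w P).
  apply: iff_trans (dilate_surface det_uw vrows D_dim2 lo_le_hi rowsP q P).
  exact: (lattice_pointsP _ (finite_dilate R det_uw v q)).
have kappaE p q := kappa_scroll_betti k (dotD u) (dotD w) (dot_inj det_uw)
  (dot_surj det_uw) dot_row mem_dilate (cell_col_bounds det_uw rowsP dot_row)
  (cell_coord_inj det_uw dot_row) (cell_coord_surj det_uw rowsP dot_row) lo_le_hi
  p q (conic_lo_hi det_uw lo_le_hi rowsP).
set F := #|free_cells _ _ _| in cardF kappaE.
move=> N N1; rewrite -/N in cardN; rewrite -/N1 in cardN1.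
(* Each of the three rows has exactly one cell that is not free. *)
have NE : N = (F + 3)%N by rewrite cardN cardF.
have bE : conic_hi hi - conic_lo lo = F%:Z - N1%:Z - 1.
  move: cardN1; rewrite cardF.
  by have := lo_le_hi row0; have := lo_le_hi row1; have := lo_le_hi row2; lia.
have {}kappaE p q : kappa k (lattice_hull (R := R) v) p q =
    (scroll_betti F 0 p q + scroll_betti F (F%:Z - N1%:Z - 1) (p%:Z - 1) (q%:Z - 1))%N.
  by rewrite kappaE bE.
have binF p : binomz (N%:Z - 3) p = binomz F p.
  by congr (binomz _ _); rewrite NE; lia.
have kappa2 p : kappa k (lattice_hull (R := R) v) p 2 =
    (posn (p%:Z + N1%:Z - F%:Z) * 'C(F, p))%N.
  rewrite kappaE /scroll_betti /= add0n subrK /=; congr (posn _ * _)%N; lia.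
move=> A; split.
- move=> p; rewrite kappa2 binF natrM posnE; congr (Num.max _ _ * _).
  by rewrite NE intrB intrD natrD -!pmulrn; ring.
- move=> p; rewrite kappaE binF.
  rewrite {1}/scroll_betti {1}/scroll_betti /= ?subrr /= addn0.
  case: p => [|p]; first by rewrite /= muln0 mul0n mulr0 mul0r subr0 addr0.
  rewrite kappa2 (_ : p.+1%:Z - 1 = p%:Z); last by lia.
  rewrite (_ : p.+1%:Z + 1 = p.+2%:Z); last by lia.
  rewrite (_ : N%:Z - 1 = F.+2%:Z); last by rewrite NE; lia.
  rewrite /binomz.
  rewrite (_ : F%:Z - N1%:Z - 1 + 1 - p%:Z = - (p%:Z + N1%:Z - F%:Z)); last by lia.
  (* The contribution of M(b) and the preceding second-row Betti number carry the same binomial,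
     with the negative and the positive part of one integer as factors. Their difference is linear,
     and what remains is a binomial identity. *)
  have := posnBN (p%:Z + N1%:Z - F%:Z); rewrite intrB intrD -!pmulrn.
  move: (posn (- _)) (posn _) => m m' mm'.
  have := mul_bin_rat F p; rewrite !binS !natrD !natrM => mb.
  have -> : m'%:R = m%:R + (p%:R + N1%:R - F%:R) :> rat by lra.
  move: mb; rewrite /A NE natrD -[p.+1]addn1 natrD.
  move: ('C(F, p.+2)%:R : rat) ('C(F, p + 1)%:R : rat) => x2 x1.
  move: ('C(F, p)%:R : rat) => x0; lra.
- by rewrite kappaE /scroll_betti /binomz /= bin0.
- move=> p q pq q1 q2; rewrite kappaE /scroll_betti.
  have [q0|q0] := eqVneq q 0%N.
    rewrite q0 in pq *; case: p pq => // p _ /=.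
    by rewrite (_ : posn _ = 0%N) //; case E: (_ - _) => [[|j]|j] //=; lia.
  rewrite !ifF ?addn0 //; apply/negbTE; lia.
Qed.
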